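(* For $\lambda,\mu\in\mathbb Z_+^n$ there exists a bijection $$J_{\mathcal A/\mathcal B}:\ SST_{\mathcal A/\mathcal B}(\lambda/\mu)\longrightarrow\bigsqcup_{\nu\in\mathscr P_{\mathcal A/\mathcal B,n}}SST_{\mathcal A/\mathcal B}(\nu)\times\mathbf{LR}^{\lambda/\mu}_{\nu}.$$ In terms of characters, $$S^{\mathcal A/\mathcal B}_{\lambda/\mu}=\sum_{\nu\in\mathscr P_{\mathcal A/\mathcal B,n}}c^{\lambda}_{\mu\,\nu}\,S^{\mathcal A/\mathcal B}_{\nu}.$$
   Context: $\mathcal A=\mathcal A_0\sqcup\mathcal A_1$ and $\mathcal B=\mathcal B_0\sqcup\mathcal B_1$ are at most countable, linearly ordered, $\mathbb Z_2$-graded sets; $n\ge1$. $\mathbb N=\{1<2<\dots\}$ with all elements of degree $0$. $\mathscr P_n$ is the set of partitions of length at most $n$, identified with Young diagrams; $(d^n)=(d,\dots,d)$ ($n$ entries). For a skew Young diagram $\lambda/\mu$, $SST_{\mathcal A}(\lambda/\mu)$ is the set of $\mathcal A$-semistandard tableaux: fillings with entries in $\mathcal A$, weakly increasing along rows (left to right) and columns (top to bottom), with entries of $\mathcal A_0$ strictly increasing in each column and entries of $\mathcal A_1$ strictly increasing in each row. The empty shape has exactly one tableau $\emptyset$. $SST_{\mathcal B}(\lambda/\mu)$ is defined in the same way. $\mathbb Z_+^n=\{\lambda\in\mathbb Z^n: \lambda_1\geq\dots\geq\lambda_n\}$ (generalized partitions of level $n$), with componentwise addition; $\mathbf 0_n=(0,\dots,0)$.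 For $\lambda,\mu\in\mathbb Z_+^n$, $SST_{\mathcal A/\mathcal B}(\lambda/\mu)$ (the $\mathcal A/\mathcal B$-semistandard tableaux of skew shape $\lambda/\mu$) is the set of pairs $(T^+,T^-)$ with $T^+\in SST_{\mathcal A}((\lambda+(d^n))/\nu)$ and $T^-\in SST_{\mathcal B}((\mu+(d^n))/\nu)$ for some integer $d\ge0$ and $\nu\in\mathscr P_n$ satisfying (1) $\lambda+(d^n),\mu+(d^n)\in\mathscr P_n$, and (2) $\nu\subset(d^n)$, $\nu\subset\lambda+(d^n)$ and $\nu\subset\mu+(d^n)$. Diagrams are placed in $n$ rows with column positions measured from a vertical line after column $d$, so that pairs arising from $(d,\nu)$ and from $(d+1,\nu+(1^n))$ with the same fillings are identified. $SST_{\mathcal A/\mathcal B}(\lambda)=SST_{\mathcal A/\mathcal B}(\lambda/\mathbf 0_n)$ and $\mathscr P_{\mathcal A/\mathcal B,n}=\{\lambda\in\mathbb Z_+^n: SST_{\mathcal A/\mathcal B}(\lambda)\neq\emptyset\}$. Characters: $S^{\mathcal A/\mathcal B}_{\lambda/\mu}=\sum_{(T^+,T^-)\in SST_{\mathcal A/\mathcal B}(\lambda/\mu)}\mathbf x_{\mathcal A}^{T^+}(\mathbf x_{\mathcal B}^{T^-})^{-1}\in\mathbb Z[[\mathbf x_{\mathcal A},\mathbf x_{\mathcal B}^{-1}]]$, where $\mathbf x^T=\prod_a x_a^{m_a}$, $m_a$ = number of occurrences of $a$ in $T$; $S^{\mathcal A/\mathcal B}_{\lambda}=S^{\mathcal A/\mathcal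 B}_{\lambda/\mathbf 0_n}$. Littlewood-Richardson tableaux: for partitions $\mu\subset\lambda$, $\nu$ with $|\lambda|=|\mu|+|\nu|$, $LR^{\lambda}_{\mu\,\nu}$ is the set of $T\in SST_{\mathbb N}(\lambda/\mu)$ in which $k$ occurs $\nu_k$ times for all $k$ and whose word, read column by column from right to left and top to bottom in each column, is a lattice permutation. Otherwise $LR^\lambda_{\mu\,\nu}=\emptyset$. $N^\lambda_{\mu\,\nu}=|LR^\lambda_{\mu\,\nu}|$. For $\lambda,\mu,\nu\in\mathbb Z_+^n$, $c^\lambda_{\mu\,\nu}=N^{\lambda+((p+q)^n)}_{\mu+(p^n)\,\nu+(q^n)}$ for all sufficiently large $p,q$. For $\lambda,\mu,\nu\in\mathscr P_n$ define bijections $\pi^n_{p,q}:LR^\lambda_{\mu\,\nu}\to LR^{\lambda+((p+q)^n)}_{\mu+(p^n)\,\nu+(q^n)}$ ($p,q\ge0$) as follows. $\pi^n_{k,0}$ regards $Q\in LR^\lambda_{\mu\,\nu}$ as the same filling of the translated shape, in $LR^{\lambda+(k^n)}_{\mu+(k^n)\,\nu}$. $\theta:LR^\lambda_{\mu\,\nu}\to LR^\lambda_{\nu\,\mu}$ is given by switching: fill $\mu$ with $H^\mu$ (the semistandard tableau all of whose $i$th-row entries are $i$) using one copy of $\mathbb N$ (inner letters), and $\lambda/\mu$ with $Q$ using a second disjoint copy (outer letters); repeatedly interchange an inner letter with an adjacent outer letter immediately below it or to its right, whenever after the interchange, for each copy separately, $u\le u'$ if $u$ is weakly northwest of $u'$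 and letters strictly increase down columns. After as many interchanges as possible the outer letters fill $\nu$ and the inner letters form a tableau of shape $\lambda/\nu$, independent of choices, which is $\theta(Q)$. Then $\pi^n_{p,q}=\theta\circ\pi^n_{q,0}\circ\theta\circ\pi^n_{p,0}$. For $\lambda,\mu,\nu\in\mathbb Z_+^n$ let $p,q$ be the smallest non-negative integers with $\mu+(p^n),\nu+(q^n),\lambda+((p+q)^n)\in\mathscr P_n$ (if the smallest pair is not unique, every choice gives the empty set) and set $\mathbf{LR}^{\lambda/\mu}_\nu=\{[Q]:Q\in LR^{\lambda+((p+q)^n)}_{\mu+(p^n)\,\nu+(q^n)}\}$, $[Q]=\{\pi^n_{s,t}(Q):s,t\ge0\}$.
   Formalization: In the definition of A/B-semistandard tableaux of shape λ/μ the condition ν ⊂ (d^n) is dropped, keeping ν ⊂ λ+(d^n) and ν ⊂ μ+(d^n); with it the claim fails, e.g. for n=1, λ=μ=(1), where the pair of empty tableaux would be excluded. *)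

(* Defs.v *)
From HB Require Import structures.
From Stdlib Require Export Relation_Operators.
From mathcomp Require Export all_boot all_order all_algebra finmap.
From mathcomp Require Export mathcomp_extra boolp classical_sets functions.
From mathcomp Require Export cardinality fsbigop.

Set Implicit Arguments.
Unset Strict Implicit.
Unset Printing Implicit Defensive.
Import Order.TTheory GRing.Theory Num.Theory.
Local Open Scope classical_set_scope.
Local Open Scope ring_scope.

Notation zvec n := {ffun 'I_n -> int}.

Definition gpart n : set (zvec n) :=
  [set lam | forall i j : 'I_n, (i <= j)%N -> lam j <= lam i].

(* Partitions of length at most n, padded with zeros to n parts. *)
Definition part n : set (zvec n) :=
  [set lam | gpart lam /\ forall i, 0 <= lam i].

(* The rectangle (d^n). *)
Definition rect n (d : nat) : zvec n := [ffun=> d%:Z].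

Definition subdiag n (mu lam : zvec n) : Prop := forall i, mu i <= lam i.

Definition psize n (lam : zvec n) : int := \sum_i lam i.

(* Row i of the diagram of lam occupies the columns 1, ..., lam i.  A filling
   is a partial map on the cells (row, column); its shape is its domain. *)
Notation filling n X := ('I_n * int -> option X).

Definition in_skew n (lam mu : zvec n) (c : 'I_n * int) : bool :=
  (mu c.1 < c.2) && (c.2 <= lam c.1).

Definition translate n X (k : nat) (T : filling n X) : filling n X :=
  fun c => T (c.1, c.2 - k%:Z).

(* The number of occurrences of x in T. *)
Definition wt n (X : eqType) (T : filling n X) (x : X) : nat :=
  #|` fset_set [set c | T c = Some x] |.

(* The Z_2-degree of a letter is given by deg, with [true] for degree 1. *)
Definition SST d (X : orderType d) (deg : X -> bool) n (lam mu : zvec n) :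
    set (filling n X) :=
  [set T | [/\ subdiag mu lam,
    forall c, T c <> None <-> in_skew lam mu c,
    forall (i : 'I_n) (j j' : int) a b, j < j' ->
      T (i, j) = Some a -> T (i, j') = Some b ->
      (a <= b)%O /\ (deg a -> deg b -> (a < b)%O)
  & forall (i i' : 'I_n) (j : int) a b, (i < i')%N ->
      T (i, j) = Some a -> T (i', j) = Some b ->
      (a <= b)%O /\ (~~ deg a -> ~~ deg b -> (a < b)%O) ]].

(* The columns of a pair (T+, T-) are numbered relative to the vertical line
   after column d, so that [translate d] puts it back on the diagrams of
   lam + (d^n) and mu + (d^n).  For mu = 0 the last inclusion says that nu is
   contained in (d^n).  For other mu this containment must not be required in
   addition: it would make the set depend on the position of (lam, mu), whereas
   c^lam_{mu,nu} is invariant under (lam, mu) |-> (lam + (1^n), mu + (1^n)).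
   With it, for n = 1 and lam = mu = (1), the pair of empty tableaux would be
   lost. *)
Definition SSTpair dA (A : orderType dA) (degA : A -> bool)
    dB (B : orderType dB) (degB : B -> bool) n (lam mu : zvec n) :
    set (filling n A * filling n B) :=
  [set T | exists (d : nat) (nu : zvec n),
    [/\ part nu,
        part (lam + rect n d) /\ part (mu + rect n d),
        subdiag nu (lam + rect n d) /\ subdiag nu (mu + rect n d),
        SST degA (lam + rect n d) nu (translate d T.1)
      & SST degB (mu + rect n d) nu (translate d T.2) ]].

Definition SSTpair0 dA (A : orderType dA) (degA : A -> bool)
    dB (B : orderType dB) (degB : B -> bool) n (lam : zvec n) :=
  SSTpair degA degB lam 0.

Definition PAB dA (A : orderType dA) (degA : A -> bool)
    dB (B : orderType dB) (degB : B -> bool) n : set (zvec n) :=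
  [set lam | gpart lam /\ SSTpair0 degA degB lam !=set0].

Arguments PAB {dA A} degA {dB B} degB n _.

(* The pair of exponents (e, f) stands for the monomial x_A^e (x_B^-1)^f, and
   an element of Z[[x_A, x_B^-1]] is its family of coefficients. *)
Notation monom A B :=
  ({fsfun A -> nat with 0%N} * {fsfun B -> nat with 0%N})%type.

Definition has_monom (A B : choiceType) n (T : filling n A * filling n B)
    (m : monom A B) : Prop :=
  (forall a, wt T.1 a = m.1 a) /\ (forall b, wt T.2 b = m.2 b).

(* The sum has finite support in each coefficient. *)
Definition schar dA (A : orderType dA) (degA : A -> bool)
    dB (B : orderType dB) (degB : B -> bool) n (lam mu : zvec n)
    (m : monom A B) : int :=
  \sum_(T \in SSTpair degA degB lam mu) (`[< has_monom T m >] : nat)%:Z.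

Definition schar0 dA (A : orderType dA) (degA : A -> bool)
    dB (B : orderType dB) (degB : B -> bool) n (lam : zvec n)
    (m : monom A B) : int :=
  schar degA degB lam 0 m.

(* Littlewood-Richardson tableaux: the letter k of {1 < 2 < ...} is encoded by
   k - 1 : nat. *)

Definition maxcol n (lam : zvec n) : nat := (\max_(i < n) `|lam i|)%N.

(* For a partition lam all the cells lie in the columns 1, ..., maxcol lam. *)
Definition word n (lam : zvec n) (T : filling n nat) : seq nat :=
  pmap T [seq (i, j%:Z) | j <- rev (iota 1 (maxcol lam)), i <- enum 'I_n].

Definition lattice (w : seq nat) : Prop :=
  forall m k : nat,
    (count_mem k.+1 (take m w) <= count_mem k (take m w))%N.

Definition coord n (nu : zvec n) (k : nat) : int := oapp nu 0 (insub k).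

Definition LR n (lam mu nu : zvec n) : set (filling n nat) :=
  [set T | [/\ [/\ part lam, part mu & part nu],
    subdiag mu lam /\ psize lam = psize mu + psize nu,
    SST (fun _ : nat => false) lam mu T,
    forall k, (wt T k)%:Z = coord nu k
  & lattice (word lam T) ]].

Definition LRnum n (lam mu nu : zvec n) : nat := #|` fset_set (LR lam mu nu) |.

(* The common value of LRnum for all sufficiently large p, q. *)
Definition LRcoef n (lam mu nu : zvec n) : nat :=
  xget 0%N [set m | exists M : nat, forall p q : nat,
    (M <= p)%N -> (M <= q)%N ->
    LRnum (lam + rect n (p + q)) (mu + rect n p) (nu + rect n q) = m].

(* Switching: [inl] tags the inner letters and [inr] the outer ones. *)

Definition inner n (S : filling n (nat + nat)) : filling n nat :=
  fun c => if S c is Some (inl a) then Some a else None.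

Definition outer n (S : filling n (nat + nat)) : filling n nat :=
  fun c => if S c is Some (inr a) then Some a else None.

Definition perforated n (T : filling n nat) : Prop :=
  forall (i i' : 'I_n) (j j' : int) a b,
    T (i, j) = Some a -> T (i', j') = Some b ->
    (i <= i')%N -> j <= j' ->
    (a <= b)%N /\ (j = j' -> (i < i')%N -> (a < b)%N).

Definition below_or_right n (c c' : 'I_n * int) : Prop :=
  (c'.1 = c.1.+1 :> nat /\ c'.2 = c.2) \/ (c'.1 = c.1 /\ c'.2 = c.2 + 1).

Definition interchange n X (S : filling n X) (c c' : 'I_n * int) :
    filling n X :=
  fun x => if x == c then S c' else if x == c' then S c else S x.

Definition switch n (S S' : filling n (nat + nat)) : Prop :=
  exists c c' : 'I_n * int,
    [/\ below_or_right c c',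
        inner S c <> None /\ outer S c' <> None,
        S' = interchange S c c'
      & perforated (inner S') /\ perforated (outer S') ].

(* H^mu (row i filled with the i-th letter) inside, Q outside. *)
Definition switch_init n (mu : zvec n) (Q : filling n nat) :
    filling n (nat + nat) :=
  fun c => if in_skew mu 0 c then Some (inl (c.1 : nat)) else omap inr (Q c).

(* The graph of theta on the tableaux Q of inner shape mu: some maximal sequence
   of interchanges leads from Q to Q'. *)
Definition theta n (mu : zvec n) (Q Q' : filling n nat) : Prop :=
  exists S : filling n (nat + nat),
    [/\ clos_refl_trans _ (@switch n) (switch_init mu Q) S,
        forall S', ~ switch S S'
      & Q' = inner S ].

(* The graph of pi_{p,q} on LR^lam_{mu,nu}; the four maps are, in turn,
   pi_{p,0}, theta, pi_{q,0} and theta, through the inner shapes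
   mu + (p^n), nu, nu + (q^n) and mu + (p^n). *)
Definition pi_LR n (mu nu : zvec n) (p q : nat) (Q Q' : filling n nat) : Prop :=
  exists2 Q1, theta (mu + rect n p) (translate p Q) Q1
            & theta (nu + rect n q) (translate q Q1) Q'.

Definition LRclass n (mu nu : zvec n) (Q : filling n nat) :
    set (filling n nat) :=
  [set Q' | exists s t : nat, pi_LR mu nu s t Q Q'].

Definition admissible n (lam mu nu : zvec n) (p q : nat) : Prop :=
  [/\ part (mu + rect n p), part (nu + rect n q) & part (lam + rect n (p + q))].

Definition smallest n (lam mu nu : zvec n) (p q : nat) : Prop :=
  admissible lam mu nu p q /\
  forall p' q', admissible lam mu nu p' q' ->
    (p' <= p)%N -> (q' <= q)%N -> p' = p /\ q' = q.

Definition bLR n (lam mu nu : zvec n) : set (set (filling n nat)) :=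
  [set C | exists p q : nat, smallest lam mu nu p q /\
    exists2 Q, LR (lam + rect n (p + q)) (mu + rect n p) (nu + rect n q) Q
             & C = LRclass (mu + rect n p) (nu + rect n q) Q].

(* The disjoint union over nu of SST_{A/B}(nu) x LR^{lam/mu}_nu. *)
Definition LRunion dA (A : orderType dA) (degA : A -> bool)
    dB (B : orderType dB) (degB : B -> bool) n (lam mu : zvec n) :
    set (zvec n * ((filling n A * filling n B) * set (filling n nat))) :=
  [set x | [/\ PAB degA degB n x.1, SSTpair0 degA degB x.1 x.2.1
             & bLR lam mu x.1 x.2.2]].

(* Main.v *)
(** Both sides are counted in the ring of symmetric Laurent polynomials in n
variables, acting by shifts on the antisymmetric functions on Z^n, where the
alternants stand for the generalized partitions.  By Pieri's rule, removing and
adding horizontal and vertical strips is multiplication by h_k or e_k, in the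
variables or their inverses, so the A/B-semistandard tableaux of shape lam/mu and
given weight are counted by the coefficient of lam in F s_mu, where F is a product
of such factors that depends on the weight only.  Expanding F and using that
s_mu s_nu is the sum of the c^lam_{mu,nu} s_lam gives the character identity.
The Littlewood-Richardson rule itself is obtained from the Jacobi-Trudi
determinant by Gasharov's sign-reversing involution.

A weight-preserving bijection exists because the sets of a given weight are finite
and have the same cardinality.  This needs the classes [Q] to be as many as the
tableaux Q, that is, theta to be well defined and invertible.  Legal interchanges
satisfy a strong diamond property, so maximal sequences of interchanges have a
common end, and reversing them exchanges the roles of the two alphabets.  That the
outer letters end up as H^nu follows by choosing the order of the interchanges:
letter by letter, keeping a row form of the lattice condition. *)
From Stdlib Require Import Operators_Properties.
From mathcomp Require Import fingroup zify.
Require Import Defs.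
From mathcomp Require Import perm.
Set Implicit Arguments.
Unset Strict Implicit.
Unset Printing Implicit Defensive.
Import Order.TTheory GRing.Theory Num.Theory.
Local Open Scope classical_set_scope.
Local Open Scope ring_scope.

(** * Alternants and shift operators *)

(** Functions on Z^n replace quotients by the Vandermonde determinant, so that nothing has to be
    divided and inverse variables need no separate treatment. Two facts carry the algebra. Shifts
    commute, and every alternant of a generalized partition is the image of the alternant of 0 under
    an operator ([Sop]); hence an identity between operators need only be tested on that one
    function. And the alternants of strictly decreasing vectors are orthonormal, so evaluation at
    lam + rho reads off a coefficient, and multiplication by z_i^-1 is adjoint to multiplication by
    z_i. The adjunction is what joins the two halves of a pair: T^+ and T^- have prescribed outer
    shapes lam and mu, and only their inner shapes have to agree. Switching serves twice: with full
    alphabets for theta, and with one inner and one outer letter, on part of a tableau, for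
    Gasharov's involution. Both rest on the same analysis of a single pair of letters. *)

Section Zvec.
Variable n : nat.
Implicit Types x y z : zvec n.

Lemma zvDE x y i : (x + y) i = x i + y i. Proof. by rewrite ffunE. Qed.
Lemma zvNE x i : (- x) i = - x i. Proof. by rewrite ffunE. Qed.
Lemma zvBE x y i : (x - y) i = x i - y i. Proof. by rewrite !ffunE. Qed.
Lemma zv0E i : (0 : zvec n) i = 0. Proof. by rewrite ffunE. Qed.
Lemma rectE d i : rect n d i = d%:Z. Proof. by rewrite ffunE. Qed.
Definition zvE := (zvDE, zvBE, zvNE, zv0E, rectE).

Definition rho : zvec n := [ffun i : 'I_n => - (i : nat)%:Z].
Lemma rhoE i : rho i = - (i : nat)%:Z. Proof. by rewrite ffunE. Qed.

Definition act x (s : 'S_n) : zvec n := [ffun i => x (s i)].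
Lemma actE x s i : act x s i = x (s i). Proof. by rewrite ffunE. Qed.
Lemma actM x (s t : 'S_n) : act (act x s) t = act x (t * s)%g.
Proof. by apply/ffunP => i; rewrite !actE permM. Qed.
Lemma act1 x : act x 1%g = x.
Proof. by apply/ffunP => i; rewrite actE perm1. Qed.
Lemma actK s : cancel (act^~ s) (act^~ s^-1%g).
Proof. by move=> x; rewrite actM mulVg act1. Qed.
Lemma actKV s : cancel (act^~ s^-1%g) (act^~ s).
Proof. by move=> x; rewrite actM mulgV act1. Qed.
Lemma actVK x s : act (act x s^-1%g) s = x.
Proof. exact: actKV. Qed.
Lemma act_eq x y s : (act x s == act y s) = (x == y).
Proof. exact: inj_eq (can_inj (@actK s)) x y. Qed.
Lemma actD x y s : act (x + y) s = act x s + act y s.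
Proof. by apply/ffunP => i; rewrite !(actE, zvE). Qed.
Lemma actB x y s : act (x - y) s = act x s - act y s.
Proof. by apply/ffunP => i; rewrite !(actE, zvE). Qed.
Lemma act_rect d s : act (rect n d) s = rect n d.
Proof. by apply/ffunP => i; rewrite !(actE, zvE). Qed.

Definition asym (g : zvec n -> int) := forall x (s : 'S_n), g (act x s) = (-1) ^+ s * g x.

Lemma asym_eq0 g x i j : asym g -> i != j -> x i = x j -> g x = 0.
Proof.
move=> ag ij xij; have := ag x (tperm i j).
have -> : act x (tperm i j) = x.
  by apply/ffunP => k; rewrite actE; case: tpermP => [->|->|].
by rewrite odd_tperm ij expr1; lia.
Qed.

(** Multiplication by the Laurent polynomial that is the sum of the monomials of exponent [f.2] with
    coefficient [f.1]. *)
Definition is_op (P : (zvec n -> int) -> zvec n -> int) :=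
  exists F : seq (int * zvec n), forall g x, P g x = \sum_(f <- F) f.1 * g (x - f.2).

Lemma op_comm P Q g x : is_op P -> is_op Q -> P (Q g) x = Q (P g) x.
Proof.
move=> [F PE] [G QE]; rewrite PE QE.
under eq_bigr do rewrite QE mulr_sumr.
under [RHS]eq_bigr do rewrite PE mulr_sumr.
rewrite exchange_big; apply: eq_bigr => a _; apply: eq_bigr => b _.
by rewrite mulrCA; congr (_ * (_ * g _)); rewrite addrAC.
Qed.

Lemma op_ext P g h x : is_op P -> g =1 h -> P g x = P h x.
Proof. by move=> [F PE] gh; rewrite !PE; apply: eq_bigr => f _; rewrite gh. Qed.

Lemma op_comp P Q : is_op P -> is_op Q -> is_op (P \o Q).
Proof.
move=> [F PE] [G QE]; exists [seq (a.1 * b.1, a.2 + b.2) | a <- F, b <- G] => g x /=.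
rewrite PE big_allpairs_dep /=; apply: eq_bigr => a _.
by rewrite QE mulr_sumr; apply: eq_bigr => b _; rewrite mulrA opprD addrA.
Qed.

Lemma op_shift y : is_op (fun g x => g (x - y)).
Proof. by exists [:: (1, y)] => g x; rewrite big_seq1 mul1r. Qed.

Lemma op_id : is_op id.
Proof. by exists [:: (1, 0)] => g x; rewrite big_seq1 mul1r subr0. Qed.

Lemma op_sum (I : finType) (p : pred I) (c : I -> int) P :
  (forall i, is_op (P i)) -> is_op (fun g x => \sum_(i | p i) c i * P i g x).
Proof.
move=> /(_ _)/cid; move/(fun H i => H i) => oP.
exists (flatten [seq [seq (c i * f.1, f.2) | f <- sval (oP i)] | i <- enum p]).
move=> g x; rewrite big_flatten big_map -big_enum /=; apply: eq_bigr => i _.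
rewrite big_map; case: (oP i) => F /= ->; rewrite mulr_sumr.
by apply: eq_bigr => f _; rewrite mulrA.
Qed.

Definition asym_op (P : (zvec n -> int) -> zvec n -> int) := forall g, asym g -> asym (P g).

Lemma asym_op_sum (I : finType) (p : pred I) (c : I -> int) P :
  (forall i, asym_op (P i)) -> asym_op (fun g x => \sum_(i | p i) c i * P i g x).
Proof.
move=> aP g ag x s; rewrite mulr_sumr; apply: eq_bigr => i _.
by rewrite (aP i g ag) mulrCA.
Qed.

(** The coefficient at z^y of the alternant with leading exponent x. *)
Definition alt x y : int := \sum_(s : 'S_n) (-1) ^+ s * (y == act x s)%:R.

Lemma alt_sym x y : alt x y = alt y x.
Proof.
rewrite /alt (reindex_inj invg_inj); apply: eq_bigr => s _.
by rewrite odd_permV eq_sym (can2_eq (@actKV s) (@actK s)).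
Qed.

Lemma alt_asym x : asym (alt x).
Proof.
move=> y s; rewrite /alt mulr_sumr.
rewrite (reindex_inj (mulgI s)); apply: eq_bigr => t _.
by rewrite -actM act_eq odd_permM signr_addb mulrA.
Qed.

Lemma alt_shift x y z : (forall s, act z s = z) -> alt (x + z) (y + z) = alt x y.
Proof.
move=> zs; apply: eq_bigr => s _.
by rewrite actD zs (inj_eq (addIr z)).
Qed.

Definition strict x := forall i j : 'I_n, (i < j)%N -> x j < x i.

(** An increasing permutation satisfies i <= s i by induction; its inverse is increasing too, which
    gives the opposite inequality. *)
Lemma homo_perm_id (s : 'S_n) : {homo s : i j / (i < j)%N} -> s = 1%g.
Proof.
have le t : {homo (t : 'S_n) : i j / (i < j)%N} -> forall i : 'I_n, (i <= t i)%N.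
  move=> ht [i]; elim: i => [//|i IH] lt /=.
  have lti : (i < n)%N by apply: ltnW.
  exact: leq_ltn_trans (IH lti) (ht (Ordinal lti) (Ordinal lt) _).
move=> hs; apply/permP => i; rewrite perm1; apply/ord_inj/eqP.
rewrite eqn_leq le // andbT -{2}(permK s i) le //.
move=> {i} i j ij; case: (ltngtP (s^-1 i)%g (s^-1 j)%g) => //.
  by move=> /hs; rewrite !permKV ltnNge ltnW.
by move=> /ord_inj /perm_inj E; rewrite E ltnn in ij.
Qed.

(** A term survives only if s carries one strictly decreasing vector to the other; such an s is
    increasing, hence the identity. This orthonormality is how coefficients are extracted everywhere
    below. *)
Lemma alt_strict x y : strict x -> strict y -> alt x y = (x == y)%:R.
Proof.
move=> sx sy; rewrite /alt (bigD1 1%g) //= act1 odd_perm1 mul1r big1 ?addr0.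
  by rewrite eq_sym.
move=> s s1; case: eqP => [E|]; last by rewrite mulr0.
case/negP: s1; apply/eqP/homo_perm_id => i j ij.
case: (ltngtP (s i) (s j)) => // [sji|/ord_inj/perm_inj E'].
  have := sy i j ij; rewrite E !actE => h.
  by have := lt_trans (sx _ _ sji) h; rewrite ltxx.
by rewrite E' ltnn in ij.
Qed.

Lemma gpart_strict lam : gpart lam -> strict (lam + rho).
Proof.
move=> gl i j ij; rewrite !zvE !rhoE.
by have := gl i j (ltnW ij); lia.
Qed.

Lemma strict_gpart x : strict x -> gpart (x - rho).
Proof.
move=> sx i j; rewrite !zvE !rhoE.
suff H m : forall i j : 'I_n, j = (i + m)%N :> nat -> x j + j%:Z <= x i + i%:Z.
  by move=> ij; rewrite !opprK; apply: (H (j - i)%N); rewrite subnKC.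
elim: m {i j} => [|m IH] i j ijm.
  by have -> : j = i by apply/ord_inj; rewrite ijm addn0.
have lt : (i + m < n)%N by have := ltn_ord j; lia.
have := IH i (Ordinal lt) erefl; have := sx (Ordinal lt) j; rewrite /= => H.
by have := H ltac:(lia); lia.
Qed.

(** A permutation that minimizes the sum of the i * x (s i) sorts x: exchanging an ascent would
    lower the sum. *)
Lemma sort_strict x : injective x -> exists s : 'S_n, strict (act x s).
Proof.
move=> xi.
pose F (s : 'S_n) := - \sum_(i < n) (i : nat)%:Z * x (s i).
case: (arg_maxP (P := predT) (i0 := 1%g) F) => // s _ smax.
exists s => i j ij; rewrite !actE ltNge; apply/negP => le.
have {le} lt : x (s i) < x (s j).
  rewrite lt_neqAle le andbT; apply/eqP => /xi/perm_inj E.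
  by rewrite E ltnn in ij.
have := smax (tperm i j * s)%g isT; rewrite /F /= lerN2.
have inj : j != i by apply: contraTneq ij => ->; rewrite ltnn.
rewrite (bigD1 i) // (bigD1 j) //= [leRHS](bigD1 i) // [X in _ <= _ + X](bigD1 j) //=.
rewrite !permM tpermL tpermR.
set S := (X in _ + (_ + X) <= _); set S' := (X in _ <= _ + (_ + X)).
have -> : S' = S.
  by apply: eq_bigr => k /andP[ki kj]; rewrite permM tpermD // eq_sym.
by move: S (x _) (x _) ij lt => S0 a b; nia.
Qed.

(** Antisymmetric functions vanish on vectors with a repeated entry, and every other vector sorts,
    up to a sign, to some lam + rho. *)
Lemma asym_determined g h : asym g -> asym h ->
  (forall lam, gpart lam -> g (lam + rho) = h (lam + rho)) -> g =1 h.
Proof.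
move=> ag ah gh x.
have [xi|] := pselect (injective x); last first.
  rewrite -existsNP => -[i]; rewrite -existsNP => -[j] /not_implyP[xij /eqP ij].
  by rewrite (asym_eq0 ag ij xij) (asym_eq0 ah ij xij).
have [s ss] := sort_strict xi.
have := gh _ (strict_gpart ss); rewrite subrK ag ah.
by move/(can_inj (signrMK _)).
Qed.

End Zvec.

(** * Pieri's rules for horizontal and vertical strips *)

Section Strips.
Variable n : nat.
Local Notation exps k := {ffun 'I_n -> 'I_k.+1}.
Implicit Types (x y lam : zvec n) (b : bool).

Definition vecn k (be : exps k) : zvec n := [ffun i => (be i : nat)%:Z].
Lemma vecnE k (be : exps k) i : vecn be i = (be i : nat)%:Z.
Proof. by rewrite ffunE. Qed.

Definition hcond b k (be : exps k) : bool :=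
  (\sum_i (be i : nat) == k)%N && (b ==> [forall i, (be i <= 1)%N]).

(* Multiplication by h_k (b = false) or e_k (b = true) in the variables z_i,
   or in the z_i^-1 when sg holds. *)
Definition hop b k (sg : bool) (g : zvec n -> int) x : int :=
  \sum_(be : exps k | hcond b be)
    g (if sg then x + vecn be else x - vecn be).

Definition actf k (be : exps k) (s : 'S_n) : exps k :=
  [ffun i => be (s i)].

Lemma actfK k s : cancel (fun be => @actf k be s) (fun be => @actf k be s^-1%g).
Proof. by move=> be; apply/ffunP => i; rewrite !ffunE permKV. Qed.

Lemma hcond_act b k (be : exps k) s : hcond b (actf be s) = hcond b be.
Proof.
rewrite /hcond; congr ((_ == _) && (_ ==> _)).
  by rewrite [RHS](reindex_inj (@perm_inj _ s)); apply: eq_bigr => i _; rewrite ffunE.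
apply/forallP/forallP => H i; last by rewrite ffunE.
by have := H (s^-1 i)%g; rewrite ffunE permKV.
Qed.

Lemma vecn_act k (be : exps k) s : vecn (actf be s) = act (vecn be) s.
Proof. by apply/ffunP => i; rewrite !ffunE. Qed.

Lemma hop_op b k sg : is_op (hop b k sg).
Proof.
exists [seq (1, if sg then - vecn be else vecn be) | be <- index_enum _ & @hcond b k be] => g x.
rewrite big_map big_filter /=; apply: eq_bigr => be _; rewrite mul1r.
by case: sg; rewrite ?opprK.
Qed.

Lemma hop_asym b k sg : asym_op (hop b k sg).
Proof.
move=> g ag x s; rewrite /hop mulr_sumr (reindex_inj (can_inj (@actfK k s))) /=.
apply: eq_big => [be|be _]; first exact: hcond_act.
by rewrite -ag vecn_act; case: sg; rewrite ?actB ?actD.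
Qed.

(** In each term of the alternant the permutation can be moved to the other vector, and the
    exponents [be] are permuted among themselves; so subtracting [be] from one argument amounts to
    adding it to the other. *)
Lemma hop_adj b k sg x y : hop b k sg (alt x) y = hop b k (~~ sg) (alt y) x.
Proof.
rewrite /hop exchange_big /= [RHS]exchange_big /=.
rewrite [RHS](reindex_inj invg_inj); apply: eq_bigr => s _.
rewrite [RHS](reindex_inj (can_inj (@actfK k s^-1%g))) /=.
apply: eq_big => [be|be _]; first by rewrite hcond_act.
rewrite odd_permV vecn_act; congr (_ * _%:R); congr nat_of_bool.
rewrite -[RHS](act_eq _ _ s) actVK.
case: sg => /=; rewrite ?actB ?actD actVK.
  by rewrite eq_sym subr_eq.
by rewrite subr_eq eq_sym.
Qed.

(** For vertical strips [hcond] already bounds the entries of [be] by 1, so only the dominance of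
    lam - be remains; for horizontal strips the condition is interlacing. *)
Definition strip b (lam : zvec n) k (be : exps k) : bool :=
  if b then [forall i : 'I_n, forall j : 'I_n, (i <= j)%N ==> ((lam - vecn be) j <= (lam - vecn be) i)]
  else [forall i : 'I_n, forall j : 'I_n, (i < j)%N ==> (lam j <= (lam - vecn be) i)].

Lemma sum_sign_involution (I : finType) (P : pred I) (F : I -> int) (f : I -> I) :
  involutive f -> (forall i, P i -> P (f i)) -> (forall i, P i -> F (f i) = - F i) ->
  \sum_(i | P i) F i = 0.
Proof.
move=> fi fP fF; have : \sum_(i | P i) F i = - \sum_(i | P i) F i; last by lia.
rewrite -sumrN [LHS](reindex_inj (inv_inj fi)) /=; apply: eq_big => [i|i Pi].
  by apply/idP/idP => [/fP|/fP //]; rewrite fi.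
by rewrite fF // -(fi i) fP.
Qed.

Lemma gpart_adj (x : zvec n) :
  (forall i j : 'I_n, j = i.+1 :> nat -> x j <= x i) -> gpart x.
Proof.
move=> H i j ij.
have {ij} : j = (i + (j - i))%N :> nat by rewrite subnKC.
move: (j - i)%N => m; elim: m j => [|m IH] j jE.
  by have -> : j = i by apply/ord_inj; rewrite jE addn0.
have lt : (i + m < n)%N by have := ltn_ord j; lia.
apply: le_trans (IH (Ordinal lt) erefl); apply: H => /=; lia.
Qed.

(** Every term vanishes by itself: where dominance fails in adjacent rows, the two parts of lam are
    equal and [be] is 1 and 0 there, so lam + rho - be has two equal entries. *)
Lemma pieri_vertical (lam : zvec n) k g : gpart lam -> asym g ->
  \sum_(be : exps k | hcond true be && ~~ strip true lam be)
     g (lam + rho n - vecn be) = 0.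
Proof.
move=> gl ag; apply: big1 => be /andP[/andP[_ /forallP /= b1] ns].
have [p /andP[/eqP p2 lt]] : exists p : 'I_n * 'I_n,
    (p.2 == p.1.+1 :> nat) && ((lam - vecn be) p.1 < (lam - vecn be) p.2).
  apply/existsP; apply: contraNT ns => /existsPn H.
  apply/forallP => i; apply/forallP => j; apply/implyP; apply: gpart_adj => {}i {}j ij.
  by have := H (i, j); rewrite /= ij eqxx -leNgt.
apply: (asym_eq0 (i := p.1) (j := p.2) ag).
  by apply/eqP => E; move: p2; rewrite E; lia.
have := gl p.1 p.2; rewrite p2 leqnSn => /(_ isT).
move: lt; rewrite !(zvE, vecnE, rhoE) p2; have := b1 p.1; have := b1 p.2; lia.
Qed.

Definition badpair (lam : zvec n) k (be : exps k) (p : 'I_n * 'I_n) :=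
  (p.2 == p.1.+1 :> nat) && ((lam - vecn be) p.1 < lam p.2).

Definition firstbad lam k (be : exps k) (p : 'I_n * 'I_n) :=
  badpair lam be p && [forall q, badpair lam be q ==> (p.1 <= q.1)%N].

(* Exchanges two adjacent entries of lam + rho - be; interlacing still fails there,
   since the first entry of lam - be becomes lam p.2 - 1 - be p.2. *)
Definition bswap (lam : zvec n) k (be : exps k) (p : 'I_n * 'I_n) : exps k :=
  [ffun r => if r == p.1 then inord (absz (lam p.1 - lam p.2 + 1 + be p.2))
             else if r == p.2 then inord (absz (lam p.2 - lam p.1 - 1 + be p.1))
             else be r].

Definition bflip (lam : zvec n) k (be : exps k) : exps k :=
  if hcond false be then
    if [pick p | firstbad lam be p] is Some p then bswap lam be p else be
  else be.

Lemma firstbad_uniq lam k (be : exps k) p q :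
  firstbad lam be p -> firstbad lam be q -> p = q.
Proof.
move=> /andP[bp /forallP mp] /andP[bq /forallP mq].
have := mp q; rewrite bq; have := mq p; rewrite bp /= => l1 l2.
move: bp bq => /andP[/eqP ep _] /andP[/eqP eq _].
case: p q ep eq l1 l2 {mp mq} => [p1 p2] [q1 q2] /= ep eq l1 l2.
by congr pair; apply/ord_inj; lia.
Qed.

Lemma sum2_le k (be : exps k) (i j : 'I_n) : i != j ->
  (\sum_l (be l : nat) = be i + (be j + \sum_(l | (l != i) && (l != j)) be l))%N.
Proof. by move=> ij; rewrite (bigD1 i) // (bigD1 j) //= eq_sym. Qed.

Section Bswap.
Variables (lam : zvec n) (k : nat) (be : exps k) (p : 'I_n * 'I_n).
Hypotheses (gl : gpart lam) (hb : hcond false be) (bp : firstbad lam be p).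

Let p2 : p.2 = p.1.+1 :> nat. Proof. by case/andP: bp => /andP[/eqP]. Qed.
Let pne : p.1 != p.2.
Proof. by apply/eqP => E; move: p2; rewrite -E; lia. Qed.
Let lamp : lam p.2 <= lam p.1. Proof. by apply: gl; rewrite p2. Qed.
Let ltp : lam p.1 - (be p.1 : nat)%:Z < lam p.2.
Proof. by case/andP: bp => /andP[_]; rewrite zvBE vecnE. Qed.
Let sumk : (be p.1 + be p.2 <= k)%N.
Proof.
move: hb; rewrite /hcond andbT (sum2_le be pne) => /eqP; lia.
Qed.

(** [absz] and [inord] lose nothing: at a bad pair both new values are non-negative, and their sum
    is still be p.1 + be p.2, at most k. *)
Let e1 : (bswap lam be p p.1 : nat) = absz (lam p.1 - lam p.2 + 1 + be p.2).
Proof. by rewrite ffunE eqxx inordK //; move: lamp ltp sumk; lia. Qed.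
Let e2 : (bswap lam be p p.2 : nat) = absz (lam p.2 - lam p.1 - 1 + be p.1).
Proof. by rewrite ffunE eq_sym (negbTE pne) eqxx inordK //; move: lamp ltp sumk; lia. Qed.
Let e3 r : r != p.1 -> r != p.2 -> bswap lam be p r = be r.
Proof. by move=> r1 r2; rewrite ffunE (negbTE r1) (negbTE r2). Qed.

Lemma bswap_hcond : hcond false (bswap lam be p).
Proof.
move: hb; rewrite /hcond !andbT !(sum2_le _ pne) e1 e2.
move=> /eqP; set S := (X in (_ + (_ + X))%N = _ -> _).
rewrite [X in (_ + (_ + X))%N == _](_ : _ = S); last first.
  by apply: eq_bigr => r /andP[r1 r2]; rewrite e3.
by move: lamp ltp sumk; move: S => S h1 h2 h3 h; apply/eqP; lia.
Qed.

(** Badness at q involves [be] in the row q.1 only, and the rows above p.1 are untouched, so no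
    earlier failure arises. *)
Lemma bswap_firstbad : firstbad lam (bswap lam be p) p.
Proof.
apply/andP; split.
  rewrite /badpair p2 eqxx zvBE vecnE e1; move: lamp; lia.
apply/forallP => q; apply/implyP => /andP[/eqP q2]; rewrite zvBE vecnE => bq.
rewrite leqNgt; apply/negP => qp.
have r1 : q.1 != p.1 by apply/eqP => E; rewrite E ltnn in qp.
have r2 : q.1 != p.2 by apply/eqP => E; move: qp; rewrite E p2; lia.
case/andP: bp => _ /forallP /(_ q); rewrite /badpair q2 eqxx zvBE vecnE -(e3 r1 r2) bq /=.
by rewrite leqNgt qp.
Qed.

Lemma bswap_act : lam + rho n - vecn (bswap lam be p) = act (lam + rho n - vecn be) (tperm p.1 p.2).
Proof.
apply/ffunP => r; rewrite !(zvE, actE, vecnE, rhoE).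
case: tpermP => [->|->|/eqP r1 /eqP r2]; last by rewrite e3.
  by rewrite e1 p2; move: lamp ltp; lia.
by rewrite e2 p2; move: lamp ltp; lia.
Qed.

Lemma bswapK : bswap lam (bswap lam be p) p = be.
Proof.
have E1 : absz (lam p.1 - lam p.2 + 1 + bswap lam be p p.2) = be p.1.
  by rewrite e2; move: lamp ltp; move: (lam p.1) (lam p.2) => *; lia.
have E2 : absz (lam p.2 - lam p.1 - 1 + bswap lam be p p.1) = be p.2.
  by rewrite e1; move: lamp ltp; move: (lam p.1) (lam p.2) => *; lia.
apply/ffunP => r; rewrite ffunE E1 E2 !inord_val.
case: eqP => [->//|/eqP r1]; case: eqP => [->//|/eqP r2].
exact: e3.
Qed.

End Bswap.

Lemma firstbad_ex (lam : zvec n) k (be : exps k) :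
  gpart lam -> ~~ strip false lam be -> exists p, firstbad lam be p.
Proof.
move=> gl ns.
have [p bp] : exists p, badpair lam be p.
  apply/existsP; apply: contraNT ns => /existsPn H.
  apply/forallP => i; apply/forallP => j; apply/implyP => ij.
  have lt : (i.+1 < n)%N by apply: leq_ltn_trans ij _.
  apply: le_trans (gl (Ordinal lt) j ij) _; have := H (i, Ordinal lt).
  by rewrite /badpair /= eqxx -leNgt.
case: (arg_minnP (fun q : 'I_n * 'I_n => q.1 : nat) bp) => q bq qmin.
by exists q; rewrite /firstbad bq; apply/forallP => r; apply/implyP/qmin.
Qed.

Lemma firstbad_nstrip (lam : zvec n) k (be : exps k) p :
  firstbad lam be p -> ~~ strip false lam be.
Proof.
move=> /andP[/andP[/eqP p2 lt] _]; apply/negP => /forallP/(_ p.1)/forallP/(_ p.2).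
by rewrite p2 ltnSn leNgt lt.
Qed.

(** The terms cancel in pairs: [bswap] at the first failure acts on lam + rho - be as a
    transposition, so g changes sign, and the first failure stays in place. *)
Lemma pieri_horizontal (lam : zvec n) k g : gpart lam -> asym g ->
  \sum_(be : exps k | hcond false be && ~~ strip false lam be)
     g (lam + rho n - vecn be) = 0.
Proof.
move=> gl ag; apply: (sum_sign_involution (f := @bflip lam k)).
- move=> be; rewrite {2}/bflip; case: ifP => hb; last by rewrite /bflip hb.
  case: pickP => [p bp|H]; last by rewrite /bflip hb; case: pickP => // p; rewrite H.
  rewrite /bflip bswap_hcond //; have bp' := bswap_firstbad gl hb bp.
  case: pickP => [q bq|/(_ p)]; last by rewrite bp'.
  by rewrite -(firstbad_uniq bp' bq) bswapK.
- move=> be /andP[hb ns]; have [p bp] := firstbad_ex gl ns.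
  rewrite /bflip hb; case: pickP => [q bq|/(_ p)]; last by rewrite bp.
  by rewrite bswap_hcond // (firstbad_nstrip (bswap_firstbad gl hb bq)).
- move=> be /andP[hb ns]; have [p bp] := firstbad_ex gl ns.
  rewrite /bflip hb; case: pickP => [q bq|/(_ p)]; last by rewrite bp.
  rewrite bswap_act // ag odd_tperm.
  suff -> : q.1 != q.2 by rewrite expr1 mulN1r.
  by apply/eqP => E; case/andP: bq => /andP[/eqP q2 _] _; move: q2; rewrite -E => /n_Sn.
Qed.

Lemma pieri b (lam : zvec n) k g : gpart lam -> asym g ->
  hop b k false g (lam + rho n) =
  \sum_(be : exps k | hcond b be && strip b lam be)
     g (lam - vecn be + rho n).
Proof.
move=> gl ag; rewrite /hop /= (bigID (@strip b lam k)) /= [X in _ + X](_ : _ = 0).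
  by rewrite addr0; apply: eq_bigr => be _; rewrite addrAC.
by case: b; [apply: pieri_vertical|apply: pieri_horizontal].
Qed.

Lemma strip_gpart b (lam : zvec n) k (be : exps k) :
  gpart lam -> strip b lam be -> gpart (lam - vecn be).
Proof.
case: b => gl /forallP H i j.
  by move: (H i) => /forallP/(_ j)/implyP.
rewrite leq_eqVlt => /orP[/eqP/ord_inj->//|].
move: (H i) => /forallP/(_ j)/implyP h /h.
by apply: le_trans; rewrite zvBE vecnE; lia.
Qed.

End Strips.

(** * Cardinals of sets and tableaux counted by operators *)

Definition ncard (T : choiceType) (A : set T) : nat := #|` fset_set A|.

Lemma ncardE (T : choiceType) (A : set T) : (ncard A)%:Z = \sum_(x \in A) 1%:Z.
Proof.
rewrite /ncard; have [fA|iA] := pselect (finite_set A).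
  by rewrite fsbig_finite // -natz -sum1_size natr_sum.
(* For an infinite set both sides take the default value 0. *)
rewrite fsbig_dflt; last first.
  by apply: contra_not iA; apply: sub_finite_set => x Ax; split.
by rewrite /fset_set; case: pselect => //= _; rewrite cardfs0.
Qed.

Lemma ncard_bij (T U : choiceType) (A : set T) (B : set U) f :
  set_bij A B f -> ncard A = ncard B.
Proof. by move=> bf; apply/eqP; rewrite -eqz_nat !ncardE (reindex_fsbig f A B _ bf). Qed.

Lemma ncard0 (T : choiceType) : ncard (set0 : set T) = 0%N.
Proof. by rewrite /ncard fset_set0 cardfs0. Qed.

Lemma ncard1 (T : choiceType) (x : T) : ncard [set x] = 1%N.
Proof. by rewrite /ncard fset_set1 cardfs1. Qed.

Lemma ncard_le (T : choiceType) (A B : set T) :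
  finite_set B -> A `<=` B -> (ncard A <= ncard B)%N.
Proof.
move=> fB AB; have fA := sub_finite_set AB fB.
by apply: fsubset_leq_card; rewrite -fset_set_sub.
Qed.

Lemma ncardU (T : choiceType) (A B : set T) : finite_set A -> finite_set B ->
  A `&` B `<=` set0 -> ncard (A `|` B) = (ncard A + ncard B)%N.
Proof.
move=> fA fB AB; apply/eqP; rewrite -eqz_nat PoszD !ncardE fsbigU0 //.
Qed.

Lemma ncardU_le (T : choiceType) (A B : set T) : finite_set A -> finite_set B ->
  (ncard (A `|` B) <= ncard A + ncard B)%N.
Proof.
by move=> fA fB; rewrite /ncard fset_setU // cardfsU leq_subr.
Qed.

Lemma ncard_eq0 (T : choiceType) (A : set T) : finite_set A -> ncard A = 0%N -> A = set0.
Proof. by move=> fA /eqP; rewrite cardfs_eq0 => /eqP /fset_set_set0; apply. Qed.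

Lemma ncard_gt0 (T : choiceType) (A : set T) x : finite_set A -> A x -> (0 < ncard A)%N.
Proof.
move=> fA Ax; rewrite lt0n; apply/eqP => /(ncard_eq0 fA) A0.
by rewrite A0 in Ax.
Qed.

Lemma fsbig_sigma (I J : choiceType) (K : set I) (A : I -> set J) (F : I -> J -> int) :
  finite_set K -> (forall i, K i -> finite_set (A i)) ->
  \sum_(i \in K) \sum_(j \in A i) F i j =
  \sum_(p \in [set p : I * J | K p.1 /\ A p.1 p.2]) F p.1 p.2.
Proof.
move=> fK fA.
have memK i : (i \in fset_set K) = (i \in K) by rewrite in_fset_set.
rewrite (fsbigE [seq (i, j) | i <- enum_fset (fset_set K), j <- enum_fset (fset_set (A i))]).
- rewrite [RHS]big_mkcond big_allpairs_dep /= fsbig_finite //.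
  apply: eq_big_seq => i; rewrite memK => /set_mem Ki.
  rewrite fsbig_finite; last exact: fA.
  apply: eq_big_seq => j; rewrite in_fset_set; last exact: fA.
  by move=> /set_mem Aj; rewrite ifT //; apply: mem_set.
- apply: allpairs_uniq_dep; first exact: fset_uniq.
  + by move=> i _; exact: fset_uniq.
  + by move=> [i j] [i' j'] _ _ [-> ->].
- move=> [i j] /allpairsPdep[i' [j' [+ + [-> ->]]]] /=.
  rewrite memK => /set_mem Ki; rewrite in_fset_set; last exact: fA.
  by move/set_mem.
- move=> [i j] [/= Ki Aj] /negP; case; apply/allpairsPdep.
  exists i, j; split=> //; first by rewrite memK; apply: mem_set.
  by rewrite in_fset_set; [apply: mem_set|apply: fA].
Qed.

Lemma finite_sigma (I J : choiceType) (K : set I) (A : I -> set J) :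
  finite_set K -> (forall i, K i -> finite_set (A i)) ->
  finite_set [set p : I * J | K p.1 /\ A p.1 p.2].
Proof.
move=> fK fA; have -> : [set p : I * J | K p.1 /\ A p.1 p.2] = \bigcup_(i in K) ([set i] `*` A i).
  apply/seteqP; split => -[i j] /=; first by move=> [Ki Aj]; exists i.
  by move=> [k Kk [/= -> Aj]].
apply: bigcup_finite => // i Ki.
by apply: finite_setX; [exact: finite_set1|exact: fA].
Qed.

Lemma finite_dep (I : finType) (J : choiceType) (P : pred I) (A : I -> set J) :
  (forall i, P i -> finite_set (A i)) ->
  finite_set [set p : I * J | P p.1 /\ A p.1 p.2].
Proof. by move=> fA; apply: (@finite_sigma _ _ [set i | P i]) => //; exact: finite_finset. Qed.

Lemma fsbig_dep (I : finType) (J : choiceType) (P : pred I) (A : I -> set J)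
    (F : I -> J -> int) :
  (forall i, P i -> finite_set (A i)) ->
  \sum_(i | P i) \sum_(j \in A i) F i j =
  \sum_(p \in [set p : I * J | P p.1 /\ A p.1 p.2]) F p.1 p.2.
Proof.
move=> fA; rewrite -(@fsbig_sigma _ _ [set i | P i]) //; last exact: finite_finset.
by rewrite bigfs ?index_enum_uniq // => i _; rewrite mem_index_enum.
Qed.

Lemma fsbig_itv (l : int) (b : nat) : \sum_(j \in [set j : int | l < j <= l + b%:Z]) 1%:Z = b%:Z.
Proof.
pose h (o : 'I_b) : int := l + 1 + (o : nat)%:Z.
have bh : set_bij [set: 'I_b] [set j : int | l < j <= l + b%:Z] h.
  split.
  - by move=> o _ /=; rewrite /h; have := ltn_ord o; lia.
  - by move=> o o' _ _; rewrite /h => E; apply/ord_inj; lia.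
  - move=> j /= /andP[l1 l2].
    have lt : (absz (j - l - 1)%R < b)%N by lia.
    by exists (Ordinal lt) => //=; rewrite /h /=; lia.
rewrite (reindex_fsbig _ _ _ _ bh).
have -> : [set: 'I_b] = [set` (predT : pred 'I_b)] by apply/seteqP; split.
rewrite -(@bigfs _ _ _ _ (index_enum 'I_b) predT) ?index_enum_uniq //; last first.
  by move=> i _; rewrite mem_index_enum.
transitivity ((\sum_(i < b) 1)%N%:R : int); first by rewrite natr_sum.
by rewrite sum1_card card_ord natz.
Qed.

Lemma ncard_rows n (lam : zvec n) (b : 'I_n -> nat) :
  ncard [set c : 'I_n * int | (lam c.1 - (b c.1)%:Z < c.2) && (c.2 <= lam c.1)]
  = (\sum_i b i)%N.
Proof.
apply/eqP; rewrite -eqz_nat ncardE.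
have E i : [set j : int | lam i - (b i)%:Z < j <= lam i] =
       [set j : int | lam i - (b i)%:Z < j <= (lam i - (b i)%:Z) + (b i)%:Z].
  by rewrite subrK.
have -> : [set c : 'I_n * int | (lam c.1 - (b c.1)%:Z < c.2) && (c.2 <= lam c.1)] =
    [set p : 'I_n * int | predT p.1 /\ [set j : int | lam p.1 - (b p.1)%:Z < j <= lam p.1] p.2].
  by apply/seteqP; split => c //= [].
rewrite -(fsbig_dep (P := predT) (A := fun i => [set j : int | lam i - (b i)%:Z < j <= lam i]) (fun _ _ => 1%:Z)).
  apply/eqP; rewrite -[RHS]natz natr_sum; apply: eq_bigr => i _.
  by rewrite E fsbig_itv natz.
move=> i _; have [//|inf] := pselect (finite_set [set j : int | lam i - (b i)%:Z < j <= lam i]).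
(* The value of the sum yields finiteness: on an infinite set it would be the default 0, so b i = 0,
   and then the interval is empty. *)
have := fsbig_itv (lam i - (b i)%:Z) (b i); rewrite -E.
case: (posnP (b i)) => [b0 _|bpos].
  rewrite b0; have -> : [set j : int | lam i - 0%:Z < j <= lam i] = set0.
    by apply/seteqP; split => j //=; lia.
  exact: finite_set0.
rewrite fsbig_dflt; first by lia.
by apply: contra_not inf; apply: sub_finite_set => x Ax; split.
Qed.

Lemma ncard_row n (m : int) (i : 'I_n) : 0 <= m ->
  ncard [set c : 'I_n * int | c.1 = i /\ 0 < c.2 <= m] = absz m.
Proof.
move=> m0; pose b k := if k == i then absz m else 0%N.
have := ncard_rows [ffun=> m] b; rewrite -big_mkcond /= big_pred1_eq => <-.
congr ncard; apply/seteqP; split => -[k j] /=; rewrite /b !ffunE.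
  by move=> [-> h]; rewrite eqxx; lia.
by case: eqP => [-> h|_]; last lia; split=> //; lia.
Qed.

(** An upward closed predicate on the columns l < c <= u holds on a final segment; [b] is its
    length, measured from the right end, where strips are attached. *)
Lemma threshold (P : int -> bool) (l u : int) : l <= u ->
  (forall c c', l < c -> c <= c' -> c' <= u -> P c -> P c') ->
  exists b : nat, l <= u - b%:Z /\ forall c, l < c -> c <= u -> P c = (u - b%:Z < c).
Proof.
move=> lu; have -> : l = u - (absz (u - l))%:Z by lia.
move: (absz (u - l)) => m {l lu}; elim: m => [|m IH] up.
  by exists 0%N; split => // c; lia.
have [|b [b1 b2]] := IH.
  by move=> c c' h; apply: up; lia.
case: (boolP ((b == m) && P (u - m%:Z))) => [/andP[/eqP bm Pm]|nP].
  exists m.+1; split=> // c h1 h2; rewrite h1.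
  by apply: (up (u - m%:Z)) => //; lia.
exists b; split; first lia.
move=> c h1 h2; have [h|h] := ltP (u - m%:Z) c; first exact: b2.
have Ec : c = u - m%:Z by lia.
rewrite Ec; have [/eqP bm|bm] := eqVneq b m.
  by move: nP; rewrite bm /= -(eqP bm) => /negbTE ->; lia.
apply/idP/idP; last by lia.
move=> Pc; have bm' : (b < m)%N by lia.
have := b2 (u - b%:Z); rewrite (up (u - m%:Z) (u - b%:Z)) //; try lia.
Qed.

(** * Tableaux built letter by letter from strips *)

Section STsum.
Variables (dX : Order.disp_t) (X : orderType dX) (deg : X -> bool) (n : nat) (e : X -> nat).
Implicit Types (lam kap : zvec n) (s : seq X) (T : filling n X).

(** The inner shape is a component of the element because it varies: iterated Pieri rules compute
    the sum of a function of the inner shape. *)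
Definition ST lam s : set (zvec n * filling n X) :=
  [set p | [/\ gpart p.1, SST deg lam p.1 p.2,
    forall c a, p.2 c = Some a -> a \in s
  & forall a, a \in s -> wt p.2 a = e a]].

Fixpoint hops (sg : bool) s (g : zvec n -> int) : zvec n -> int :=
  if s is a :: s' then hop (deg a) (e a) sg (hops sg s' g) else g.

Lemma hops_op sg s : is_op (hops sg s).
Proof.
elim: s => [|a s IH]; first exact: op_id.
exact: op_comp (hop_op _ _ _ _) IH.
Qed.

Lemma hops_asym sg s : asym_op (hops sg s).
Proof. by elim: s => [|a s IH] g ag //=; apply/hop_asym/IH. Qed.

Lemma ST_nil lam : gpart lam -> ST lam [::] = [set (lam, fun=> None)].
Proof.
move=> gl; apply/seteqP; split => [[kap T] [/= gk [sub dom _ _] noT _]|_ ->] /=.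
  have TN : T = fun=> None.
    by apply/funext => c; case E: (T c) => [a|//]; have := noT _ _ E.
  congr pair => //; apply/ffunP => i; apply/eqP; rewrite eq_le sub leNgt /=.
  apply/negP => lt; have := (dom (i, lam i)).2; rewrite TN /in_skew /= lt lexx.
  by apply.
split=> //; split=> //.
move=> c; rewrite /in_skew /=; split => //; lia.
Qed.

Variables (a : X) (s : seq X).
Local Notation exps := {ffun 'I_n -> 'I_(e a).+1}.
Hypothesis amax : forall x, x \in s -> (x < a)%O.

Lemma anotin : a \notin s.
Proof. by apply/negP => /amax; rewrite ltxx. Qed.

Definition ext lam (b : zvec n) T : filling n X :=
  fun c => if (lam c.1 - b c.1 < c.2) && (c.2 <= lam c.1) then Some a else T c.

(** The largest letter fills the row ends: [hcond] keeps a letter of degree 1 from repeating in a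
    row, [strip] keeps a letter of degree 0 from repeating in a column. *)
Lemma ext_ST lam (be : exps) p : gpart lam ->
  hcond (deg a) be -> strip (deg a) lam be -> ST (lam - vecn be) s p ->
  ST lam (a :: s) (p.1, ext lam (vecn be) p.2).
Proof.
move=> gl hc st; case: p => kap T [/= gk [sub dom row col] let_ wts].
have bpos i : 0 <= vecn be i by rewrite vecnE.
have dom' c x : T c = Some x -> (kap c.1 < c.2) && (c.2 <= lam c.1 - vecn be c.1).
  by move=> E; have := (dom c).1; rewrite E /in_skew zvBE; apply.
have glb := strip_gpart gl st.
split => //=.
- split.
  + by move=> i; have := sub i; have := bpos i; rewrite zvBE; lia.
  + move=> c; rewrite /ext /in_skew; have := sub c.1; have := bpos c.1; rewrite zvBE => h1 h2.
    case: ifP => h3; first by split => // _; lia.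
    rewrite dom /in_skew zvBE; lia.
  + move=> i j j' x y jj'; rewrite /ext /=.
    case: ifP => h1; case: ifP => h2.
    * move=> [<-] [<-]; split=> // da _; move: hc; rewrite /hcond da /= => /andP[_ /forallP/(_ i)].
      by move: h1 h2; rewrite vecnE; lia.
    * by move=> _ /dom' /=; lia.
    * move=> E [<-]; split; first by rewrite ltW // amax // (let_ _ _ E).
      by rewrite amax // (let_ _ _ E).
    * exact: row.
  + move=> i i' j x y ii'; rewrite /ext /=.
    case: ifP => h1; case: ifP => h2.
    * move=> [<-] [<-]; split=> // da _; move: st; rewrite /strip (negbTE da).
      move=> /forallP/(_ i)/forallP/(_ i'); rewrite ii' zvBE; lia.
    * move=> _ /dom' /=; have := glb i i' (ltnW ii'); rewrite !zvBE; lia.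
    * move=> E [<-]; split; first by rewrite ltW // amax // (let_ _ _ E).
      by rewrite amax // (let_ _ _ E).
    * exact: col.
- move=> c x; rewrite /ext; case: ifP => _; first by move=> [<-]; rewrite mem_head.
  by move=> /let_ xs; rewrite inE xs orbT.
- move=> x; rewrite inE => /orP[/eqP -> {x}|xs].
    case/andP: hc => /eqP h _; rewrite -[RHS]h -(ncard_rows lam (fun i => be i)).
    congr (#|` fset_set _|); apply/seteqP; split => c /=.
      rewrite /ext vecnE; case: ifP => // _ /let_ as_.
      by case/negP: anotin.
    by rewrite /ext vecnE => ->.
  rewrite -[RHS]wts //; congr (#|` fset_set _|); apply/seteqP; split => c /=; rewrite /ext.
    by case: ifP => // _ [E]; case/negP: anotin; rewrite E.
  by move=> E; rewrite ifF //; have := dom' _ _ E; lia.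
Qed.

Definition restr T : filling n X := fun c => if T c == Some a then None else T c.

(** Being maximal, [a] occupies a final segment of each row. The lengths of these segments are [be],
    and the column conditions of T make them a strip. *)
Lemma restr_ST lam kap T : gpart lam -> ST lam (a :: s) (kap, T) ->
  exists be : exps,
  [/\ hcond (deg a) be, strip (deg a) lam be,
      ST (lam - vecn be) s (kap, restr T) & T = ext lam (vecn be) (restr T)].
Proof.
move=> gl [/= gk [sub dom row col] let_ wts].
have domE i j : (kap i < j) && (j <= lam i) -> exists x, T (i, j) = Some x.
  by move=> h; have := (dom (i, j)).2 h; case: (T _) => // x; exists x.
have domS c x : T c = Some x -> (kap c.1 < c.2) && (c.2 <= lam c.1).
  by move=> E; have := (dom c).1; rewrite E; apply.
have le_a c x : T c = Some x -> (x <= a)%O.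
  by move=> /let_; rewrite inE => /orP[/eqP -> //|/amax/ltW].
have /(_ _)/cid-/all_sig[b bP] : forall i, exists b : nat, kap i <= lam i - b%:Z /\
    forall c, kap i < c -> c <= lam i -> (T (i, c) == Some a) = (lam i - b%:Z < c).
  move=> i; apply: threshold => [|c c' h1 h2 h3 /eqP E]; first exact: sub.
  have [<-|ne] := eqVneq c c'; first exact/eqP.
  have [x E'] : exists x, T (i, c') = Some x by apply: domE; lia.
  have lt : c < c' by rewrite lt_neqAle ne.
  have [ax _] := row _ _ _ _ _ lt E E'.
  by rewrite E'; apply/eqP; congr Some; apply/eqP; rewrite eq_le ax (le_a _ _ E').
have aE c : (T c == Some a) = (lam c.1 - (b c.1)%:Z < c.2) && (c.2 <= lam c.1).
  have [b1 b2] := bP c.1; case: c b1 b2 => i j /= b1 b2.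
  apply/idP/idP.
    by move=> E; have := domS _ _ (eqP E); move=> /= /andP[l1 l2]; rewrite -b2 ?E.
  by move=> h; rewrite b2; lia.
have wa : (\sum_i b i)%N = e a.
  rewrite -wts ?mem_head // -(ncard_rows lam b); congr (#|` fset_set _|).
  by apply/seteqP; split => c /=; rewrite -aE => /eqP.
have bk i : (b i < (e a).+1)%N by rewrite ltnS -wa (bigD1 i) //= leq_addr.
pose be : exps := [ffun i => inord (b i)].
have vb i : vecn be i = (b i)%:Z by rewrite vecnE ffunE inordK.
have bpos i : (b i)%:Z <= lam i - kap i by have [+ _] := bP i; lia.
have st : strip (deg a) lam be.
  rewrite /strip; case da: (deg a); apply/forallP => i; apply/forallP => i'; apply/implyP => ii'.
    rewrite !zvBE !vb leNgt; apply/negP => lt.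
    have ll := gl _ _ ii'; have kk := gk _ _ ii'; have bi := bpos i; have bi' := bpos i'.
    have := aE (i, lam i' - (b i')%:Z); have := aE (i', lam i' - (b i')%:Z) => /=.
    (* The last cell of row i' before its letters [a] would lie under an [a] of row i, and so hold
       [a] itself. *)
    have [x E'] := domE i' (lam i' - (b i')%:Z) ltac:(lia).
    move=> a1 a2; have E : T (i, lam i' - (b i')%:Z) = Some a by apply/eqP; rewrite a2; lia.
    have lt' : (i < i')%N.
      rewrite ltn_neqAle ii' andbT; apply/eqP => /ord_inj Eii.
      by rewrite Eii ltxx in lt.
    have [ax _] := col _ _ _ _ _ lt' E E'.
    have Ex : x = a by apply/eqP; rewrite eq_le ax (le_a _ _ E').
    by move: a1; rewrite E' Ex eqxx; lia.
  rewrite zvBE vb leNgt; apply/negP => lt.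
  have ll := gl _ _ (ltnW ii'); have kk := gk _ _ (ltnW ii').
  have bi := bpos i; have bi' := bpos i'.
  (* The last cell of row i' would lie under an [a] and hold [a] as well, which degree 0 forbids. *)
  have [x E'] := domE i' (lam i') ltac:(lia).
  have E : T (i, lam i') = Some a by apply/eqP; rewrite aE /=; lia.
  have [ax] := col _ _ _ _ _ ii' E E'.
  have -> : x = a by apply/eqP; rewrite eq_le ax (le_a _ _ E').
  by rewrite da ltxx => /(_ isT isT).
exists be; split => //.
- rewrite /hcond; apply/andP; split.
    by apply/eqP; rewrite -[RHS]wa; apply: eq_bigr => i _; rewrite ffunE inordK.
  apply/implyP => da; apply/forallP => i; rewrite leqNgt; apply/negP => lt.
  have bi : (1 < b i)%N by move: lt; rewrite ffunE inordK.
  have E : T (i, lam i - 1) = Some a by apply/eqP; rewrite aE /=; lia.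
  have E' : T (i, lam i) = Some a by apply/eqP; rewrite aE /=; lia.
  have [_ /(_ da da)] := row i (lam i - 1) (lam i) a a ltac:(lia) E E'.
  by rewrite ltxx.
- have rE c x : restr T c = Some x -> T c = Some x.
    by rewrite /restr; case: ifP.
  split => //=; first split.
  + by move=> i; rewrite zvBE vb; have := bpos i; lia.
  + move=> c; rewrite /restr /in_skew zvBE vb; have := dom c; rewrite /in_skew.
    have := aE c; have := bpos c.1.
    case: (T c == Some a) => h1 h2 h3; split => //.
    * by move=> h; exfalso; move: h2 h; lia.
    * by move=> /(h3.1); move: h1 h2; lia.
    * by move=> h; apply/(h3.2); move: h1 h2 h; lia.
  + by move=> i j j' x y jj' /rE h1 /rE h2; apply: row h1 h2.
  + by move=> i i' j x y jj' /rE h1 /rE h2; apply: col h1 h2.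
  + move=> c x; rewrite /restr; case: eqP => // ne E; have := let_ _ _ E.
    by rewrite inE => /orP[/eqP Ex|//]; rewrite E Ex in ne.
  + move=> x xs; rewrite -wts ?inE ?xs ?orbT //; congr (#|` fset_set _|).
    apply/seteqP; split => c /=; rewrite /restr; first by case: ifP.
    move=> E; case: eqP => // E'; case/negP: anotin.
    by move: E'; rewrite E => -[<-].
- apply/funext => c; rewrite /ext vb -aE /restr; case: eqP => //.
Qed.

Lemma ext_bij lam : gpart lam ->
  set_bij [set p : exps * (zvec n * filling n X) |
             (hcond (deg a) p.1 && strip (deg a) lam p.1) /\ ST (lam - vecn p.1) s p.2]
          (ST lam (a :: s))
          (fun p => (p.2.1, ext lam (vecn p.1) p.2.2)).
Proof.
move=> gl; split.
- by move=> [be p] [/= /andP[hc st] h]; apply: ext_ST.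
- move=> [be [kap T]] [be' [kap' T']] /set_mem [/= _ h] /set_mem [/= _ h'] [/= Ek E].
  rewrite -{}Ek in h' *.
  have TN (be0 : exps) T0 c : ST (lam - vecn be0) s (kap, T0) ->
      (lam c.1 - vecn be0 c.1 < c.2) -> T0 c = None.
    move=> [/= _ [_ dom _ _] _ _] lt; case E0: (T0 c) => [x|//].
    have /dom : T0 c <> None by rewrite E0.
    by rewrite /in_skew zvBE; lia.
  have key (be0 : exps) T0 c : ST (lam - vecn be0) s (kap, T0) ->
      (ext lam (vecn be0) T0 c == Some a) = (lam c.1 - vecn be0 c.1 < c.2) && (c.2 <= lam c.1).
    move=> [_ _ /= let_ _]; rewrite /ext; case: ifP => _; first by rewrite eqxx.
    by apply/eqP => /let_; apply/negP/anotin.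
  have Eb : be = be'.
    apply/ffunP => i; apply/ord_inj.
    have h1 c := key be T c h; have h2 c := key be' T' c.
    have h3 j := esym (h1 (i, j)); rewrite E in h3.
    have {}h3 j : (lam i - vecn be i < j) && (j <= lam i) = (lam i - vecn be' i < j) && (j <= lam i).
      by rewrite h3 h2.
    move: h3; rewrite !vecnE => h3.
    have := h3 (lam i - (be i : nat)%:Z); have := h3 (lam i - (be' i : nat)%:Z).
    by rewrite !ltxx /= => h4 h5; lia.
  rewrite -Eb in h' E *; congr (_, (_, _)); apply/funext => c.
  have := congr1 (fun f => f c) E; rewrite /ext /=; case: ifP => // /andP[l1 l2] _.
  by rewrite (TN _ _ _ h l1) (TN _ _ _ h' l1).
- move=> [kap T] /= /(restr_ST gl)[be [hc st h E]].
  by exists (be, (kap, restr T)) => /=; [rewrite hc st|rewrite -E].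
Qed.

End STsum.

(** Induction on the letters; [s] is decreasing, so its head is the outermost strip. With [g]
    arbitrary, Pieri's rule applies to the image of [g] under the operators of the remaining
    letters. *)
Lemma ST_sum (dX : Order.disp_t) (X : orderType dX) (deg : X -> bool) n (e : X -> nat)
    (s : seq X) (lam : zvec n) :
  sorted (fun x y => (y < x)%O) s -> gpart lam ->
  finite_set (ST deg e lam s) /\
  forall g, asym g ->
  \sum_(p \in ST deg e lam s) g (p.1 + rho n) = hops deg e false s g (lam + rho n).
Proof.
move=> ss; elim: s ss lam => [|a s IH] ss lam gl.
  by rewrite ST_nil //; split=> [|g ag]; [exact: finite_set1|rewrite fsbig_set1].
have amax x : x \in s -> (x < a)%O.
  move: ss; rewrite /= path_sortedE; last by move=> y x' z h1 h2; apply: lt_trans h2 h1.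
  by move=> /andP[/allP h _] /h.
have {}IH := IH (path_sorted ss).
have fin : finite_set [set p : {ffun 'I_n -> 'I_(e a).+1} * (zvec n * filling n X) |
     (hcond (deg a) p.1 && strip (deg a) lam p.1) /\ ST deg e (lam - vecn p.1) s p.2].
  apply: (@finite_dep _ _ (fun be => hcond (deg a) be && strip (deg a) lam be)
    (fun be => ST deg e (lam - vecn be) s)).
  by move=> be /andP[hc st]; case: (IH (lam - vecn be)) => //; apply: strip_gpart st.
have bij := @ext_bij _ _ deg n e a s amax lam gl.
split.
  have [_ _ surj] := bij; apply: sub_finite_set surj _.
  exact: finite_image.
move=> g ag; rewrite (reindex_fsbig _ _ _ _ bij) /=.
rewrite -(@fsbig_dep _ _ (fun be => hcond (deg a) be && strip (deg a) lam be)
    (fun be => ST deg e (lam - vecn be) s) (fun _ p => g (p.1 + rho n))); last first.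
  by move=> be /andP[hc st]; case: (IH (lam - vecn be)) => //; apply: strip_gpart st.
rewrite pieri //; last exact: hops_asym.
apply: eq_bigr => be /andP[hc st]; case: (IH (lam - vecn be)) => [|_ ->//].
exact: strip_gpart st.
Qed.

(** * Switching *)

Section Switching.
Variable n : nat.
Local Notation cell := ('I_n * int)%type.
Local Notation state := (filling n (nat + nat)).
Implicit Types (c d : cell) (S F : state).

Definition cle c d := (c.1 <= d.1)%N && (c.2 <= d.2).
Definition above c d := (c.2 == d.2) && (c.1 < d.1)%N.

Lemma cell_ext c d : c.1 = d.1 :> nat -> c.2 = d.2 -> c = d.
Proof. by case: c d => [i j] [i' j'] /= /ord_inj -> ->. Qed.

Lemma perforatedP (T : filling n nat) :
  perforated T <-> forall c d a b, T c = Some a -> T d = Some b -> cle c d ->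
    (a <= b)%N /\ (above c d -> (a < b)%N).
Proof.
split=> [H [i j] [i' j'] a b h1 h2 /andP[/= l1 l2]|H i i' j j' a b h1 h2 l1 l2].
  have [le lt] := H _ _ _ _ _ _ h1 h2 l1 l2.
  by split=> // /andP[/eqP /= e l]; apply: lt.
have [|le lt] := H _ _ _ _ h1 h2; first by rewrite /cle /= l1.
by split=> // e l; apply: lt; rewrite /above /= e eqxx l.
Qed.

Definition perf S := perforated (inner S) /\ perforated (outer S).

Lemma below_or_right_cle c c' : below_or_right c c' -> cle c c' /\ c != c'.
Proof.
case: c c' => [i j] [i' j']; rewrite /below_or_right /cle /=.
move=> [[e1 ->]|[-> ->]]; split; try lia.
  by apply/eqP => /(congr1 (fun c : cell => nat_of_ord c.1)) /=; lia.
by apply/eqP => /(congr1 snd) /=; lia.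
Qed.

Lemma interchange1 X (S : filling n X) c c' : interchange S c c' c = S c'.
Proof. by rewrite /interchange eqxx. Qed.
Lemma interchange2 X (S : filling n X) c c' : interchange S c c' c' = S c.
Proof. by rewrite /interchange; case: eqVneq => [->|_]; rewrite ?eqxx. Qed.
Lemma interchangeN X (S : filling n X) c c' x : x != c -> x != c' -> interchange S c c' x = S x.
Proof. by rewrite /interchange => /negbTE -> /negbTE ->. Qed.

Lemma interchangeK X (S : filling n X) c c' : interchange (interchange S c c') c c' = S.
Proof.
apply/funext => x; have [->|x1] := eqVneq x c; first by rewrite interchange1 interchange2.
have [->|x2] := eqVneq x c'; first by rewrite interchange2 interchange1.
by rewrite !interchangeN.
Qed.

Lemma interchange_comm X (S : filling n X) c c' d d' :
  c != d -> c != d' -> c' != d -> c' != d' ->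
  interchange (interchange S c c') d d' = interchange (interchange S d d') c c'.
Proof.
move=> n1 n2 n3 n4; apply/funext => x.
have m1 : d != c by rewrite eq_sym.
have m2 : d' != c by rewrite eq_sym.
have m3 : d != c' by rewrite eq_sym.
have m4 : d' != c' by rewrite eq_sym.
have [->|x1] := eqVneq x c.
  by rewrite (interchangeN _ n1 n2) !interchange1 interchangeN.
have [->|x2] := eqVneq x c'.
  by rewrite (interchangeN _ n3 n4) !interchange2 interchangeN.
have [->|x3] := eqVneq x d.
  by rewrite (interchangeN _ m1 m3) !interchange1 interchangeN.
have [->|x4] := eqVneq x d'.
  by rewrite (interchangeN _ m2 m4) !interchange2 interchangeN.
by rewrite !interchangeN.
Qed.

Lemma innerE S c a : inner S c = Some a <-> S c = Some (inl a).
Proof. by rewrite /inner; case: (S c) => [[x|x]|]; split=> // -[->]. Qed.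
Lemma outerE S c a : outer S c = Some a <-> S c = Some (inr a).
Proof. by rewrite /outer; case: (S c) => [[x|x]|]; split=> // -[->]. Qed.
Lemma inner_ex S c : inner S c <> None <-> exists a, S c = Some (inl a).
Proof.
split=> [|[a /innerE -> //]]; case E: (inner S c) => [a|] // _.
by exists a; apply/innerE.
Qed.
Lemma outer_ex S c : outer S c <> None <-> exists a, S c = Some (inr a).
Proof.
split=> [|[a /outerE -> //]]; case E: (outer S c) => [a|] // _.
by exists a; apply/outerE.
Qed.

Lemma switch_ex S S' : switch S S' <-> exists c c' a b,
  [/\ below_or_right c c', S c = Some (inl a), S c' = Some (inr b),
      S' = interchange S c c' & perf S'].
Proof.
split=> [[c [c' [br [/inner_ex[a Ea] /outer_ex[b Eb]] E p]]]|[c [c' [a [b [br Ea Eb E p]]]]]].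
  by exists c, c', a, b.
by exists c, c'; split=> //; split; [apply/inner_ex; exists a|apply/outer_ex; exists b].
Qed.

Lemma perf_inner S c d a b : perf S -> S c = Some (inl a) -> S d = Some (inl b) -> cle c d ->
  (a <= b)%N /\ (above c d -> (a < b)%N).
Proof. by move=> [/perforatedP H _] /innerE h1 /innerE h2; apply: H. Qed.
Lemma perf_outer S c d a b : perf S -> S c = Some (inr a) -> S d = Some (inr b) -> cle c d ->
  (a <= b)%N /\ (above c d -> (a < b)%N).
Proof. by move=> [_ /perforatedP H] /outerE h1 /outerE h2; apply: H. Qed.

Lemma perfI S :
  (forall c d a b, S c = Some (inl a) -> S d = Some (inl b) -> cle c d ->
     (a <= b)%N /\ (above c d -> (a < b)%N)) ->
  (forall c d a b, S c = Some (inr a) -> S d = Some (inr b) -> cle c d ->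
     (a <= b)%N /\ (above c d -> (a < b)%N)) -> perf S.
Proof.
move=> h1 h2; split; apply/perforatedP => c d a b.
  by move=> /innerE e1 /innerE e2; apply: h1.
by move=> /outerE e1 /outerE e2; apply: h2.
Qed.

(* Two interchanges from a same state that share a cell are equal: the two outer
   neighbours of an inner letter decide which of them may move, and conversely. *)
Lemma switch_exclusive S c c' d d' a b a' b' :
  below_or_right c c' -> below_or_right d d' ->
  S c = Some (inl a) -> S c' = Some (inr b) -> S d = Some (inl a') -> S d' = Some (inr b') ->
  perf (interchange S c c') -> perf (interchange S d d') ->
  (c == d) || (c' == d') -> c = d /\ c' = d'.
Proof.
move=> r1 r2 Ec Ec' Ed Ed' p1 p2.
have [le1 n1] := below_or_right_cle r1; have [le2 n2] := below_or_right_cle r2.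
have [Ecd|ncd] := eqVneq c d => /= [_|/eqP E].
  rewrite -{}Ecd in r2 Ed p2 le2 n2 *.
  split=> //; apply/eqP/negPn/negP => ne.
  have sub x y x' y' : below_or_right c x -> below_or_right c y -> S x = Some (inr x') ->
     S y = Some (inr y') -> perf (interchange S c x) -> perf (interchange S c y) ->
     x.1 = c.1.+1 :> nat -> y.1 = c.1 -> x.2 = c.2 -> y.2 = c.2 + 1 -> False.
    move=> h1 h2 Ex Ey px py e1 e2 e3 e4.
    have [_ m1] := below_or_right_cle h1; have [_ m2] := below_or_right_cle h2.
    have m3 : x != y by apply/eqP => E'; move: e1; rewrite E' e2; lia.
    have [] := @perf_outer _ c y x' y' px; rewrite ?interchange1 ?interchangeN // 1?eq_sym //.
      by rewrite /cle e2 e4; clear; lia.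
    move=> l1 _; have [] := @perf_outer _ c x y' x' py; rewrite ?interchange1 ?interchangeN // 1?eq_sym //.
      by rewrite /cle e1 e3; clear; lia.
    by move=> _; move: l1; rewrite /above e1 e3; clear; lia.
  case: (r1) (r2) => [[e1 e2]|[e1 e2]] [[f1 f2]|[f1 f2]].
  - by case/negP: ne; apply/eqP; apply: cell_ext; [rewrite e1 f1|rewrite e2 f2].
  - by apply: (sub c' d' b b') => //; rewrite f1.
  - by apply: (sub d' c' b' b) => //; rewrite e1.
  - by case/negP: ne; apply/eqP; apply: cell_ext; [rewrite e1 f1|rewrite e2 f2].
exfalso; rewrite -{}E in r2 Ed' p2 le2 n2 *.
have sub x y x' y' : below_or_right x c' -> below_or_right y c' -> S x = Some (inl x') ->
   S y = Some (inl y') -> perf (interchange S x c') -> perf (interchange S y c') ->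
   c'.1 = x.1.+1 :> nat -> c'.1 = y.1 -> c'.2 = x.2 -> c'.2 = y.2 + 1 -> False.
  move=> h1 h2 Ex Ey px py e1 e2 e3 e4.
  have [_ m1] := below_or_right_cle h1; have [_ m2] := below_or_right_cle h2.
  have m3 : x != y by apply/eqP => E'; move: e1; rewrite E' e2; lia.
  have [] := @perf_inner _ y c' y' x' px; rewrite ?interchange2 ?interchangeN // 1?eq_sym //.
    by rewrite /cle e2 e4; clear; lia.
  move=> l1 _; have [] := @perf_inner _ x c' x' y' py; rewrite ?interchange2 ?interchangeN // 1?eq_sym //.
    by rewrite /cle e1 e3; clear; lia.
  by move=> _; move: l1; rewrite /above e1 e3; clear; lia.
case: (r1) (r2) => [[e1 e2]|[e1 e2]] [[f1 f2]|[f1 f2]].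
- by case/negP: ncd; apply/eqP; apply: cell_ext; lia.
- by apply: (sub c d a a') => //; rewrite f1.
- by apply: (sub d c a' a) => //; rewrite e1.
- case/negP: ncd; apply/eqP; apply: cell_ext; last by lia.
  by rewrite -e1 -f1.
Qed.

Lemma ord_succ_col c c' : below_or_right c c' ->
  (c'.1 = c.1.+1 :> nat /\ c'.2 = c.2) \/ (c'.1 = c.1 :> nat /\ c'.2 = c.2 + 1).
Proof. by move=> [[-> ->]|[-> ->]]; [left|right]. Qed.

Lemma cell_neq c d : c != d -> (c.1 != d.1 :> nat) || (c.2 != d.2).
Proof.
case: c d => [i j] [i' j'] /=; apply: contraNT; rewrite negb_or !negbK => /andP[/eqP/ord_inj -> /eqP ->].
exact: eqxx.
Qed.

Section Diamond.
Variables (S : state) (c c' d d' : cell) (a b a' b' : nat).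
Hypotheses (p : perf S) (r1 : below_or_right c c') (r2 : below_or_right d d').
Hypotheses (Ec : S c = Some (inl a)) (Ec' : S c' = Some (inr b)).
Hypotheses (Ed : S d = Some (inl a')) (Ed' : S d' = Some (inr b')).
Hypotheses (p1 : perf (interchange S c c')) (p2 : perf (interchange S d d')).
Hypotheses (ncd : c != d) (ncd' : c' != d').

Let ncd1 : c != d'. Proof. by apply/eqP => E; move: Ec; rewrite E Ed'. Qed.
Let ncd2 : c' != d. Proof. by apply/eqP => E; move: Ec'; rewrite E Ed. Qed.
Let cc : c != c'. Proof. by have [] := below_or_right_cle r1. Qed.
Let dd : d != d'. Proof. by have [] := below_or_right_cle r2. Qed.

(** The weak inequality is visible after the second interchange alone, where a is still at c. For
    strictness, the two directions decide which of the original state and the two states with one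
    interchange has both letters in one column. *)
Lemma diamond_inner : cle c' d' -> (a <= a')%N /\ (above c' d' -> (a < a')%N).
Proof.
move=> le.
have [le1 _] := below_or_right_cle r1.
have le' : cle c d' by move: le le1; rewrite /cle; clear; lia.
have [||le2 lt2] := @perf_inner _ c d' a a' p2 _ _ le'.
- by rewrite interchangeN.
- by rewrite interchange2.
split=> // ab; case: (ord_succ_col r1) => -[e1 e2].
  by apply: lt2; move: ab; rewrite /above e1 e2; clear; lia.
case: (ord_succ_col r2) => -[f1 f2].
  have [|||_] := @perf_inner _ c' d a a' p1 _ _ _.
  - by rewrite interchange2.
  - by rewrite interchangeN // eq_sym.
  - by move: ab le (cell_neq ncd2); rewrite /cle /above f1 f2; clear; lia.
  by apply; move: ab le (cell_neq ncd2); rewrite /cle /above f1 f2; clear; lia.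
have [|_] := @perf_inner _ c d a a' p Ec Ed.
  by move: ab le; rewrite /cle /above e1 e2 f1 f2; clear; lia.
by apply; move: ab le; rewrite /cle /above e1 e2 f1 f2; clear; lia.
Qed.

Lemma diamond_outer : cle c d -> (b <= b')%N /\ (above c d -> (b < b')%N).
Proof.
move=> le.
have [le1 _] := below_or_right_cle r2.
have le' : cle c d' by move: le le1; rewrite /cle; clear; lia.
have [||le2 lt2] := @perf_outer _ c d' b b' p1 _ _ le'.
- by rewrite interchange1.
- by rewrite interchangeN // eq_sym.
split=> // ab; case: (ord_succ_col r2) => -[e1 e2].
  by apply: lt2; move: ab; rewrite /above e1 e2; clear; lia.
case: (ord_succ_col r1) => -[f1 f2].
  have [|||_] := @perf_outer _ c' d b b' p2 _ _ _.
  - by rewrite interchangeN.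
  - by rewrite interchange1.
  - by move: ab le (cell_neq ncd2); rewrite /cle /above f1 f2; clear; lia.
  by apply; move: ab le (cell_neq ncd2); rewrite /cle /above f1 f2; clear; lia.
have [|_] := @perf_outer _ c' d' b b' p Ec' Ed'.
  by move: ab le; rewrite /cle /above e1 e2 f1 f2; clear; lia.
by apply; move: ab le; rewrite /cle /above e1 e2 f1 f2; clear; lia.
Qed.

End Diamond.

(** Two letters of the same alphabet, unless they are the two moved ones, already have their final
    positions after one of the interchanges alone; the two moved ones are compared by the diamond
    lemmas. *)
Lemma perf_interchange2 S c c' d d' a b a' b' : perf S ->
  below_or_right c c' -> below_or_right d d' ->
  S c = Some (inl a) -> S c' = Some (inr b) -> S d = Some (inl a') -> S d' = Some (inr b') ->
  perf (interchange S c c') -> perf (interchange S d d') ->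
  c != d -> c' != d' -> perf (interchange (interchange S c c') d d').
Proof.
move=> p r1 r2 Ec Ec' Ed Ed' p1 p2 ncd ncd'.
have ncd1 : c != d' by apply/eqP => E; move: Ec; rewrite E Ed'.
have ncd2 : c' != d by apply/eqP => E; move: Ec'; rewrite E Ed.
have com := interchange_comm S ncd ncd1 ncd2 ncd'.
set S3 := interchange (interchange S c c') d d'.
have dd : d != d' by have [] := below_or_right_cle r2.
have cc : c != c' by have [] := below_or_right_cle r1.
have S3c : S3 c = Some (inr b) by rewrite /S3 interchangeN // interchange1.
have S3c' : S3 c' = Some (inl a) by rewrite /S3 interchangeN // interchange2.
have S3d : S3 d = Some (inr b') by rewrite /S3 com interchangeN 1?eq_sym // interchange1.
have S3d' : S3 d' = Some (inl a') by rewrite /S3 com interchangeN 1?eq_sym // interchange2.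
have E1 x : x != d -> x != d' -> S3 x = interchange S c c' x by move=> *; rewrite /S3 interchangeN.
have E2 x : x != c -> x != c' -> S3 x = interchange S d d' x by move=> *; rewrite /S3 com interchangeN.
apply: perfI => x y u v Ex Ey le.
- have xc : x != c by apply/eqP => E; move: Ex; rewrite E S3c.
  have xd : x != d by apply/eqP => E; move: Ex; rewrite E S3d.
  have yc : y != c by apply/eqP => E; move: Ey; rewrite E S3c.
  have yd : y != d by apply/eqP => E; move: Ey; rewrite E S3d.
  have [xc'|xc'] := eqVneq x c'; have [yd'|yd'] := eqVneq y d'.
  + move: Ex Ey le; rewrite xc' yd' S3c' S3d' => -[<-] [<-].
    exact: (@diamond_inner S c c' d d' a b a' b').
  + have xd' : x != d' by rewrite xc'.
    by apply: (perf_inner p1) le; rewrite -E1.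
  + have [yc'|yc'] := eqVneq y c'; first by case/negP: ncd'; rewrite -yc' yd'.
    by apply: (perf_inner p2) le; rewrite -E2.
  have [xd'|xd'] := eqVneq x d'; last by apply: (perf_inner p1) le; rewrite -E1.
  have [yc'|yc'] := eqVneq y c'; last by apply: (perf_inner p2) le; rewrite -E2.
  move: Ex Ey le; rewrite xd' yc' S3c' S3d' => -[<-] [<-].
  by apply: (@diamond_inner S d d' c c' a' b' a b); rewrite // eq_sym.
- have xc : x != c' by apply/eqP => E; move: Ex; rewrite E S3c'.
  have xd : x != d' by apply/eqP => E; move: Ex; rewrite E S3d'.
  have yc : y != c' by apply/eqP => E; move: Ey; rewrite E S3c'.
  have yd : y != d' by apply/eqP => E; move: Ey; rewrite E S3d'.
  have [xc'|xc'] := eqVneq x c; have [yd'|yd'] := eqVneq y d.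
  + move: Ex Ey le; rewrite xc' yd' S3c S3d => -[<-] [<-].
    exact: (@diamond_outer S c c' d d' a b a' b').
  + have xd' : x != d by rewrite xc'.
    by apply: (perf_outer p1) le; rewrite -E1.
  + have [yc'|yc'] := eqVneq y c; first by case/negP: ncd; rewrite -yc' yd'.
    by apply: (perf_outer p2) le; rewrite -E2.
  have [xd'|xd'] := eqVneq x d; last by apply: (perf_outer p1) le; rewrite -E1.
  have [yc'|yc'] := eqVneq y c; last by apply: (perf_outer p2) le; rewrite -E2.
  move: Ex Ey le; rewrite xd' yc' S3c S3d => -[<-] [<-].
  by apply: (@diamond_outer S d d' c c' a' b' a b); rewrite // eq_sym.
Qed.

Lemma switch_diamond S S1 S2 : perf S -> switch S S1 -> switch S S2 ->
  S1 = S2 \/ exists S3, switch S1 S3 /\ switch S2 S3.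
Proof.
move=> p /switch_ex[c [c' [a [b [r1 Ec Ec' E1 p1]]]]] /switch_ex[d [d' [a' [b' [r2 Ed Ed' E2 p2]]]]].
rewrite {S1}E1 in p1 *; rewrite {S2}E2 in p2 *.
have ncd1 : c != d' by apply/eqP => E; move: Ec; rewrite E Ed'.
have ncd2 : c' != d by apply/eqP => E; move: Ec'; rewrite E Ed.
have [sh|] := boolP ((c == d) || (c' == d')).
  by have [-> ->] := switch_exclusive r1 r2 Ec Ec' Ed Ed' p1 p2 sh; left.
rewrite negb_or => /andP[ncd ncd']; right.
exists (interchange (interchange S c c') d d').
have p3 := perf_interchange2 p r1 r2 Ec Ec' Ed Ed' p1 p2 ncd ncd'.
split; apply/switch_ex.
  by exists d, d', a', b'; split=> //; rewrite interchangeN // 1?eq_sym.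
exists c, c', a, b; split=> //; first by rewrite interchangeN.
  by rewrite interchangeN.
exact: interchange_comm.
Qed.

Definition switches := clos_refl_trans state (@switch n).
Definition stuck S := forall S', ~ switch S S'.

Lemma switch_perf S S' : switch S S' -> perf S'.
Proof. by case=> c [c' [_ _ _]]. Qed.

(** The diamond carries the step to S1 along the path to N. As N cannot be left, the path must
    absorb that step. *)
Lemma switch_strip S S1 N : perf S -> switch S S1 -> switches S N -> stuck N -> switches S1 N.
Proof.
move=> p s1 h0; have H := clos_rt_rt1n _ _ _ _ h0; revert S1 p s1; clear h0.
induction H as [S|S S' N ss' H IH] => S1 p s1 st; first by case: (st _ s1).
have [->|[S3 [h1 h2]]] := switch_diamond p s1 ss'; first exact: clos_rt1n_rt.
exact: rt_trans (rt_step _ _ _ _ h1) (IH _ (switch_perf ss') h2 st).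
Qed.

Lemma switches_perf S S' : perf S -> switches S S' -> perf S'.
Proof.
move=> p H; induction H as [S S' h|S|S S' S'' h IH h' IH'] => //; first exact: switch_perf h.
exact/IH'/IH.
Qed.

Lemma stuck_uniq S N1 N2 : perf S -> switches S N1 -> stuck N1 -> switches S N2 -> stuck N2 ->
  N1 = N2.
Proof.
move=> p h0; have {h0} H := clos_rt_rt1n _ _ _ _ h0; induction H as [S|S S' N ss' H IH] => st1 h st2.
  have h' := clos_rt_rt1n _ _ _ _ h; case: h' st1 => // S1 N ss' _ st; by case: (st _ ss').
by apply: IH (switch_perf ss') st1 (switch_strip p ss' h st2) st2.
Qed.

Definition flip S : state := fun c => omap (fun x => match x with inl a => inr a | inr a => inl a end) (S c).

Lemma inner_flip S : inner (flip S) = outer S.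
Proof. by apply/funext => c; rewrite /inner /flip /outer; case: (S c) => [[a|a]|]. Qed.
Lemma outer_flip S : outer (flip S) = inner S.
Proof. by apply/funext => c; rewrite /inner /flip /outer; case: (S c) => [[a|a]|]. Qed.
Lemma perf_flip S : perf S -> perf (flip S).
Proof. by rewrite /perf inner_flip outer_flip => -[]. Qed.
Lemma flip_inl S c a : flip S c = Some (inl a) <-> S c = Some (inr a).
Proof. by rewrite -innerE inner_flip outerE. Qed.
Lemma flip_inr S c a : flip S c = Some (inr a) <-> S c = Some (inl a).
Proof. by rewrite -outerE outer_flip innerE. Qed.

Lemma flip_interchange S c c' : flip (interchange S c c') = interchange (flip S) c c'.
Proof. by apply/funext => x; rewrite /flip /interchange; case: ifP => // _; case: ifP. Qed.

(** With the alphabets exchanged, undoing an interchange is an interchange at the same two cells,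
    and its legality is the perforatedness of the old state. Theta is an involution for this
    reason. *)
Lemma switch_flip S S' : perf S -> switch S S' -> switch (flip S') (flip S).
Proof.
move=> p /switch_ex[c [c' [a [b [br Ea Eb -> p']]]]].
apply/switch_ex; exists c, c', b, a; split=> //.
- by apply/flip_inl; rewrite interchange1.
- by apply/flip_inr; rewrite interchange2.
- by rewrite -flip_interchange interchangeK.
- exact: perf_flip.
Qed.

Lemma switches_flip S S' : perf S -> switches S S' -> switches (flip S') (flip S).
Proof.
move=> p H; induction H as [S S' h|S|S S' S'' h IH h' IH'].
- exact/rt_step/switch_flip.
- exact: rt_refl.
- exact: rt_trans (IH' (switches_perf p h)) (IH p).
Qed.

Definition tp c c' c0 : cell := if c0 == c then c' else if c0 == c' then c else c0.

Lemma tpK c c' : involutive (tp c c').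
Proof.
move=> x; rewrite /tp; have [->|xc] := eqVneq x c.
  by have [->|] := eqVneq c' c => //; rewrite eqxx.
have [->|xc'] := eqVneq x c'; first by rewrite eqxx.
by rewrite (negbTE xc) (negbTE xc').
Qed.

Lemma interchange_tp X (S : filling n X) c c' x : interchange S c c' x = S (tp c c' x).
Proof. by rewrite /interchange /tp; case: ifP => //; case: ifP. Qed.

Lemma ncard_tp c c' (A B : set cell) : (forall x, B (tp c c' x) <-> A x) -> ncard A = ncard B.
Proof.
move=> AB; apply: (@ncard_bij _ _ _ _ (tp c c')); split.
- by move=> x /= /AB.
- by move=> x y _ _; apply: inv_inj (tpK c c') x y.
- by move=> x Bx; exists (tp c c' x); rewrite ?tpK //=; apply/AB; rewrite tpK.
Qed.

Definition letters S (x : nat + nat) : set cell := [set c | S c = Some x].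

Lemma switches_letters S S' x : switches S S' -> ncard (letters S' x) = ncard (letters S x).
Proof.
move=> H; induction H as [S S' h|S|S S' S'' h IH h' IH'] => //; last by rewrite IH' IH.
move: h => /switch_ex[c [c' [a [b [_ _ _ -> _]]]]]; apply: (@ncard_tp c c') => y.
by rewrite /letters /= interchange_tp.
Qed.

Lemma switches_dom S S' c : switches S S' -> (S' c = None) <-> (S c = None).
Proof.
move=> H; induction H as [S S' h|S|S S' S'' h IH h' IH'] => //; last by rewrite IH' IH.
move: h => /switch_ex[d [d' [a [b [_ Ea Eb -> _]]]]]; rewrite /interchange.
by case: eqP => [->|_]; [rewrite Ea Eb|case: eqP => [->|_ //]; rewrite Ea Eb].
Qed.

End Switching.

(** * Switching two letters *)

Lemma ncard_lt (T : choiceType) (A B : set T) x :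
  finite_set B -> A `<=` B -> B x -> ~ A x -> (ncard A < ncard B)%N.
Proof.
move=> fB AB Bx nAx; have fA := sub_finite_set AB fB.
have := ncardU (finite_set1 x) fA; rewrite ncard1 add1n => <-; last by move=> y [/= ->].
by apply: ncard_le => // y [->|/AB].
Qed.

Section Toggle.
Variables (n s t : nat).
Local Notation cell := ('I_n * int)%type.
Local Notation state := (filling n (nat + nat)).
Implicit Types (c d : cell) (F : state).

Definition region F c := F c = Some (inl s) \/ F c = Some (inr t).

(* The cells of the letters s and t can be refilled freely with these two
   letters, as long as no column repeats a letter. *)
Record togglable F : Prop := Togglable {
  tog_convex : forall c1 c2 c3, region F c1 -> region F c3 -> cle c1 c2 -> cle c2 c3 -> region F c2;
  tog_inner : forall c d y, region F c -> F d = Some (inl y) -> y <> s ->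
    (cle c d -> (s < y)%N) /\ (cle d c -> (y < s)%N);
  tog_outer : forall c d y, region F c -> F d = Some (inr y) -> y <> t ->
    (cle c d -> (t < y)%N) /\ (cle d c -> (y < t)%N);
  tog_in2 : forall c d, above c d -> F c = Some (inl s) -> F d = Some (inl s) -> False;
  tog_out2 : forall c d, above c d -> F c = Some (inr t) -> F d = Some (inr t) -> False }.

(** Letters outside D are strictly separated from z, and inside D all letters are z, so only a
    repetition in a column could do harm. *)
Lemma refill (f f' : filling n nat) (D : cell -> Prop) z : perforated f ->
  (forall c, ~ D c -> f' c = f c) -> (forall c a, D c -> f' c = Some a -> a = z) ->
  (forall c d y, D c -> ~ D d -> f d = Some y ->
     (cle c d -> (z < y)%N) /\ (cle d c -> (y < z)%N)) ->
  (forall c d, above c d -> f' c = Some z -> f' d = Some z -> False) -> perforated f'.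
Proof.
move=> /perforatedP pf out on sep no2; apply/perforatedP => c d a b Ea Eb le.
have [rc|rc] := pselect (D c); have [rd|rd] := pselect (D d).
- have ea := on _ _ rc Ea; have eb := on _ _ rd Eb; rewrite ea eb in Ea Eb *.
  by split=> // ab; case: (no2 _ _ ab Ea Eb).
- rewrite (on _ _ rc Ea); rewrite out // in Eb.
  by have [/(_ le) lt _] := sep _ _ _ rc rd Eb; rewrite (ltnW lt).
- rewrite (on _ _ rd Eb); rewrite out // in Ea.
  by have [_ /(_ le) lt] := sep _ _ _ rd rc Ea; rewrite (ltnW lt).
- by rewrite !out // in Ea Eb; apply: pf Ea Eb le.
Qed.

Lemma tog_perf F F' : perf F -> togglable F -> (forall c, region F' c <-> region F c) ->
  (forall c, ~ region F c -> F' c = F c) ->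
  (forall c d, above c d -> F' c = Some (inl s) -> F' d = Some (inl s) -> False) ->
  (forall c d, above c d -> F' c = Some (inr t) -> F' d = Some (inr t) -> False) ->
  perf F' /\ togglable F'.
Proof.
move=> p tg rE out i2 o2.
have fromF c x : F' c = Some x -> x <> inl s -> x <> inr t -> F c = Some x.
  move=> E n1 n2; rewrite -out // -rE => -[] E'; move: E; rewrite E' => -[] /esym //.
have reg c x : F' c = Some x -> x <> inl s -> x <> inr t -> ~ region F' c.
  by move=> E n1 n2 [] E'; move: E; rewrite E' => -[] /esym.
split; last split => //.
- split.
    apply: (@refill (inner F) _ (region F) s p.1).
    + by move=> c nr; rewrite /inner out.
    + move=> c a /rE[E|E]; rewrite /inner E // => -[] //.
    + by move=> c d y rc nd /innerE Ed; apply: (tog_inner tg rc Ed) => e; apply: nd; left; rewrite Ed e.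
    + by move=> c d ab /innerE Ec /innerE; apply: i2 ab Ec.
  apply: (@refill (outer F) _ (region F) t p.2).
  + by move=> c nr; rewrite /outer out.
  + move=> c a /rE[E|E]; rewrite /outer E // => -[] //.
  + by move=> c d y rc nd /outerE Ed; apply: (tog_outer tg rc Ed) => e; apply: nd; right; rewrite Ed e.
  + by move=> c d ab /outerE Ec /outerE; apply: o2 ab Ec.
- by move=> c1 c2 c3; rewrite !rE; apply: tog_convex.
- move=> c d y /rE rc Ed ys; apply: (tog_inner tg rc _ ys).
  by apply: fromF Ed _ _ => // -[].
- move=> c d y /rE rc Ed ys; apply: (tog_outer tg rc _ ys).
  by apply: fromF Ed _ _ => // -[].
Qed.

Lemma above_cle c d : above c d -> cle c d.
Proof. by rewrite /above /cle => /andP[/eqP -> /ltnW ->] /=. Qed.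

(** By convexity the cells between c and d belong to the region, and three cells of a column cannot
    share two letters without repetition. *)
Lemma col_two F c d : togglable F -> region F c -> region F d -> above c d -> d.1 = c.1.+1 :> nat.
Proof.
move=> tg rc rd ab; apply/eqP/negPn/negP => ne.
have lt : (c.1.+1 < n)%N by have := ltn_ord d.1; move: ab ne; rewrite /above; lia.
pose e : cell := (Ordinal lt, c.2).
have ab1 : above c e by rewrite /above /e /= eqxx ltnSn.
have ab2 : above e d by move: ab ne; rewrite /above /e /=; lia.
have re : region F e by apply: (tog_convex tg rc rd); apply: above_cle.
by case: rc => E1; case: rd => E2; case: re => E3;
  move: (tog_in2 tg ab) (tog_in2 tg ab1) (tog_in2 tg ab2)
   (tog_out2 tg ab) (tog_out2 tg ab1) (tog_out2 tg ab2); rewrite E1 E2 E3 => *; eauto.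
Qed.

(* The letters t in rows < i after each t with an s above it has moved up. *)
Definition rowset F (i : nat) : set cell :=
  [set c | F c = Some (inr t) /\
     ((c.1 < i)%N \/ (c.1 = i :> nat /\ exists d, above d c /\ F d = Some (inl s)))].

Definition upright F := forall c d, above c d -> F c = Some (inl s) -> F d = Some (inr t) -> False.

Lemma region_interchange F c c' : F c = Some (inl s) -> F c' = Some (inr t) ->
  (forall x, region (interchange F c c') x <-> region F x) /\
  (forall x, ~ region F x -> interchange F c c' x = F x).
Proof.
move=> Ec Ec'; split=> x.
  rewrite /region /interchange; case: eqP => [->|_]; first by rewrite Ec Ec'; split; [left|right].
  by case: eqP => [->|//]; rewrite Ec Ec'; split; [right|left].
move=> nr; rewrite interchangeN //; apply: contra_notN nr => /eqP ->; [left|right] => //.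
Qed.

Lemma interchange_st F c c' : F c = Some (inl s) -> F c' = Some (inr t) ->
  (forall x, interchange F c c' x = Some (inl s) -> x = c' \/ F x = Some (inl s) /\ x <> c) /\
  (forall x, interchange F c c' x = Some (inr t) -> x = c \/ F x = Some (inr t) /\ x <> c').
Proof.
move=> Ec Ec'; split=> x; rewrite /interchange.
  case: eqP => [_|xc]; first by rewrite Ec'.
  by case: eqP => [xc' _|xc' E]; [left|right].
case: eqP => [xc _|xc]; first by left.
by case: eqP => [_|xc' E]; [rewrite Ec|right].
Qed.

(** At i = c'.1 the moved t is counted by [rowset] before because of the s above it, and afterwards
    because its row is smaller; no other i sees a difference. *)
Lemma toggle_vertical F c c' : perf F -> togglable F -> above c c' ->
  F c = Some (inl s) -> F c' = Some (inr t) -> below_or_right c c' ->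
  let F' := interchange F c c' in
  [/\ perf F', togglable F' & forall i, ncard (rowset F' i) = ncard (rowset F i)].
Proof.
move=> p tg ab Ec Ec' br /=; set F' := interchange F c c'.
have [rE out] := region_interchange Ec Ec'.
have E' : c'.1 = c.1.+1 :> nat by apply: (col_two tg _ _ ab); [left|right].
have [F's F't] := interchange_st Ec Ec'.
have sc x : F x = Some (inl s) -> x <> c -> x.2 <> c.2.
  move=> Ex xc e; have : x.1 <> c.1 :> nat by move=> e'; apply/xc/cell_ext.
  move=> ne; have [ax|ax] : above x c \/ above c x by rewrite /above e eqxx /=; lia.
    exact (tog_in2 tg ax Ex Ec).
  exact (tog_in2 tg ax Ec Ex).
have tc x : F x = Some (inr t) -> x <> c' -> x.2 <> c'.2.
  move=> Ex xc e; have : x.1 <> c'.1 :> nat by move=> e'; apply/xc/cell_ext.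
  move=> ne; have [ax|ax] : above x c' \/ above c' x by rewrite /above e eqxx /=; lia.
    exact (tog_out2 tg ax Ex Ec').
  exact (tog_out2 tg ax Ec' Ex).
have cc : c'.2 = c.2 by move: ab; rewrite /above => /andP[/eqP].
have [pF' tF'] : perf F' /\ togglable F'.
  apply: (tog_perf p) => // x y /[dup] axy /andP[/eqP xy lxy].
    move=> /F's[Ex|[Ex xc]] /F's[Ey|[Ey yc]].
    - by move: lxy; rewrite Ex Ey ltnn.
    - by apply: (sc _ Ey yc); rewrite -xy Ex cc.
    - by apply: (sc _ Ex xc); rewrite xy Ey cc.
    - exact (tog_in2 tg axy Ex Ey).
  move=> /F't[Ex|[Ex xc]] /F't[Ey|[Ey yc]].
  - by move: lxy; rewrite Ex Ey ltnn.
  - by apply: (tc _ Ey yc); rewrite -xy Ex cc.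
  - by apply: (tc _ Ex xc); rewrite xy Ey cc.
  - exact (tog_out2 tg axy Ex Ey).
split=> // i; apply/esym; apply: (@ncard_tp _ c c') => x; rewrite /rowset /= /F' interchange_tp tpK.
split=> -[Ex H]; split=> //; move: H; rewrite /tp.
  have xc : x != c by apply/eqP => E; rewrite E Ec in Ex.
  rewrite (negbTE xc); have [->|xc'] := eqVneq x c'; last first.
    move=> [lt|[e [d [ad Fd]]]]; first by left.
    right; split=> //; exists d; split=> //.
    case/F's: Fd => [Ed|[]//]; exfalso; rewrite Ed in ad.
    by case/andP: ad => /eqP e2 _; apply: (tc _ Ex); [exact/eqP|rewrite e2].
  move=> [lt|[e [d [ad Fd]]]].
    have [h|h|h] := ltngtP c'.1 i; [by left|lia|by right; split=> //; exists c].
  exfalso; case/F's: Fd => [Ed|[Ed dc]].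
    by move: ad; rewrite Ed /above E'; lia.
  by apply: (sc _ Ed dc); case/andP: ad => /eqP.
have xc : x != c by apply/eqP => E; rewrite E Ec in Ex.
rewrite (negbTE xc); have [->|xc'] := eqVneq x c'.
  by move=> H; left; case: H => [|[]]; rewrite E'; lia.
move=> [lt|[e [d [ad Fd]]]]; [by left|right; split=> //].
have dc : d != c.
  apply/eqP => Ed; apply: (tc _ Ex (elimN eqP xc')); rewrite cc -Ed.
  by case/andP: ad => /eqP.
exists d; split=> //; rewrite interchangeN //.
by apply/eqP => Ed; rewrite Ed Ec' in Fd.
Qed.

(** When no s stands above a t, convexity makes c and c' the only cells of the region in their
    columns. So the exchange creates no repetition, and the letter t stays in its row. *)
Lemma toggle_horizontal F c c' : perf F -> togglable F -> upright F ->
  F c = Some (inl s) -> F c' = Some (inr t) -> c'.1 = c.1 -> c'.2 = c.2 + 1 ->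
  let F' := interchange F c c' in
  [/\ perf F', togglable F' & forall i, ncard (rowset F' i) = ncard (rowset F i)].
Proof.
move=> p tg up Ec Ec' e1 e2 /=; set F' := interchange F c c'.
have [rE out] := region_interchange Ec Ec'.
have rc : region F c by left.
have rc' : region F c' by right.
have [F's F't] := interchange_st Ec Ec'.
have colc x : region F x -> x <> c -> x.2 <> c.2.
  move=> rx xc e; have ne : x.1 <> c.1 :> nat by move=> e'; apply/xc/cell_ext.
  have [ax|ax] : above x c \/ above c x by rewrite /above e eqxx /=; lia.
    case: rx => Ex; first exact (tog_in2 tg ax Ex Ec).
    (* The cell beside x in the column of c' lies between x and c', hence in the region; neither s
       nor t can stand there above the t at c'. *)
    pose z : cell := (x.1, c'.2).
    have rz : region F z.
      apply: (tog_convex tg (c1 := x) (c3 := c')) => //; first by right.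
        by rewrite /z /cle /= leqnn e e2; lia.
      by move: ax; rewrite /z /cle /= e1 lexx /above; lia.
    have az : above z c' by move: ax; rewrite /z /above /= e1 eqxx; lia.
    by case: rz => Ez; [exact (up _ _ az Ez Ec')|exact (tog_out2 tg az Ez Ec')].
  by case: rx => Ex; [exact (tog_in2 tg ax Ec Ex)|exact (up _ _ ax Ec Ex)].
have colc' x : region F x -> x <> c' -> x.2 <> c'.2.
  move=> rx xc e; have ne : x.1 <> c'.1 :> nat by move=> e'; apply/xc/cell_ext.
  have [ax|ax] : above x c' \/ above c' x by rewrite /above e eqxx /=; lia.
    by case: rx => Ex; [exact (up _ _ ax Ex Ec')|exact (tog_out2 tg ax Ex Ec')].
  case: rx => Ex; last exact (tog_out2 tg ax Ec' Ex).
  pose z : cell := (x.1, c.2).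
  have az : above c z by move: ax; rewrite /z /above /= e1 eqxx; lia.
  have rz : region F z.
    apply: (tog_convex tg (c1 := c) (c3 := x)) => //; first by left.
      exact: above_cle.
    by rewrite /z /cle /= leqnn e e2; lia.
  by case: rz => Ez; [exact (tog_in2 tg az Ec Ez)|exact (up _ _ az Ec Ez)].
have [pF' tF'] : perf F' /\ togglable F'.
  apply: (tog_perf p) => // x y /[dup] axy /andP[/eqP xy lxy].
    move=> /F's[Ex|[Ex xc]] /F's[Ey|[Ey yc]].
    - by move: lxy; rewrite Ex Ey ltnn.
    - by apply: (colc' y); [left|move=> E; rewrite E Ec' in Ey|rewrite -xy Ex].
    - by apply: (colc' x); [left|move=> E; rewrite E Ec' in Ex|rewrite xy Ey].
    - exact (tog_in2 tg axy Ex Ey).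
  move=> /F't[Ex|[Ex xc]] /F't[Ey|[Ey yc]].
  - by move: lxy; rewrite Ex Ey ltnn.
  - by apply: (colc y); [right|move=> E; rewrite E Ec in Ey|rewrite -xy Ex].
  - by apply: (colc x); [right|move=> E; rewrite E Ec in Ex|rewrite xy Ey].
  - exact (tog_out2 tg axy Ex Ey).
split=> // i; apply/esym; apply: (@ncard_tp _ c c') => x; rewrite /rowset /= /F' interchange_tp tpK.
have tp1 : (tp c c' x).1 = x.1.
  by rewrite /tp; case: eqP => [->//|_]; case: eqP => [->|].
rewrite tp1; split=> -[Ex [lt|[e [d [ad Fd]]]]]; split=> //; try by left.
  exfalso; have [xc'|xc'] := eqVneq x c'.
    move: ad; rewrite /tp xc' eqxx; case: (eqVneq c' c) => [E|_] ad; first by rewrite E Ec in Ec'.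
    case/F's: Fd => [Ed|[Ed dc]].
      by move: ad; rewrite Ed /above e1; lia.
    by apply: (colc d) => //; [left|case/andP: ad => /eqP].
  have xc : x != c by apply/eqP => E; rewrite E Ec in Ex.
  move: ad; rewrite /tp (negbTE xc) (negbTE xc') => ad.
  case/F's: Fd => [Ed|[Ed dc]]; last exact (up _ _ ad Ed Ex).
  by apply: (colc' x); [right|exact/eqP|case/andP: ad; rewrite Ed => /eqP].
by exfalso; exact (up _ _ ad Fd Ex).
Qed.

(** A termination measure: row plus column is larger by one at the second cell of an interchange
    than at the first. *)
Definition inversions F : set (cell * cell) :=
  [set p | [/\ F p.1 = Some (inl s), F p.2 = Some (inr t) &
     (p.1.1 : nat)%:Z + p.1.2 < (p.2.1 : nat)%:Z + p.2.2]].

Lemma inversions_finite F : finite_set [set c | F c <> None] -> finite_set (inversions F).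
Proof.
move=> fin; apply: sub_finite_set (finite_setX fin fin) => -[c d] [/= -> -> _].
by split.
Qed.

(** Exchanging the names of c and c' sends inversions afterwards to inversions before, and the pair
    (c, c') is missed. *)
Lemma inversions_lt F c c' : finite_set [set x | F x <> None] -> below_or_right c c' ->
  F c = Some (inl s) -> F c' = Some (inr t) ->
  (ncard (inversions (interchange F c c')) < ncard (inversions F))%N.
Proof.
move=> fin br Ec Ec'.
have cc : c' != c by apply/eqP => E; rewrite E Ec in Ec'.
have dg : (c.1 : nat)%:Z + c.2 < (c'.1 : nat)%:Z + c'.2.
  by case: br => -[e1 e2]; rewrite e1 e2; lia.
pose h (p : cell * cell) := (tp c c' p.1, tp c c' p.2).
have hK : involutive h by move=> [x y]; rewrite /h /= !tpK.
have -> : ncard (inversions (interchange F c c')) = ncard (h @` inversions (interchange F c c')).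
  apply: (@ncard_bij _ _ _ _ h); split; first by move=> p hp; exists p.
    by move=> p q _ _; apply: (inv_inj hK).
  by move=> p.
apply: (@ncard_lt _ _ _ (c, c')).
- exact: inversions_finite.
- move=> _ [[x y] [/= Ex Ey xy] <-]; rewrite !interchange_tp in Ex Ey.
  split=> //=; move: Ex Ey xy; rewrite /tp.
  have [->|xc] := eqVneq x c; first by rewrite Ec'.
  have [->|yc'] := eqVneq y c'.
    by rewrite (negbTE cc) Ec.
  have [->|xc'] := eqVneq x c'; have [->|yc] := eqVneq y c => _ _; lia.
- by split.
- move=> [[x y] [/= Ex Ey xy] [e1 e2]].
  have Ex' : x = c' by rewrite -[x](tpK c c') e1 /tp eqxx.
  have Ey' : y = c by rewrite -[y](tpK c c') e2 /tp (negbTE cc) eqxx.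
  by move: xy; rewrite Ex' Ey'; lia.
Qed.

(** A walk from c to d in single steps down or right stays in the region by convexity, so somewhere
    on it an s is followed by a t. *)
Lemma sorted_of_noadj F : togglable F ->
  (forall c c', below_or_right c c' -> F c = Some (inl s) -> F c' = Some (inr t) -> False) ->
  forall c d, cle c d -> F c = Some (inl s) -> F d = Some (inr t) -> False.
Proof.
move=> tg na c d le.
have [m] : exists m : nat, (d.1 : nat)%:Z + d.2 - (c.1 : nat)%:Z - c.2 <= m%:Z.
  by exists (absz ((d.1 : nat)%:Z + d.2 - (c.1 : nat)%:Z - c.2)%R); lia.
elim: m c le => [|m IH] c le lm Ec Ed.
  have E : c = d by apply: cell_ext; move: le lm; rewrite /cle; lia.
  by rewrite E Ed in Ec.
have ne : c != d by apply/eqP => E; rewrite E Ed in Ec.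
have [x [br xd]] : exists x, below_or_right c x /\ cle x d.
  have [l1|l1] := ltnP c.1 d.1.
    have lt : (c.1.+1 < n)%N by have := ltn_ord d.1; lia.
    exists (Ordinal lt, c.2); split; first by left.
    by move: le; rewrite /cle /=; lia.
  exists (c.1, c.2 + 1); split; first by right.
  by move: le (cell_neq ne); rewrite /cle /=; lia.
have [cx _] := below_or_right_cle br.
have [Ex|Ex] : region F x by apply: (tog_convex tg (c1 := c) (c3 := d)) => //; [left|right].
  apply: (IH x) => //; move: lm; case: br => -[e1 e2]; rewrite e1 e2; lia.
exact: na br Ec Ex.
Qed.

(** Vertical exchanges take precedence, as [toggle_horizontal] requires an upright state; the number
    of inversions decreases each time. *)
Lemma toggle_exists F : finite_set [set c | F c <> None] -> perf F -> togglable F ->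
  exists F', [/\ switches F F', perf F' /\ togglable F',
    (forall c, region F' c <-> region F c) /\ (forall c, ~ region F c -> F' c = F c),
    forall i, ncard (rowset F' i) = ncard (rowset F i)
  & forall c d, cle c d -> F' c = Some (inl s) -> F' d = Some (inr t) -> False].
Proof.
have [m] := ubnP (ncard (inversions F)); elim: m F => // m IH F lm fin p tg.
have step c c' : below_or_right c c' -> F c = Some (inl s) -> F c' = Some (inr t) ->
    [/\ perf (interchange F c c'), togglable (interchange F c c')
      & forall i, ncard (rowset (interchange F c c') i) = ncard (rowset F i)] ->
    exists F', [/\ switches F F', perf F' /\ togglable F',
    (forall c, region F' c <-> region F c) /\ (forall c, ~ region F c -> F' c = F c),
    forall i, ncard (rowset F' i) = ncard (rowset F i)
  & forall c d, cle c d -> F' c = Some (inl s) -> F' d = Some (inr t) -> False].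
  move=> br Ec Ec' [p1 t1 n1]; set F1 := interchange F c c' in p1 t1 n1.
  have sw : switch F F1 by apply/switch_ex; exists c, c', s, t.
  have fin1 : finite_set [set c | F1 c <> None].
    apply: sub_finite_set fin => x /= h h'; apply: h.
    by apply/(switches_dom x (rt_step _ _ _ _ sw)).
  have lt1 : (ncard (inversions F1) < m)%N.
    by apply: leq_trans (inversions_lt fin br Ec Ec') _; rewrite -ltnS.
  have [F' [h1 h2 [h3 h3'] h4 h5]] := IH F1 lt1 fin1 p1 t1.
  have [rE out] := region_interchange Ec Ec'.
  exists F'; split=> //.
  - exact: rt_trans (rt_step _ _ _ _ sw) h1.
  - split=> x; first by rewrite h3.
    move=> nr; have nr1 : ~ region F1 x by move=> /rE.
    by rewrite h3' // /F1 out.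
  - by move=> i; rewrite h4.
have [up|] := pselect (upright F); last first.
  move=> nup; have [c [c' [ab Ec Ec']]] : exists c c', [/\ above c c', F c = Some (inl s) & F c' = Some (inr t)].
    apply: contrapT => H; apply: nup => c c' ab Ec Ec'; apply: H.
    by exists c, c'.
  have e : c'.1 = c.1.+1 :> nat by apply: (col_two tg _ _ ab); [left|right].
  have br : below_or_right c c' by left; split=> //; case/andP: ab => /eqP.
  by apply: (step _ _ br Ec Ec'); apply: toggle_vertical.
have [[c [c' [br Ec Ec']]]|na] := pselect (exists c c', [/\ below_or_right c c', F c = Some (inl s) & F c' = Some (inr t)]).
  apply: (step _ _ br Ec Ec'); case: (br) => -[e1 e2].
    by case: (up c c') => //; rewrite /above e1 e2 eqxx ltnSn.
  exact: toggle_horizontal.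
exists F; split=> //; first exact: rt_refl.
apply: sorted_of_noadj => // c c' br Ec Ec'; apply: na.
by exists c, c'.
Qed.

End Toggle.

(** * Switching all letters *)

Section Passes.
Variable n : nat.
Local Notation cell := ('I_n * int)%type.
Local Notation state := (filling n (nat + nat)).
Implicit Types (c d : cell) (F : state) (r : nat + nat -> nat).

(** Inner and outer letters, merged by the rank [r], form a single semistandard filling. *)
Definition ranked r F := forall c d x y, F c = Some x -> F d = Some y -> cle c d ->
  (r x <= r y)%N /\ (above c d -> (r x < r y)%N).

Definition dom_convex F := forall c1 c2 c3, F c1 <> None -> F c3 <> None ->
  cle c1 c2 -> cle c2 c3 -> F c2 <> None.

Lemma ranked_ext r r' F : (forall c x, F c = Some x -> r x = r' x) -> ranked r F -> ranked r' F.
Proof.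
move=> E H c d x y Ex Ey le; rewrite -(E _ _ Ex) -(E _ _ Ey); exact: H le.
Qed.

(** As s and t have consecutive ranks, no other letter fits between them: this makes their region
    convex and separates it strictly from all other letters. Sorting the region then exchanges just
    these two ranks. *)
Lemma toggle_ranked r r' s t F :
  {homo (fun a => r (inl a)) : a b / (a < b)%N} -> {homo (fun a => r (inr a)) : a b / (a < b)%N} ->
  r (inr t) = (r (inl s)).+1 ->
  (forall c x, F c = Some x -> r x = r (inl s) -> x = inl s) ->
  (forall c x, F c = Some x -> r x = r (inr t) -> x = inr t) ->
  r' (inl s) = r (inr t) -> r' (inr t) = r (inl s) ->
  (forall x, x <> inl s -> x <> inr t -> r' x = r x) ->
  ranked r F -> dom_convex F -> finite_set [set c | F c <> None] ->
  exists F', [/\ switches F F', ranked r' F',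
    (forall c, region s t F' c <-> region s t F c) /\ (forall c, ~ region s t F c -> F' c = F c),
    forall i, ncard (rowset s t F' i) = ncard (rowset s t F i)
  & [/\ perf F', togglable s t F, togglable s t F' &
     forall c d, cle c d -> F' c = Some (inl s) -> F' d = Some (inr t) -> False]].
Proof.
move=> hl hr rt injs injt rs' rt' ro rk cv fin.
have monol a b : (r (inl a) < r (inl b))%N -> (a < b)%N.
  by case: (ltngtP a b) => // [/hl|->]; lia.
have monor a b : (r (inr a) < r (inr b))%N -> (a < b)%N.
  by case: (ltngtP a b) => // [/hr|->]; lia.
have regr c x : region s t F c -> F c = Some x -> r x = r (inl s) \/ r x = r (inr t).
  by move=> [->|->] [<-]; [left|right].
have rreg c x : F c = Some x -> r x = r (inl s) \/ r x = r (inr t) -> region s t F c.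
  by move=> E [e|e]; [left; rewrite E (injs _ _ E e)|right; rewrite E (injt _ _ E e)].
have nreg c x : F c = Some x -> x <> inl s -> x <> inr t -> r x <> r (inl s) /\ r x <> r (inr t).
  by move=> E n1 n2; split=> e; [case: n1; apply: injs E e|case: n2; apply: injt E e].
have regx c : region s t F c -> exists x, F c = Some x.
  by move=> [E|E]; rewrite E; eexists.
have pF : perf F.
  apply: perfI => c d a b Ea Eb le; have [l1 l2] := rk _ _ _ _ Ea Eb le.
    split=> [|/l2/monol //]; rewrite leqNgt; apply/negP => /hl; lia.
  split=> [|/l2/monor //]; rewrite leqNgt; apply/negP => /hr; lia.
have tF : togglable s t F.
  split.
  - move=> c1 c2 c3 r1 r3 l1 l2; have [x1 E1] := regx _ r1; have [x3 E3] := regx _ r3.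
    have : F c2 <> None by apply: (cv c1 c2 c3) => //; rewrite ?E1 ?E3.
    case E2: (F c2) => [x2|] // _; apply: (rreg _ _ E2).
    have [h1 _] := rk _ _ _ _ E1 E2 l1; have [h2 _] := rk _ _ _ _ E2 E3 l2.
    by have := regr _ _ r1 E1; have := regr _ _ r3 E3; move: h1 h2; rewrite rt; lia.
  - move=> c d y rc Ed ys; have [x E] := regx _ rc.
    have [n1 n2] : r (inl y) <> r (inl s) /\ r (inl y) <> r (inr t).
      by apply: (nreg _ _ Ed) => // -[].
    have hx := regr _ _ rc E.
    split=> le; apply: monol.
      by have [h1 _] := rk _ _ _ _ E Ed le; move: n1 n2 hx h1; rewrite rt; lia.
    by have [h1 _] := rk _ _ _ _ Ed E le; move: n1 n2 hx h1; rewrite rt; lia.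
  - move=> c d y rc Ed ys; have [x E] := regx _ rc.
    have [n1 n2] : r (inr y) <> r (inl s) /\ r (inr y) <> r (inr t).
      by apply: (nreg _ _ Ed) => // -[].
    have hx := regr _ _ rc E.
    split=> le; apply: monor.
      by have [h1 _] := rk _ _ _ _ E Ed le; move: n1 n2 hx h1; rewrite rt; lia.
    by have [h1 _] := rk _ _ _ _ Ed E le; move: n1 n2 hx h1; rewrite rt; lia.
  - by move=> c d ab E1 E2; have [_ /(_ ab)] := rk _ _ _ _ E1 E2 (above_cle ab); rewrite ltnn.
  - by move=> c d ab E1 E2; have [_ /(_ ab)] := rk _ _ _ _ E1 E2 (above_cle ab); rewrite ltnn.
have [F' [sw [pF' tF'] [rE out] rows srt]] := toggle_exists fin pF tF.
exists F'; split=> // c d x y Ex Ey le.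
have offF e z : F' e = Some z -> ~ region s t F e -> F e = Some z /\ r' z = r z.
  move=> E nr; have E' : F e = Some z by rewrite -out.
  split=> //; apply: ro => Ez; apply: nr; [left|right]; by rewrite E' Ez.
have onF e z : F' e = Some z -> region s t F e ->
    exists z', [/\ F e = Some z', r z' = r (inl s) \/ r z' = r (inr t) & z = inl s \/ z = inr t].
  move=> E re; have [z' E'] := regx _ re; exists z'; split=> //; first exact: regr re E'.
  by move/rE: re; rewrite /region E => -[[]|[]]; [left|right].
have [rc|rc] := pselect (region s t F c); have [rd|rd] := pselect (region s t F d).
- have [_ [_ _ hx]] := onF _ _ Ex rc; have [_ [_ _ hy]] := onF _ _ Ey rd.
  case: hx hy => e1 [] e2; rewrite e1 e2 ?leqnn in Ex Ey *.
  + by split=> // ab; case: (tog_in2 tF' ab Ex Ey).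
  + by case: (srt _ _ le Ex Ey).
  + by rewrite rs' rt' rt; split.
  + by split=> // ab; case: (tog_out2 tF' ab Ex Ey).
- have [z [Ez hz hx]] := onF _ _ Ex rc; have [Fy ->] := offF _ _ Ey rd.
  have [h1 _] := rk _ _ _ _ Ez Fy le.
  have [n1 n2] : r y <> r (inl s) /\ r y <> r (inr t).
    by split=> e; apply: rd; apply: rreg Fy _; [left|right].
  by case: hx => ->; rewrite ?rs' ?rt'; move: n1 n2 hz h1; rewrite rt; lia.
- have [z [Ez hz hy]] := onF _ _ Ey rd; have [Fx ->] := offF _ _ Ex rc.
  have [h1 _] := rk _ _ _ _ Fx Ez le.
  have [n1 n2] : r x <> r (inl s) /\ r x <> r (inr t).
    by split=> e; apply: rc; apply: rreg Fx _; [left|right].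
  by case: hy => ->; rewrite ?rs' ?rt'; move: n1 n2 hz h1; rewrite rt; lia.
- have [Fx ->] := offF _ _ Ex rc; have [Fy ->] := offF _ _ Ey rd.
  exact: rk Fx Fy le.
Qed.

Definition rowcount F (i k : nat) : nat := ncard [set c | F c = Some (inr k) /\ (c.1 < i)%N].
Definition cols F (i : nat) x : set int := [set j | exists i' : 'I_n, i' = i :> nat /\ F (i', j) = Some x].

Definition domfin F := finite_set [set c | F c <> None].

Lemma fin_sub F (A : set cell) : domfin F -> (forall c, A c -> F c <> None) -> finite_set A.
Proof. by move=> fin AF; apply: sub_finite_set fin. Qed.

Lemma cols_finite F i x : domfin F -> finite_set (cols F i x).
Proof.
move=> fin; apply: (@sub_finite_set _ _ (snd @` [set c | F c <> None])); last exact: finite_image.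
by move=> j [i' [_ E]]; exists (i', j) => //=; rewrite E.
Qed.

Lemma ncard_cols F i x (A : set int) :
  ncard [set c | [/\ F c = Some x, c.1 = i :> nat & A c.2]] = ncard (cols F i x `&` A).
Proof.
apply: (@ncard_bij _ _ _ _ snd); split.
- by move=> [i' j] [/= E ei Aj]; split=> //; exists i'.
- move=> [i1 j1] [i2 j2] /set_mem [/= _ e1 _] /set_mem [/= _ e2 _] ej.
  by apply: cell_ext => //=; rewrite e1 e2.
- by move=> j [[i' [ei E]] Aj]; exists (i', j).
Qed.

Lemma rowcountS F i k : domfin F ->
  rowcount F i.+1 k = (rowcount F i k + ncard (cols F i (inr k)))%N.
Proof.
move=> fin; rewrite -[cols _ _ _]setIT -ncard_cols -ncardU.
- congr ncard; apply/seteqP; split => c /=.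
    by rewrite ltnS leq_eqVlt => -[E /orP[/eqP e|l]]; [right|left].
  by move=> [[E l]|[E e _]]; split=> //; [exact: ltnW|rewrite e].
- by apply: (fin_sub fin) => c [/= ->].
- by apply: (fin_sub fin) => c [/= ->].
- by move=> c [[/= _ l] [/= _ e _]]; rewrite e ltnn in l.
Qed.

Definition overlap F s i k : nat :=
  if i is i'.+1 then ncard (cols F i' (inr k) `&` cols F i (inl s)) else 0%N.

(* The row form of the lattice condition on the outer letters, corrected when
   the inner letter s is ranked between the outer letters t - 1 and t. *)
Definition rlattice F s t := forall i k,
  (rowcount F i.+1 k.+1 + (if k.+1 == t then overlap F s i k else 0) <= rowcount F i k)%N.

(** By [col_two] an s above a t stands directly above it, so the additional cells of [rowset] can be
    counted by their columns. *)
Lemma rowcount_rowset s t F i : domfin F -> togglable s t F ->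
  ncard (rowset s t F i) = (rowcount F i t + (if i is i'.+1 then ncard (cols F i' (inl s) `&` cols F i (inr t)) else 0))%N.
Proof.
move=> fin tg; have -> : (if i is i'.+1 then ncard (cols F i' (inl s) `&` cols F i (inr t)) else 0%N)
   = ncard [set c | [/\ F c = Some (inr t), c.1 = i :> nat & exists2 i', i'.+1 = i & cols F i' (inl s) c.2]].
  case: i => [|i].
    rewrite (_ : [set c | _] = set0) ?ncard0 //.
    by apply/seteqP; split => c //= -[_ _ []].
  rewrite (ncard_cols F i.+1 (inr t) [set j | exists2 i', i'.+1 = i.+1 & cols F i' (inl s) j]) setIC.
  by congr ncard; apply/seteqP; split => j [h1 h2]; split=> //; [exists i|case: h2 => i' [->]].
rewrite -ncardU.
- congr ncard; apply/seteqP; split => c /=.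
    move=> [E [l|[e [d [ab Ed]]]]]; first by left.
    right; split=> //; exists d.1.
      by rewrite -e (col_two tg _ _ ab) //; [left|right].
    by exists d.1; split=> //; case: d ab Ed => i' j; rewrite /above /= => /andP[/eqP <-].
  move=> [[E l]|[E e [i' ei [i2 [e2 E2]]]]]; first by split=> //; left.
  split=> //; right; split=> //; exists (i2, c.2); split=> //.
  by rewrite /above /= eqxx e2 e -ei ltnSn.
- by apply: (fin_sub fin) => c [/= ->].
- by apply: (fin_sub fin) => c [/= ->].
- by move=> c [[/= _ l] [/= _ e _]]; rewrite e ltnn in l.
Qed.

(** For k = t, columns with s over t become columns with t over s, and both sides of the inequality
    grow by their number. For k + 1 = t only the left side grows, by the number V of columns with s
    in row i over t in row i + 1; the old inequality one row further down makes up for this through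
    [key]. *)
Lemma rlattice_toggle r s t F F' : domfin F -> domfin F' -> dom_convex F ->
  (forall k, k.+1 = t -> r (inl s) = (r (inr k)).+1) -> r (inr t) = (r (inl s)).+1 ->
  (forall c x, F c = Some x -> r x = r (inl s) -> x = inl s) ->
  (forall c x, F c = Some x -> r x = r (inr t) -> x = inr t) ->
  ranked r F ->
  (forall c, region s t F' c <-> region s t F c) -> (forall c, ~ region s t F c -> F' c = F c) ->
  (forall i, ncard (rowset s t F' i) = ncard (rowset s t F i)) ->
  togglable s t F -> togglable s t F' ->
  (forall c d, cle c d -> F' c = Some (inl s) -> F' d = Some (inr t) -> False) ->
  rlattice F s t -> rlattice F' s t.+1.
Proof.
move=> fin fin' cv rpred rt injs injt rk rE out rows tg tg' srt lat i k.
have up' : upright s t F' by move=> c d ab; apply: srt; apply: above_cle.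
have upr : forall i, cols F' i (inl s) `&` cols F' i.+1 (inr t) = set0.
  move=> i0; apply/seteqP; split => j // -[[i1 [e1 E1]] [i2 [e2 E2]]].
  by apply: (up' _ _ _ E1 E2); rewrite /above /= eqxx e1 e2 ltnSn.
have other x : x <> inl s -> x <> inr t -> forall c, F' c = Some x <-> F c = Some x.
  move=> n1 n2 c; split=> E.
    have [rc|/out <- //] := pselect (region s t F c).
    by move/rE: rc => -[] E'; move: E; rewrite E' => -[] /esym.
  by rewrite out // => -[] E'; move: E; rewrite E' => -[] /esym.
have same k' i' : k' <> t -> rowcount F' i' k' = rowcount F i' k'.
  move=> kt; have e c : F' c = Some (inr k') <-> F c = Some (inr k') by apply: other => // -[].
  by congr ncard; apply/seteqP; split => c [E l]; split=> //; apply/e.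
have rcT i' : rowcount F' i' t = (rowcount F i' t +
     (if i' is i0.+1 then ncard (cols F i0 (inl s) `&` cols F i' (inr t)) else 0))%N.
  have := rows i'; rewrite !rowcount_rowset // => <-.
  by case: i' => [|i']; rewrite ?upr ?ncard0 addn0.
have two i0 : cols F' i0 (inr t) `&` cols F' i0.+1 (inl s) = cols F i0 (inl s) `&` cols F i0.+1 (inr t).
  apply/seteqP; split => j [[i1 [e1 E1]] [i2 [e2 E2]]].
    have r1 : region s t F (i1, j) by rewrite -rE; right.
    have r2 : region s t F (i2, j) by rewrite -rE; left.
    have ab : above ((i1, j) : cell) (i2, j) by rewrite /above /= eqxx e1 e2 ltnSn.
    case: r1 => E3; case: r2 => E4.
    - by case: (tog_in2 tg ab E3 E4).
    - by split; [exists i1|exists i2].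
    - have := rk _ _ _ _ E3 E4 (above_cle ab); rewrite rt => -[]; lia.
    - by case: (tog_out2 tg ab E3 E4).
  have r1 : region s t F' (i1, j) by rewrite rE; left.
  have r2 : region s t F' (i2, j) by rewrite rE; right.
  have ab : above ((i1, j) : cell) (i2, j) by rewrite /above /= eqxx e1 e2 ltnSn.
  case: r1 => E3; case: r2 => E4.
  - by case: (tog_in2 tg' ab E3 E4).
  - by case: (up' _ _ ab E3 E4).
  - by split; [exists i1|exists i2].
  - by case: (tog_out2 tg' ab E3 E4).
have [kt|kt] := eqVneq k.+1 t.
  have kt' : k <> t by lia.
  have -> : (k.+1 == t.+1) = false by lia.
  rewrite addn0 (same k) // kt rcT.
  have lat0 := lat i k; rewrite kt eqxx in lat0.
  set V := ncard _; have [->|Vpos] := posnP V; first by rewrite addn0; lia.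
  have [j0 [[i1 [e1 E1]] [i2 [e2 E2]]]] : exists j, (cols F i (inl s) `&` cols F i.+1 (inr t)) j.
    apply: contrapT => H; move: Vpos; rewrite /V (_ : _ `&` _ = set0) ?ncard0 //.
    by apply/seteqP; split => j // hj; apply: H; exists j.
  have lat1 := lat i.+1 k; rewrite kt eqxx /= !rowcountS // in lat1.
  rewrite [rowcount F i.+1 t]rowcountS // in lat0 *.
  (* Each k in row i lies to the left of the s at column j0, having smaller rank; the cell below it
     lies to the left of the t at j0, so it holds s or t. *)
  have key : (ncard (cols F i (inr k)) + V <= ncard (cols F i.+1 (inr t)) +
     ncard (cols F i (inr k) `&` cols F i.+1 (inl s)))%N.
    have fc i' x : finite_set (cols F i' x) by apply: cols_finite.
    have fI i' x B : finite_set (cols F i' x `&` B) by apply: finite_setIl.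
    rewrite /V -[leqLHS]ncardU //; last first.
      move=> j [[i3 [e3 E3]] [[i4 [e4 E4]] _]].
      have e : i3 = i4 by apply/ord_inj; rewrite e3 e4.
      by rewrite e E4 in E3.
    apply: leq_trans (ncardU_le (fc _ _) (fI _ _ _)); apply: ncard_le.
      by rewrite finite_setU.
    move=> j [[i3 [e3 E3]]|[_ h]]; last by left.
    have e31 : i3 = i1 by apply/ord_inj; rewrite e3 e1.
    rewrite e31 in E3.
    have jj : j < j0.
      rewrite ltNge; apply/negP => jj.
      have [] := rk _ _ _ _ E1 E3; first by rewrite /cle /= leqnn jj.
      by rewrite (rpred _ kt); lia.
    have l1 : cle ((i1, j) : cell) (i2, j) by rewrite /cle /= lexx e1 e2; lia.
    have l2 : cle ((i2, j) : cell) (i2, j0) by rewrite /cle /= leqnn; lia.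
    have ab : above ((i1, j) : cell) (i2, j) by rewrite /above /= eqxx e1 e2 ltnSn.
    have : F (i2, j) <> None by apply: (cv _ _ _ _ _ l1 l2); rewrite ?E3 ?E2.
    case E4: (F (i2, j)) => [x|] // _.
    have [_ /(_ ab) h1] := rk _ _ _ _ E3 E4 l1; have [h2 _] := rk _ _ _ _ E4 E2 l2.
    have [h|h] : r x = r (inl s) \/ r x = r (inr t) by move: h1 h2; rewrite rt (rpred _ kt); lia.
      right; split; first by exists i1.
      by exists i2; split=> //; rewrite E4 (injs _ _ E4 h).
    by left; exists i2; split=> //; rewrite E4 (injt _ _ E4 h).
  by move: key lat1; rewrite /V; lia.
have lat0 := lat i k; rewrite (negbTE kt) addn0 in lat0.
rewrite eqSS same; last exact/eqP.
have [kt2|kt2] := eqVneq k t; last by rewrite addn0 same //; exact/eqP.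
rewrite kt2 rcT; rewrite kt2 in lat0; rewrite /overlap; case: i lat0 => [|i] lat0; first by rewrite !addn0.
by rewrite two leq_add2r.
Qed.

(* A linear order for which the tableau is increasing just before the inner letter s
   passes the outer letter t: inner letters < s, outer letters < t, s, outer letters
   >= t, inner letters > s. *)
Definition rk (s t : nat) (x : nat + nat) : nat :=
  match x with
  | inl a => if (a < s)%N then a else if a == s then (s + t)%N else (n + a)%N
  | inr b => if (b < t)%N then (s + b)%N else (s + b).+1
  end.

Definition smallr F := forall c a, F c = Some (inr a) -> (a < n)%N.
Definition small F := smallr F /\ forall c a, F c = Some (inl a) -> (a < n)%N.

Lemma switches_small F F' : switches F F' -> small F -> small F'.
Proof.
move=> H; induction H as [S S' h|S|S S' S'' h IH h' IH'] => //; last by move=> /IH/IH'.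
move: h => /switch_ex[c [c' [a [b [_ Ea Eb -> _]]]]] [s1 s2].
split=> d x; rewrite interchange_tp; [exact: s1|exact: s2].
Qed.

Lemma switches_domE F F' c : switches F F' -> (F' c <> None) <-> (F c <> None).
Proof. by move=> /(switches_dom c) E; split => h h'; apply: h; apply/E. Qed.

Lemma switches_domfin F F' : switches F F' -> domfin F -> domfin F'.
Proof. by move=> sw; apply: sub_finite_set => c /= /(switches_domE c sw). Qed.

Lemma switches_convex F F' : switches F F' -> dom_convex F -> dom_convex F'.
Proof.
by move=> sw cv c1 c2 c3; rewrite !(switches_domE _ sw); apply: cv.
Qed.

Lemma pass_one s t F : (s < n)%N -> (t < n)%N -> domfin F -> dom_convex F -> small F ->
  ranked (rk s t) F -> rlattice F s t ->
  exists F', [/\ switches F F', ranked (rk s t.+1) F' & rlattice F' s t.+1].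
Proof.
move=> sn tn fin cv [smr sml] rF lat.
have es : rk s t (inl s) = (s + t)%N by rewrite /rk ltnn eqxx.
have et : rk s t (inr t) = (s + t).+1 by rewrite /rk ltnn.
have rt : rk s t (inr t) = (rk s t (inl s)).+1 by rewrite es et.
have injs c x : F c = Some x -> rk s t x = rk s t (inl s) -> x = inl s.
  rewrite es; case: x => [a|b] Ex /=; last by case: ltnP => h1 h2; exfalso; lia.
  by case: ltnP => h1; [move=> h2; exfalso; lia|case: eqP => [->//|_ h2]; exfalso; lia].
have injt c x : F c = Some x -> rk s t x = rk s t (inr t) -> x = inr t.
  rewrite et; case: x => [a|b] Ex /=.
    by case: ltnP => h1; [move=> h2; exfalso; lia|case: eqP => h2 h3; exfalso; lia].
  by case: ltnP => h1 h2; congr inr; lia.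
have hl : {homo (fun a => rk s t (inl a)) : a b / (a < b)%N}.
  by move=> a b ab /=; case: (ltnP a s); case: (ltnP b s); case: (eqVneq a s); case: (eqVneq b s); lia.
have hr : {homo (fun a => rk s t (inr a)) : a b / (a < b)%N}.
  by move=> a b ab /=; case: (ltnP a t); case: (ltnP b t); lia.
have [||| F' [sw rF' [rE out] rows [pF' tF tF' srt]]] :=
    @toggle_ranked _ (rk s t.+1) _ _ _ hl hr rt injs injt _ _ _ rF cv fin.
- by rewrite et /rk ltnn eqxx addnS.
- by rewrite es /rk ltnSn.
- move=> [a|b] h1 h2 /=; last first.
    have bt : b <> t by move=> e; apply: h2; rewrite e.
    by case: (ltnP b t.+1); case: (ltnP b t); lia.
  by case: ltnP => // _; case: eqP => // e; case: h1; rewrite e.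
exists F'; split=> //; apply: (rlattice_toggle fin _ cv _ rt injs injt) lat => //.
  exact: switches_domfin fin.
by move=> k kt; rewrite es /rk; case: ltnP; lia.
Qed.

Lemma pass_letter s F : (s < n)%N -> domfin F -> dom_convex F -> small F ->
  ranked (rk s 0) F -> rlattice F s 0 ->
  exists F', [/\ switches F F', ranked (rk s n) F' & rlattice F' s n].
Proof.
move=> sn fin cv sm rF lat.
suff H t : (t <= n)%N -> exists F', [/\ switches F F', ranked (rk s t) F' & rlattice F' s t].
  exact: H.
elim: t => [|t IH] tn; first by exists F; split=> //; exact: rt_refl.
have [F1 [sw1 r1 l1]] := IH (ltnW tn).
have [F2 [sw2 r2 l2]] := pass_one sn tn (switches_domfin sw1 fin) (switches_convex sw1 cv)
  (switches_small sw1 sm) r1 l1.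
by exists F2; split=> //; apply: rt_trans sw1 sw2.
Qed.

(** The largest inner letter passes first, so that the others still rank below all outer letters.
    The correction in [rlattice] is void at t = 0 and can be discarded at t = n. *)
Lemma pass_all F : domfin F -> dom_convex F -> small F ->
  ranked (fun x => match x with inl a => a | inr b => (n + b)%N end) F ->
  (forall i k, rowcount F i.+1 k.+1 <= rowcount F i k)%N ->
  exists F', [/\ switches F F',
    ranked (fun x => match x with inl a => (n + a)%N | inr b => b end) F'
    & forall i k, (rowcount F' i.+1 k.+1 <= rowcount F' i k)%N].
Proof.
move=> fin cv sm rF lat.
pose r m (x : nat + nat) := match x with inl a => if (a < m)%N then a else (n + a)%N | inr b => (m + b)%N end.
suff H e : forall m, (m + e = n)%N -> exists F', [/\ switches F F', ranked (r m) F'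
    & forall i k, (rowcount F' i.+1 k.+1 <= rowcount F' i k)%N].
  have [F' [sw rF' l']] := H n 0%N (add0n n).
  by exists F'; split=> //; apply: ranked_ext rF' => c [a|b].
elim: e => [|e IH] m md.
  exists F; split=> //; first exact: rt_refl.
  rewrite addn0 in md; rewrite md; apply: ranked_ext rF => c [a|b] E //=.
  by rewrite ifT //; apply: sm.2 E.
have [F1 [sw1 r1 l1]] := IH m.+1 ltac:(lia).
have sm1 := switches_small sw1 sm.
have [|| F2 [sw2 r2 l2]] := @pass_letter m F1 ltac:(lia) (switches_domfin sw1 fin) (switches_convex sw1 cv) sm1.
- apply: ranked_ext r1 => c [a|b] E /=; last by lia.
  rewrite addn0 ltnS; case: (ltngtP a m) => //; lia.
- by move=> i k /=; rewrite addn0.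
exists F2; split; first exact: rt_trans sw1 sw2.
  have sm2 := switches_small sw2 sm1.
  apply: ranked_ext r2 => c [a|b] E /=.
    by case: ltnP => // _; case: eqP => // ->; rewrite addnC.
  by rewrite ifT //; apply: sm2.1 E.
by move=> i k; apply: leq_trans (l2 i k); rewrite leq_addr.
Qed.

End Passes.

(** * The lattice condition *)

Lemma finite_itv (l u : int) : finite_set [set j : int | l < j <= u].
Proof.
apply: (@sub_finite_set _ _ ((fun k : nat => l + k%:Z) @` `I_(absz (u - l)).+1)).
  move=> j /= h; exists (absz (j - l)) => /=; lia.
by apply: finite_image; exact: finite_II.
Qed.

Lemma finite_skew n (lam mu : zvec n) : finite_set [set c | in_skew lam mu c].
Proof.
apply: (@sub_finite_set _ _ [set p : 'I_n * int | predT p.1 /\ [set j : int | mu p.1 < j <= lam p.1] p.2]).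
  by move=> c /= h; split.
apply: (@finite_dep _ _ predT (fun i => [set j : int | mu i < j <= lam i])) => i _.
exact: finite_itv.
Qed.

Lemma SST_finite d (X : orderType d) deg n (lam mu : zvec n) (T : filling n X) :
  SST deg lam mu T -> finite_set [set c | T c <> None].
Proof.
move=> [_ dom _ _]; apply: sub_finite_set (finite_skew lam mu) => c /=.
by rewrite dom.
Qed.

Lemma ncard_count (T : choiceType) (P : pred T) (l : seq T) : uniq l ->
  (forall c, P c -> c \in l) -> ncard [set c | P c] = count P l.
Proof.
move=> ul Pl; rewrite -size_filter; have uf := filter_uniq P ul.
rewrite /ncard (_ : fset_set _ = [fset x in filter P l]%fset).
  by rewrite card_fseq undup_id.
have fin : finite_set [set c | P c].
  apply: (@sub_finite_set _ _ [set` l]) => [c /= /Pl //|]; exact: finite_seq.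
apply/fsetP => x; rewrite in_fset_set // inE mem_filter.
apply/idP/andP => [/set_mem Px|[Px _]]; last exact: mem_set.
by split=> //; apply: Pl.
Qed.

Lemma min_column n (A : set ('I_n * int)) c : finite_set A -> A c ->
  exists2 c0, A c0 & forall d, A d -> c0.2 <= d.2.
Proof.
move=> fin Ac; have cA : c \in fset_set A by rewrite in_fset_set // mem_set.
case: (arg_minP (P := predT) (i0 := [` cA]%fset) (fun x : fset_set A => (val x).2)) => // x _ xmin.
exists (val x) => [|d Ad]; first by have := valP x; rewrite in_fset_set // => /set_mem.
have dA : d \in fset_set A by rewrite in_fset_set // mem_set.
exact: xmin [` dA]%fset isT.
Qed.

Section Lattice.
Variable n : nat.
Local Notation cell := ('I_n * int)%type.
Implicit Types (c d : cell) (lam mu nu : zvec n) (T Q : filling n nat).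

Local Notation SSTn := (SST (fun _ : nat => false)).

Lemma SST_cle lam mu T : gpart lam -> gpart mu -> SSTn lam mu T ->
  forall c d a b, T c = Some a -> T d = Some b -> cle c d ->
    (a <= b)%N /\ (above c d -> (a < b)%N).
Proof.
move=> gl gm [sub dom row col] [i j] [i' j'] a b Ea Eb /andP[/= li lj].
have sk c x : T c = Some x -> in_skew lam mu c by move=> E; apply/dom; rewrite E.
have colS : forall (i i' : 'I_n) (j : int) a b, (i < i')%N -> T (i, j) = Some a ->
   T (i', j) = Some b -> (a < b)%N.
  by move=> i1 i2 j1 a1 b1 l E1 E2; have [_ /(_ isT isT)] := col _ _ _ _ _ l E1 E2; rewrite ltEnat.
have rowS : forall (i : 'I_n) (j j' : int) a b, j <= j' -> T (i, j) = Some a ->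
   T (i, j') = Some b -> (a <= b)%N.
  move=> i1 j1 j2 a1 b1; rewrite le_eqVlt => /orP[/eqP ->|l] E1 E2.
    by move: E2; rewrite E1 => -[->].
  by have [] := row _ _ _ _ _ l E1 E2; rewrite leEnat.
move: li; rewrite leq_eqVlt => /orP[/eqP/ord_inj ii|li].
  rewrite -{}ii in Eb *; split; first exact: rowS lj Ea Eb.
  by rewrite /above /= ltnn andbF.
have : T (i, j') <> None.
  apply/dom; have := sk _ _ Ea; have := sk _ _ Eb; rewrite /in_skew /=.
  by have := gl i i' (ltnW li); lia.
case E: (T (i, j')) => [x|] // _.
have h1 := rowS _ _ _ _ _ lj Ea E; have h2 := colS _ _ _ _ _ li E Eb.
by split=> [|_]; lia.
Qed.

(* The lattice condition, tested after each complete column of the word. *)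
Definition clattice T := forall (j : int) k,
  (ncard [set c | T c = Some k.+1 /\ (j <= c.2)%R] <= ncard [set c | T c = Some k /\ (j <= c.2)%R])%N.

Definition cellseq (s : seq nat) : seq cell := [seq (i, j%:Z) | j <- s, i <- enum 'I_n].

Lemma mem_cellseq_iota a b c : (c \in cellseq (rev (iota a b))) = (a%:Z <= c.2) && (c.2 < (a + b)%:Z).
Proof.
apply/allpairsP/idP => [[[j i] [/= + _ ->]]|h].
  by rewrite mem_rev mem_iota /=; lia.
exists (absz c.2, c.1); split; rewrite /= ?mem_enum //; first by rewrite mem_rev mem_iota; lia.
by case: c h => i j /= h; congr pair; lia.
Qed.

Lemma uniq_cellseq s : uniq s -> uniq (cellseq s).
Proof.
move=> us; apply: allpairs_uniq => //; first exact: enum_uniq.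
by move=> [j i] [j' i'] _ _ [-> ->].
Qed.

Lemma cellseq_cat s1 s2 : cellseq (s1 ++ s2) = cellseq s1 ++ cellseq s2.
Proof. by elim: s1 => //= j s1 IH; rewrite /cellseq /= -catA; congr cat. Qed.

(** The reading order of words: columns from right to left, each from the top. *)
Definition before d c := (c.2 < d.2) || ((c.2 == d.2) && (d.1 < c.1)%N).

Lemma pairwise_cellseq s : pairwise (fun x y => y < x)%N s -> pairwise before (cellseq s).
Proof.
elim: s => //= j s IH /andP[js ps]; rewrite /cellseq /= pairwise_cat; apply/and3P; split.
- apply/allrelP => c d /mapP[i _ ->] /allpairsP[[j' i'] [/= j's _ ->]].
  by move/allP/(_ _ j's): js; rewrite /before /=; lia.
- rewrite pairwise_map; have := iota_ltn_sorted 0 n.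
  rewrite -val_enum_ord (sorted_pairwise ltn_trans) pairwise_map.
  by apply: sub_pairwise => x y /=; rewrite /before /= ltxx eqxx.
- exact: IH.
Qed.

Lemma wordE lam T : word lam T = pmap T (cellseq (rev (iota 1 (maxcol lam)))).
Proof. by []. Qed.

Lemma count_pmap T k (l : seq cell) : count_mem k (pmap T l) = count (fun c => T c == Some k) l.
Proof. by elim: l => //= c l <-; case: (T c). Qed.

Lemma take_pmap (A B : Type) (f : A -> option B) m l : exists m', take m (pmap f l) = pmap f (take m' l).
Proof.
elim: l m => [|x l IH] m; first by exists 0%N.
rewrite /=; case E: (f x) => [y|] /=.
  case: m => [|m]; first by exists 0%N.
  by have [m' Em] := IH m; exists m'.+1; rewrite /= E Em.
by have [m' Em] := IH m; exists m'.+1; rewrite /= E Em.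
Qed.

Lemma maxcol_le lam i : lam i <= (maxcol lam)%:Z.
Proof.
have : (absz (lam i) <= maxcol lam)%N by rewrite /maxcol (bigD1 i) //= leq_maxl.
lia.
Qed.

(** Letters increase down a column, so k is read there before k + 1. Hence a prefix can be compared
    with the columns from its leftmost k + 1 on: every k in these columns has been read. *)
Lemma lattice_clattice lam mu T : part lam -> part mu -> SSTn lam mu T ->
  lattice (word lam T) <-> clattice T.
Proof.
move=> [gl pl] [gm pm] ST; have fin := SST_finite ST.
have [sub dom _ _] := ST; have le := SST_cle gl gm ST.
pose M := maxcol lam; pose l := cellseq (rev (iota 1 M)).
have inT c a : T c = Some a -> 0 < c.2 /\ c.2 <= M%:Z.
  move=> E; have : in_skew lam mu c by apply/dom; rewrite E.
  rewrite /in_skew; have := maxcol_le lam c.1; have := pm c.1; rewrite /M; lia.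
have finE (P : set cell) : finite_set [set c | T c <> None /\ P c].
  by apply: sub_finite_set fin => c [].
have colcount (j : nat) k : (j <= M)%N ->
    count_mem k (pmap T (cellseq (rev (iota j.+1 (M - j))))) = ncard [set c | T c = Some k /\ j.+1%:Z <= c.2].
  move=> jM; rewrite count_pmap -size_filter.
  have -> : [set c | T c = Some k /\ j.+1%:Z <= c.2] = [set c | (T c == Some k) && (j.+1%:Z <= c.2)].
    by apply/seteqP; split => c /= => [[/eqP -> ->]|/andP[/eqP]].
  rewrite (@ncard_count _ _ (cellseq (rev (iota j.+1 (M - j))))).
  - rewrite size_filter; apply: eq_in_count => c; rewrite mem_cellseq_iota => /andP[-> _].
    by rewrite andbT.
  - by apply: uniq_cellseq; rewrite rev_uniq iota_uniq.
  - move=> c /andP[/eqP E h]; rewrite mem_cellseq_iota h /=; have := inT _ _ E; lia.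
split=> [lat j k|clat m k].
  (* All columns outside 1, ..., M are empty, so j is clipped; the columns from j on become those
     after jn, which form a prefix of the word. *)
  pose jn := if j <= 1 then 0%N else if M%:Z < j then M else (absz j).-1.
  have jM : (jn <= M)%N by rewrite /jn; case: ifP => //; case: ifP => //; lia.
  have eqj x : [set c | T c = Some x /\ j <= c.2] = [set c | T c = Some x /\ jn.+1%:Z <= c.2].
    apply/seteqP; split => c /= -[E h]; split=> //; have := inT _ _ E; move: h; rewrite /jn;
      case: ifP => h1; [|case: ifP => h2| |case: ifP => h2]; lia.
  rewrite !eqj -!colcount //.
  have := lat (size (pmap T (cellseq (rev (iota jn.+1 (M - jn)))))) k.
  rewrite wordE -/M.
  have -> : iota 1 M = iota 1 jn ++ iota jn.+1 (M - jn) by rewrite -iotaD subnKC.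
  by rewrite rev_cat cellseq_cat pmap_cat take_size_cat.
have [m' ->] := take_pmap T m l.
rewrite !count_pmap; set p := take m' l.
have pw : pairwise before l.
  apply: pairwise_cellseq; have := iota_ltn_sorted 1 M.
  rewrite -rev_sorted sorted_pairwise //; by move=> a b c h1 h2; apply: ltn_trans h2 h1.
have pwp : pairwise before p by apply: subseq_pairwise pw; exact: take_subseq.
have up : uniq p by apply: take_uniq; apply: uniq_cellseq; rewrite rev_uniq iota_uniq.
have closed c d : c \in p -> T d <> None -> before d c -> d \in p.
  move=> cp Td dc; have dl : d \in l.
    case E: (T d) Td => [a|] // _; rewrite mem_cellseq_iota; have := inT _ _ E; lia.
  move: dl; rewrite -(cat_take_drop m' l) mem_cat => /orP[//|dd].
  move: pw; rewrite -(cat_take_drop m' l) pairwise_cat => /and3P[/allrelP h _ _].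
  by have := h c d cp dd; move: dc; rewrite /before; lia.
have pcount k0 : count (fun c => T c == Some k0) p = ncard [set c | (T c == Some k0) && (c \in p)].
  rewrite (@ncard_count _ _ p) //; first by apply: eq_in_count => c ->; rewrite andbT.
  by move=> c /andP[].
rewrite !pcount.
have [->|/eqP/eqP/set0P[c Ac]] := eqVneq [set c | (T c == Some k.+1) && (c \in p)] set0.
  by rewrite ncard0.
have finp k0 : finite_set [set c | (T c == Some k0) && (c \in p)].
  by apply: sub_finite_set fin => d /= /andP[/eqP -> _].
have [c0 /= /andP[/eqP E0 p0] cmin] := min_column (finp k.+1) Ac.
apply: leq_trans (leq_trans (clat c0.2 k) _); apply: ncard_le.
- by apply: sub_finite_set fin => d /= [->].
- by move=> d /= h; split; [case/andP: h => /eqP|apply: cmin].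
- exact: finp.
- move=> d /= [E h]; rewrite E eqxx /=; apply: (closed c0) => //; first by rewrite E.
  rewrite /before; case: ltgtP h => //= e _.
  rewrite ltnNge; apply/negP => h; have [] := le _ _ _ _ E0 E; last by lia.
  by rewrite /cle h e lexx.
Qed.

(** Apply [clattice] at the column of the leftmost k + 1 in rows up to i: a letter k in that column
    or further right must lie strictly higher than this k + 1. *)
Lemma clattice_rows lam mu T i k : gpart lam -> gpart mu -> SSTn lam mu T -> clattice T ->
  (ncard [set c | T c = Some k.+1 /\ (c.1 < i.+1)%N] <= ncard [set c | T c = Some k /\ (c.1 < i)%N])%N.
Proof.
move=> gl gm ST clat; have fin := SST_finite ST; have le := SST_cle gl gm ST.
have finE k0 (P : set cell) : finite_set [set c | T c = Some k0 /\ P c].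
  by apply: sub_finite_set fin => c [/= ->].
have [->|/eqP/eqP/set0P[c Ac]] := eqVneq [set c | T c = Some k.+1 /\ (c.1 < i.+1)%N] set0.
  by rewrite ncard0.
have [c0 /= [E0 l0] cmin] := min_column (finE _ _) Ac.
apply: leq_trans (leq_trans (clat c0.2 k) _); apply: ncard_le; try exact: finE.
  by move=> d /= h; split; [case: h|apply: cmin].
move=> d /= [E h]; split=> //; apply: (@leq_trans c0.1); last by rewrite -ltnS.
rewrite ltnNge; apply/negP => l1; have [] := le _ _ _ _ E0 E; last by lia.
by rewrite /cle l1 h.
Qed.

(** Iterated down to the letter 0, the row condition shows that b does not occur above row b.
    Columns that increase strictly from the top give the opposite bound. *)
Lemma straight_entry T : finite_set [set c | T c <> None] ->
  (forall i k, (ncard [set c | T c = Some k.+1 /\ (c.1 < i.+1)%N]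
     <= ncard [set c | T c = Some k /\ (c.1 < i)%N])%N) ->
  (forall c d b, above c d -> T d = Some b -> exists2 b', T c = Some b' & (b' < b)%N) ->
  forall c b, T c = Some b -> b = c.1.
Proof.
move=> fin rows up c b E; apply/eqP; rewrite eqn_leq; apply/andP; split.
  rewrite leqNgt; apply/negP => lt.
  have z : ncard [set c | T c = Some b /\ (c.1 < b)%N] = 0%N.
    elim: (b) => [|b' IH]; last by apply/eqP; rewrite -leqn0 -[leqRHS]IH; apply: rows.
    by rewrite (_ : [set c | _] = set0) ?ncard0 //; apply/seteqP; split => d //= -[].
  have finR : finite_set [set c | T c = Some b /\ (c.1 < b)%N].
    by apply: sub_finite_set fin => d [/= ->].
  have : (0 < ncard [set c | T c = Some b /\ (c.1 < b)%N])%N by apply: (ncard_gt0 finR (x := c)).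
  by rewrite z.
have [m] : exists m, m = c.1 :> nat by exists c.1.
elim: m c b E => [|m IH] c b E cm; first by rewrite -cm.
have lt : (m < n)%N by have := ltn_ord c.1; lia.
pose d : cell := (Ordinal lt, c.2).
have ab : above d c by rewrite /above /d eqxx -cm /=.
by have [b' Eb' lb] := up _ _ _ ab E; have := IH d b' Eb' erefl; rewrite /d /=; lia.
Qed.

End Lattice.

(** * The bijection theta *)

Section Translate.
Variable n : nat.
Implicit Types (lam mu nu : zvec n).

Lemma rect0 : rect n 0 = 0.
Proof. by apply/ffunP => i; rewrite !zvE. Qed.

Lemma translate0 X (T : filling n X) : translate 0 T = T.
Proof. by apply/funext => -[i j]; rewrite /translate /= subr0. Qed.

Definition tcell (s : int) (c : 'I_n * int) : 'I_n * int := (c.1, c.2 - s).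
Lemma tcellK s : cancel (tcell s) (tcell (- s)).
Proof. by case=> i j; rewrite /tcell /= opprK subrK. Qed.
Lemma tcellKV s : cancel (tcell (- s)) (tcell s).
Proof. by case=> i j; rewrite /tcell /= opprK addrK. Qed.

Lemma ncard_tcell s (A : set ('I_n * int)) : ncard [set c | A (tcell s c)] = ncard A.
Proof.
apply: (@ncard_bij _ _ _ _ (tcell s)); split=> //.
- by move=> x y _ _; apply: can_inj (tcellK s) x y.
- by move=> c Ac; exists (tcell (- s) c); rewrite /= tcellKV.
Qed.

Lemma wt_translate (X : eqType) s (T : filling n X) x : wt (translate s T) x = wt T x.
Proof. exact: (ncard_tcell s%:Z [set c | T c = Some x]). Qed.

Lemma gpart_rect lam s : gpart lam -> gpart (lam + rect n s).
Proof. by move=> gl i j ij; rewrite !zvE; have := gl i j ij; lia. Qed.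

Lemma part_rect lam s : part lam -> part (lam + rect n s).
Proof.
by move=> [gl pl]; split; [exact: gpart_rect|move=> i; rewrite !zvE; have := pl i; lia].
Qed.

Lemma SST_translate d (X : orderType d) deg lam mu s (T : filling n X) :
  SST deg (lam + rect n s) (mu + rect n s) (translate s T) <-> SST deg lam mu T.
Proof.
have Tt i j : translate s T (i, j + s%:Z) = T (i, j) by rewrite /translate /= addrK.
split=> -[sub dom row col]; split.
- by move=> i; have := sub i; rewrite !zvE; lia.
- move=> [i j]; have := dom (i, j + s%:Z); rewrite Tt => ->.
  rewrite /in_skew !zvE /=; split; lia.
- by move=> i j j' a b jj; rewrite -!Tt; apply: row; lia.
- by move=> i i' j a b ii; rewrite -!Tt; apply: col.
- by move=> i; have := sub i; rewrite !zvE; lia.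
- move=> [i j]; rewrite /translate (dom _) /in_skew !zvE /=; split; lia.
- by move=> i j j' a b jj; rewrite /translate /=; apply: row; lia.
- by move=> i i' j a b ii; rewrite /translate /=; apply: col.
Qed.

Lemma psize_rect lam s : psize (lam + rect n s) = psize lam + (n * s)%N%:Z.
Proof.
rewrite /psize (eq_bigr (fun i => lam i + s%:Z)); last by move=> i _; rewrite !zvE.
by rewrite big_split /= sumr_const card_ord -mulr_natr; congr (_ + _); lia.
Qed.

Lemma clattice_translate s (T : filling n nat) : clattice (translate s T) <-> clattice T.
Proof.
have E j k : ncard [set c | translate s T c = Some k /\ (j <= c.2)%R] =
    ncard [set c | T c = Some k /\ (j - s%:Z <= c.2)%R].
  rewrite -[RHS](ncard_tcell s%:Z); congr ncard; apply/seteqP.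
  by split => c; rewrite /tcell /translate /= => -[h1 h2]; split=> //; lia.
split=> H j k; last by rewrite !E.
by have := H (j + s%:Z) k; rewrite !E addrK.
Qed.

Lemma LR_translate lam mu nu s Q : LR lam mu nu Q ->
  LR (lam + rect n s) (mu + rect n s) nu (translate s Q).
Proof.
move=> [[pl pm pn] [sub sz] ST w lat].
have ST' : SST (fun _ : nat => false) (lam + rect n s) (mu + rect n s) (translate s Q).
  exact/SST_translate.
split=> //.
- by split=> //; apply: part_rect.
- by split; [case: ST'|rewrite !psize_rect; lia].
- by move=> k; rewrite wt_translate.
apply/(lattice_clattice _ _ ST'); try exact: part_rect.
by apply/clattice_translate/(lattice_clattice pl pm ST).
Qed.

End Translate.

Section Theta.
Variable n : nat.
Local Notation cell := ('I_n * int)%type.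
Implicit Types (c d : cell) (lam mu nu : zvec n) (T Q P : filling n nat).
Local Notation SSTn := (SST (fun _ : nat => false)).

Lemma coord_ord nu (i : 'I_n) : coord nu i = nu i.
Proof. by rewrite /coord valK. Qed.

Lemma coord_ge nu k : (n <= k)%N -> coord nu k = 0.
Proof. by move=> nk; rewrite /coord insubF // ltnNge nk. Qed.

Lemma LR_small lam mu nu Q c k : LR lam mu nu Q -> Q c = Some k -> (k < n)%N.
Proof.
move=> [_ _ ST w _] E; rewrite ltnNge; apply/negP => nk.
have := w k; rewrite coord_ge // => /eqP; rewrite eqz_nat => /eqP w0.
have fin : finite_set [set c | Q c = Some k].
  by apply: sub_finite_set (SST_finite ST) => d /= ->.
by have := ncard_gt0 fin E; rewrite -[ncard _]/(wt Q k) w0.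
Qed.

Section Final.
Variables (lam mu nu : zvec n) (Q : filling n nat).
Hypothesis LRQ : LR lam mu nu Q.

Let gl : gpart lam. Proof. by case: LRQ => -[[]]. Qed.
Let gm : gpart mu. Proof. by case: LRQ => -[_ []]. Qed.
Let pm i : 0 <= mu i. Proof. by case: LRQ => -[_ []]. Qed.
Let ST : SSTn lam mu Q. Proof. by case: LRQ. Qed.

Let F0 := switch_init mu Q.

Let Qdom c : Q c <> None <-> in_skew lam mu c. Proof. by case: ST. Qed.

Let F0in c a : F0 c = Some (inl a) <-> in_skew mu 0 c /\ a = c.1.
Proof.
rewrite /F0 /switch_init; case: ifP => h; first by split=> [[<-]|[_ ->]].
by split=> [|[]//]; case: (Q c).
Qed.

Let F0out c a : F0 c = Some (inr a) <-> Q c = Some a.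
Proof.
rewrite /F0 /switch_init; case: ifP => h.
  split=> // E; have : in_skew lam mu c by apply/Qdom; rewrite E.
  by move: h; rewrite /in_skew; lia.
by case: (Q c) => [x|]; split=> // -[->].
Qed.

Let F0dom c : F0 c <> None <-> in_skew lam 0 c.
Proof.
have sub : subdiag mu lam by case: ST.
have := sub c.1; have := Qdom c; have := pm c.1.
rewrite /F0 /switch_init /in_skew zv0E; case: ifP => h1 h2 h3 h4.
  by split=> // _; lia.
case E: (Q c) h3 => [x|] h3 /=.
  by have := h3.1 ltac:(done); split=> //; lia.
by split=> // h; exfalso; apply: h3.2 => //; lia.
Qed.

Let F0convex : dom_convex F0.
Proof.
move=> c1 c2 c3; rewrite !F0dom /in_skew !zv0E /cle => h1 h2 h3 h4.
by have := gl (i := c2.1) (j := c3.1); lia.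
Qed.

Let F0fin : domfin F0.
Proof.
by apply: sub_finite_set (finite_skew lam 0) => c /F0dom.
Qed.

Let F0small : small F0.
Proof.
split=> c a; first by move=> /F0out; apply: LR_small LRQ.
by move=> /F0in[_ ->].
Qed.

Let F0ranked : ranked (fun x => match x with inl a => a | inr b => (n + b)%N end) F0.
Proof.
have skQ c b : Q c = Some b -> in_skew lam mu c by move=> E; apply/Qdom; rewrite E.
move=> c d [a|b] [a'|b'] Ec Ed le.
- move: Ec Ed => /F0in[h1 ->] /F0in[h2 ->]; move: le; rewrite /cle /above; lia.
- move: Ec => /F0in[h1 ->]; have := ltn_ord c.1; lia.
- move: Ec Ed => /F0out/skQ h1 /F0in[h2 ->]; exfalso.
  move: h1 h2 le; rewrite /in_skew /cle zv0E; have := gm (i := c.1) (j := d.1); lia.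
- move: Ec Ed => /F0out Ec /F0out Ed; have [h1 h2] := SST_cle gl gm ST Ec Ed le.
  by split=> [|/h2]; lia.
Qed.

Let F0perf : perf F0.
Proof.
apply: perfI => c d a b Ea Eb le; have [h1 h2] := F0ranked Ea Eb le; split=> //.
  by move: h1; lia.
by move/h2; lia.
Qed.

Let F0rows i k : (rowcount F0 i.+1 k.+1 <= rowcount F0 i k)%N.
Proof.
have clat : clattice Q by case: LRQ => -[pl pm' _] _ _ _ /(lattice_clattice pl pm' ST).
have E i' k' : rowcount F0 i' k' = ncard [set c | Q c = Some k' /\ (c.1 < i')%N].
  by congr ncard; apply/seteqP; split => c [/F0out].
by rewrite !E; apply: clattice_rows gl gm ST clat.
Qed.

(** In the last ranking the outer letters precede the inner ones and so fill a straight shape, where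
    [straight_entry] makes every entry its row index. Switching preserves the number of each letter,
    so this shape is nu. *)
Lemma switching_final : exists S, [/\ switches F0 S, stuck S & flip S = switch_init nu (inner S)].
Proof.
have [S [sw rk rows]] := pass_all F0fin F0convex F0small F0ranked F0rows.
have fin := switches_domfin sw F0fin.
have cv := switches_convex sw F0convex.
have sm := switches_small sw F0small.
have domS c : S c <> None <-> in_skew lam 0 c by rewrite (switches_domE _ sw).
have rowE c b : S c = Some (inr b) -> b = c.1.
  move=> /outerE; apply: (@straight_entry _ (outer S)) => [|i k|{}c d {}b ab /outerE Ed].
  - by apply: sub_finite_set fin => d /= /outer_ex[a ->].
  - have e i' k' : rowcount S i' k' = ncard [set c | outer S c = Some k' /\ (c.1 < i')%N].
      by congr ncard; apply/seteqP; split => d [/outerE].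
    by rewrite -!e.
  have : in_skew lam 0 d by apply/domS; rewrite Ed.
  move=> kd; have : in_skew lam 0 c.
    by move: kd ab; rewrite /in_skew !zv0E /above; have := gl (i := c.1) (j := d.1); lia.
  move=> /domS; case Ec: (S c) => [[a|b']|] // _; have le := above_cle ab.
    by have [+ _] := rk _ _ _ _ Ec Ed le; have := sm.1 _ _ Ed; lia.
  by exists b'; [apply/outerE|have [_ h] := rk _ _ _ _ Ec Ed le; apply: h].
have outE c : S c = Some (inr (c.1 : nat)) <-> in_skew nu 0 c.
  have l0 : 0 <= lam c.1 by have := pm c.1; have [sub _ _ _] := ST; have := sub c.1; lia.
  pose p (j : int) := if S (c.1, j) is Some (inl _) then true else false.
  have [|b [b1 b2]] := @threshold p 0 (lam c.1) l0.
    move=> j j' h1 h2 h3; rewrite /p; case E: (S (c.1, j)) => [[a|a]|] // _.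
    have : S (c.1, j') <> None by apply/domS; rewrite /in_skew zv0E /=; lia.
    case E': (S (c.1, j')) => [[a'|a']|] // _.
    have [] := rk _ _ _ _ E E'; first by rewrite /cle /= leqnn.
    by have := sm.1 _ _ E'; lia.
  have pE j : S (c.1, j) = Some (inr (c.1 : nat)) <-> 0 < j <= lam c.1 - b%:Z.
    split=> [E|h].
      have : in_skew lam 0 (c.1, j) by apply/domS; rewrite E.
      rewrite /in_skew zv0E /= => h; have := b2 j; rewrite /p E; lia.
    have := b2 j; rewrite /p; have : S (c.1, j) <> None by apply/domS; rewrite /in_skew zv0E /=; lia.
    case E: (S (c.1, j)) => [[a|a]|] // _; first by lia.
    by rewrite (rowE _ _ E).
  have cnt : ncard (letters S (inr (c.1 : nat))) = absz (lam c.1 - b%:Z).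
    rewrite -(ncard_row c.1); last by lia.
    congr ncard; apply/seteqP; split => -[i j] /=.
      by move=> E; have e := ord_inj (rowE _ _ E); rewrite /= in e; move: E; rewrite -e => /pE.
    by move=> [-> h]; apply/pE.
  have nuE : nu c.1 = lam c.1 - b%:Z.
    case: LRQ => _ _ _ /(_ c.1) + _; rewrite coord_ord => <-.
    have -> : wt Q c.1 = ncard (letters F0 (inr (c.1 : nat))).
      by congr ncard; apply/seteqP; split => d /= /F0out.
    rewrite -(switches_letters _ sw) cnt; lia.
  by case: c pE nuE {p b2 cnt b1 l0} => i j /= pE nuE; rewrite pE /in_skew zv0E /= nuE.
exists S; split=> //.
- move=> S' /switch_ex[c [c' [a [b [br Ea Eb _ _]]]]].
  have [le _] := below_or_right_cle br; have [+ _] := rk _ _ _ _ Ea Eb le.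
  by have := sm.1 _ _ Eb; lia.
- apply/funext => c; rewrite /flip /switch_init /inner; have := outE c.
  case: ifP => [h1 h2|h1 h2]; first by rewrite h2.2.
  case E: (S c) => [[a|a]|] //=; have := rowE _ _ E => Ea.
  by move: (h2.1 ltac:(by rewrite E Ea)).
Qed.

Lemma switch_init_perf : perf F0. Proof. exact: F0perf. Qed.

End Final.

(** The flipped final state is the initial state for P, and the reversed path leads from it to the
    flipped initial state of Q. Since that one is stuck, [stuck_uniq] makes theta return to Q and to
    nothing else. *)
Lemma theta_LR lam mu nu Q : LR lam mu nu Q -> exists P,
  [/\ theta mu Q P, forall P', theta mu Q P' -> P' = P,
      theta nu P Q & forall Q', theta nu P Q' -> Q' = Q].
Proof.
move=> LRQ; have [S [sw st fl]] := switching_final LRQ.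
have p0 := switch_init_perf LRQ; have pS := switches_perf p0 sw.
have swf := switches_flip p0 sw; rewrite fl in swf.
(* Here the inner letters are those of Q, and none of them stands weakly northwest of a cell of
   mu. *)
have stf : stuck (flip (switch_init mu Q)).
  move=> S' /switch_ex[c [c' [a [b [br + + _ _]]]]] => /flip_inl + /flip_inr.
  have [le _] := below_or_right_cle br; move: le.
  case: LRQ => -[_ [gm _] _] _ [_ dom _ _] _ _.
  rewrite /switch_init /cle /in_skew !zv0E; case: ifP => // h1 le; case: ifP => h2; last by case: (Q c').
  case E: (Q c) => [x|] // _ _; have : in_skew lam mu c by apply/dom; rewrite E.
  by rewrite /in_skew; have := gm c.1 c'.1; lia.
have innerF : inner (flip (switch_init mu Q)) = Q.
  rewrite inner_flip; apply/funext => c; rewrite /outer /switch_init.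
  case: ifP => h; last by case: (Q c).
  case E: (Q c) => [x|] //; case: LRQ => _ _ [_ dom _ _] _ _.
  have : in_skew lam mu c by apply/dom; rewrite E.
  by move: h; rewrite /in_skew; lia.
have pf : perf (switch_init nu (inner S)) by rewrite -fl; apply: perf_flip.
exists (inner S); split.
- by exists S.
- by move=> P' [S' [sw' st' ->]]; rewrite (stuck_uniq p0 sw st sw' st').
- by exists (flip (switch_init mu Q)); split.
- by move=> Q' [S' [sw' st' ->]]; rewrite -(stuck_uniq pf swf stf sw' st') innerF.
Qed.

Lemma theta_wt mu Q Q' (i : 'I_n) : part mu -> theta mu Q Q' -> (wt Q' i)%:Z = mu i.
Proof.
move=> [gm pm] [S [sw _ ->]].
have -> : wt (inner S) i = ncard (letters S (inl (i : nat))).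
  by congr ncard; apply/seteqP; split => c /= /innerE.
rewrite (switches_letters _ sw).
have := ncard_row i (pm i); have := pm i.
have -> : [set c : cell | c.1 = i /\ 0 < c.2 <= mu i] = letters (switch_init mu Q) (inl (i : nat)).
  apply/seteqP; split => -[k j]; rewrite /letters /switch_init /in_skew /= zv0E.
    by move=> [-> ->].
  case: ifP => h; last by case: (Q _).
  by move=> [/ord_inj e]; rewrite e in h *.
by move=> h ->; lia.
Qed.

(** The class of Q1 contains Q1, through pi_{0,0}, so Q1 = pi_{s,t}(Q2) for some s and t. Such an
    image has weight nu + (t^n), which forces t = 0; then the two thetas cancel and Q1 is Q2
    translated by s. Both fill lam/mu, so s = 0 or the shape is empty. *)
Lemma LRclass_inj lam mu nu Q1 Q2 : (0 < n)%N -> LR lam mu nu Q1 -> LR lam mu nu Q2 ->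
  LRclass mu nu Q1 = LRclass mu nu Q2 -> Q1 = Q2.
Proof.
move=> n0 L1 L2 E.
have : LRclass mu nu Q2 Q1.
  have [P [h1 _ h2 _]] := theta_LR L1.
  by rewrite -E; exists 0%N, 0%N, P; rewrite rect0 addr0 translate0.
move=> [s [t [P]]]; have L2s := LR_translate s L2.
have [P0 [_ u _ u']] := theta_LR L2s; move=> /u -> {P} tP.
have t0 : t = 0%N.
  have pn : part (nu + rect n t) by apply: part_rect; case: L1 => -[].
  have := theta_wt (Ordinal n0) pn tP; case: (L1) => _ _ _ + _.
  by move=> ->; rewrite coord_ord !zvE; lia.
rewrite t0 rect0 addr0 translate0 in tP.
have Q1E := u' _ tP.
case: (posnP s) => [s0|spos]; first by rewrite Q1E s0 translate0.
have [_ _ [sub d1 _ _] _ _] := L1; have [_ _ [_ d2 _ _] _ _] := L2.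
have [_ _ [_ d2s _ _] _ _] := L2s.
have lm i : lam i = mu i.
  apply/eqP; rewrite eq_le sub andbT leNgt; apply/negP => lt.
  have : in_skew lam mu (i, mu i + 1) by rewrite /in_skew /=; lia.
  by move=> /d1; rewrite Q1E => /d2s; rewrite /in_skew !zvE /=; lia.
apply/funext => c.
have nd : ~ in_skew lam mu c by rewrite /in_skew lm; lia.
case E1: (Q1 c) => [x|]; first by case: nd; apply/d1; rewrite E1.
by case E2: (Q2 c) => [x|//]; case: nd; apply/d2; rewrite E2.
Qed.

End Theta.

(** * Gasharov's involution *)

Lemma fsbig_sign_relation (T : choiceType) (N : set T) (R : T -> T -> Prop) (F : T -> int) :
  (forall x, N x -> exists y, R x y) -> (forall x y, N x -> R x y -> [/\ N y, R y x & F y = - F x]) ->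
  (forall x y z, N x -> R x y -> R x z -> y = z) -> \sum_(x \in N) F x = 0.
Proof.
move=> ex sym fn.
pose phi x := if pselect (N x) is left h then sval (cid (ex x h)) else x.
have phiP x : N x -> R x (phi x).
  by move=> Nx; rewrite /phi; case: pselect => // h; case: (cid (ex x h)).
have phiK x : N x -> phi (phi x) = x.
  move=> Nx; have h := phiP _ Nx; have [Ny Ryx _] := sym _ _ Nx h.
  exact: fn Ny (phiP _ Ny) Ryx.
have phiN x : N x -> N (phi x) by move=> Nx; have [] := sym _ _ Nx (phiP _ Nx).
have bij : set_bij N N phi.
  split=> //; last by move=> y Ny; exists (phi y); [exact: phiN|exact: phiK].
  by move=> x y /set_mem Nx /set_mem Ny E; rewrite -(phiK _ Nx) E phiK.
have : \sum_(x \in N) F x = - 1 * \sum_(x \in N) F x; last by lia.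
rewrite [LHS](reindex_fsbig _ _ _ _ bij) mulr_fsumr; apply: eq_fsbigr => x /set_mem Nx.
by have [_ _ ->] := sym _ _ Nx (phiP _ Nx); rewrite mulN1r.
Qed.

Lemma int_max (P : int -> Prop) (B j : int) : P j -> (forall i, P i -> i <= B) ->
  exists i, P i /\ forall i', i < i' -> ~ P i'.
Proof.
move=> Pj PB; have [m] := ubnP (absz (B - j)); elim: m j Pj => // m IH j Pj lt.
have [[i [ji Pi]]|H] := pselect (exists i, j < i /\ P i).
  by apply: (IH i) => //; have := PB _ Pi; lia.
by exists j; split=> // i ji Pi; apply: H; exists i.
Qed.

Lemma nat_min (P : nat -> Prop) k : P k -> exists i, P i /\ forall i', (i' < i)%N -> ~ P i'.
Proof.
have [m] := ubnP k; elim: m k => // m IH k lt Pk.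
have [[i [ji Pi]]|H] := pselect (exists i, (i < k)%N /\ P i).
  by apply: (IH i) => //; lia.
by exists k; split=> // i ji Pi; apply: H; exists i.
Qed.

Section Gasharov.
Variable n : nat.
Local Notation cell := ('I_n * int)%type.
Local Notation state := (filling n (nat + nat)).
Implicit Types (c d : cell) (lam kap mu nu : zvec n) (T Q : filling n nat).
Local Notation SSTn := (SST (fun _ : nat => false)).

Definition colcount T (j : int) k : nat := ncard [set c | T c = Some k /\ j <= c.2].
Definition bad T j k := (colcount T j k < colcount T j k.+1)%N.
Definition firstfail T j k := [/\ bad T j k, forall j' k', j < j' -> ~ bad T j' k' &
  forall k', (k' < k)%N -> ~ bad T j k'].

Lemma firstfail_uniq T j k j' k' : firstfail T j k -> firstfail T j' k' -> j = j' /\ k = k'.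
Proof.
move=> [b1 m1 l1] [b2 m2 l2].
have e : j = j' by case: (ltgtP j j') => // [/m1|/m2] h; [case: (h k')|case: (h k)].
rewrite -{}e in b2 l2 *; split=> //.
by case: (ltngtP k k') => // [/l2|/l1].
Qed.

Lemma firstfail_ex T : finite_set [set c | T c <> None] -> ~ clattice T -> exists j k, firstfail T j k.
Proof.
move=> fin ncl.
have [j [k bjk]] : exists j k, bad T j k.
  apply: contrapT => H; apply: ncl => j k; rewrite leqNgt; apply/negP => h.
  by apply: H; exists j, k.
have [B BP] : exists B : int, forall c, T c <> None -> c.2 <= B.
  have [[c Tc]|H] := pselect (exists c, T c <> None); last first.
    by exists 0 => c Tc; case: H; exists c.
  have cA : c \in fset_set [set c | T c <> None] by rewrite in_fset_set // mem_set.
  case: (arg_maxP (P := predT) (i0 := [` cA]%fset) (fun x : fset_set [set c | T c <> None] => (val x).2)) => // x _ xmax.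
  exists (val x).2 => d Td.
  have dA : d \in fset_set [set c | T c <> None] by rewrite in_fset_set // mem_set.
  exact: xmax [` dA]%fset isT.
have badB i : (exists k, bad T i k) -> i <= B.
  move=> [k0 b]; have [|/eqP/eqP/set0P[c [/= Ec h]]] := eqVneq [set c | T c = Some k0.+1 /\ i <= c.2] set0.
    by move=> E; move: b; rewrite /bad /colcount E ncard0.
  by apply: le_trans h _; apply: BP; rewrite Ec.
have [i [[k0 bi] imax]] := int_max (P := fun i => exists k, bad T i k) (ex_intro _ k bjk) badB.
have [k1 [b1 kmin]] := nat_min (P := fun k => bad T i k) bi.
exists i, k1; split=> // j' k' lt b; apply: (imax j' lt).
by exists k'.
Qed.

Definition cut j k T : state := fun c =>
  if c.2 < j then
    if T c is Some a then
      if a == k then Some (inl 0%N) else if a == k.+1 then Some (inr 0%N) else None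
    else None
  else None.

(** Switching leaves the former letters k (inner) behind the former k + 1 (outer), hence the
    crosswise renaming. *)
Definition paste k T (F : state) : filling n nat := fun c =>
  match F c with Some (inl _) => Some k.+1 | Some (inr _) => Some k | None => T c end.

(* At the last column j where the lattice condition fails, for the least such k,
   column j holds k+1 but not k; exchanging the numbers of k and k+1 to the left of
   j (as Bender and Knuth do, here by switching) reflects the weight plus rho. *)
Definition gasharov T T' := exists j k F, [/\ firstfail T j k, switches (cut j k T) F, stuck F
  & T' = paste k T F].

Section Step.
Variables (lam kap : zvec n) (T : filling n nat) (j : int) (k : nat).
Hypotheses (gl : gpart lam) (gk : gpart kap) (ST : SSTn lam kap T) (ff : firstfail T j k).

Let fin : finite_set [set c | T c <> None]. Proof. exact: SST_finite ST. Qed.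
Let le := SST_cle gl gk ST.
Let F0 := cut j k T.

Let F0in c a : F0 c = Some (inl a) <-> [/\ a = 0%N, c.2 < j & T c = Some k].
Proof.
rewrite /F0 /cut; case: ifP => h; last by split=> // -[].
case: (T c) => [x|]; last by split=> // -[].
case: eqP => [->|ne]; first by split=> [[<-]|[->]].
by case: eqP => _; split=> // -[_ _ [e]]; case: ne.
Qed.

Let F0out c a : F0 c = Some (inr a) <-> [/\ a = 0%N, c.2 < j & T c = Some k.+1].
Proof.
rewrite /F0 /cut; case: ifP => h; last by split=> // -[].
case: (T c) => [x|]; last by split=> // -[].
case: eqP => [->|ne]; first by split=> // -[_ _ [e]]; lia.
by case: eqP => [->|n2]; [split=> [[<-]|[->]]|split=> // -[_ _ [e]]; case: n2].
Qed.

Let F0reg c : region 0 0 F0 c <-> c.2 < j /\ (T c = Some k \/ T c = Some k.+1).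
Proof.
rewrite /region; split=> [[/F0in[_ h e]|/F0out[_ h e]]|[h [e|e]]]; try by split=> //; auto.
  by left; apply/F0in.
by right; apply/F0out.
Qed.

Let Tconvex c1 c2 c3 : T c1 <> None -> T c3 <> None -> cle c1 c2 -> cle c2 c3 -> T c2 <> None.
Proof.
have [_ dom _ _] := ST; rewrite !dom /in_skew /cle => h1 h2 h3 h4.
by have := gl (i := c2.1) (j := c3.1); have := gk (i := c1.1) (j := c2.1); lia.
Qed.

Let F0perf : perf F0.
Proof.
apply: perfI => c d a b.
  move=> /F0in[-> _ e1] /F0in[-> _ e2] l; have [_ h] := le e1 e2 l.
  by split=> // /h; rewrite ltnn.
move=> /F0out[-> _ e1] /F0out[-> _ e2] l; have [_ h] := le e1 e2 l.
by split=> // /h; rewrite ltnn.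
Qed.

Let F0tog : togglable 0 0 F0.
Proof.
split.
- move=> c1 c2 c3 /F0reg[h1 e1] /F0reg[h3 e3] l1 l2; apply/F0reg.
  have : T c2 <> None by apply: Tconvex l1 l2; [case: e1 => ->|case: e3 => ->].
  case e2: (T c2) => [x|] // _; split; first by move: l2; rewrite /cle; lia.
  have : (k <= x)%N by case: e1 => e1; have [] := le e1 e2 l1; lia.
  have : (x <= k.+1)%N by case: e3 => e3; have [] := le e2 e3 l2; lia.
  move=> h4 h5; have [<-|ne] := eqVneq k x; [by left|right; congr Some; lia].
- by move=> c d y _ /F0in[-> _ _].
- by move=> c d y _ /F0out[-> _ _].
- by move=> c d ab /F0in[_ _ e1] /F0in[_ _ e2]; have [_ /(_ ab)] := le e1 e2 (above_cle ab); rewrite ltnn.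
- by move=> c d ab /F0out[_ _ e1] /F0out[_ _ e2]; have [_ /(_ ab)] := le e1 e2 (above_cle ab); rewrite ltnn.
Qed.

Let F0fin : finite_set [set c | F0 c <> None].
Proof.
by apply: sub_finite_set fin => c /=; rewrite /F0 /cut; case: ifP => // _; case: (T c).
Qed.

Let final : exists F, [/\ switches F0 F, stuck F, forall c, region 0 0 F c <-> region 0 0 F0 c,
  forall c, ~ region 0 0 F0 c -> F c = None
  & (forall c d, cle c d -> F c = Some (inl 0%N) -> F d = Some (inr 0%N) -> False) /\ togglable 0 0 F].
Proof.
have [F [sw [pF tF] [rE out] _ srt]] := toggle_exists F0fin F0perf F0tog.
have out1 c : ~ region 0 0 F0 c -> F c = None.
  move=> nr; rewrite out //; case E: (F0 c) => [[a|a]|] //; case: nr; apply/F0reg.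
    by have /F0in[_ h e] := E; split=> //; left.
  by have /F0out[_ h e] := E; split=> //; right.
exists F; split=> // S' /switch_ex[c [c' [a [b [br Ea Eb _ _]]]]].
have [l _] := below_or_right_cle br.
have inF d x : F d = Some x -> x = inl 0%N \/ x = inr 0%N.
  move=> E; have [/rE|/out1] := pselect (region 0 0 F0 d); last by rewrite E.
  by rewrite /region E => -[[]|[]]; [left|right].
have [[ea]|//] := inF _ _ Ea; have [//|[eb]] := inF _ _ Eb.
by apply: (srt c c') => //; rewrite ?Ea ?Eb ?ea ?eb.
Qed.

Lemma gasharov_ex : exists T', gasharov T T'.
Proof. by have [F [sw st _ _ _]] := final; exists (paste k T F), j, k, F. Qed.

Variable F : state.
Hypotheses (sw : switches F0 F) (st : stuck F).

Let srtF : (forall c, region 0 0 F c <-> region 0 0 F0 c) /\ (forall c, ~ region 0 0 F0 c -> F c = None) /\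
  (forall c d, cle c d -> F c = Some (inl 0%N) -> F d = Some (inr 0%N) -> False) /\ togglable 0 0 F.
Proof.
have [F1 [sw1 st1 rE out srt]] := final.
by rewrite (stuck_uniq F0perf sw st sw1 st1).
Qed.

Let rE := srtF.1.
Let out := srtF.2.1.
Let srt := srtF.2.2.1.
Let tF := srtF.2.2.2.

Let T' := paste k T F.

Let Fcases c : [\/ F c = Some (inl 0%N) /\ region 0 0 F0 c, F c = Some (inr 0%N) /\ region 0 0 F0 c
   | F c = None /\ ~ region 0 0 F0 c].
Proof.
have [r|r] := pselect (region 0 0 F0 c); last by constructor 3; split=> //; exact: out.
by case: ((rE c).2 r) => E; [constructor 1|constructor 2].
Qed.

Let T'reg c : region 0 0 F0 c ->
  (F c = Some (inl 0%N) /\ T' c = Some k.+1) \/ (F c = Some (inr 0%N) /\ T' c = Some k).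
Proof.
by move=> r; case: (Fcases c) => -[E h]; rewrite /T' /paste E; [left|right|case: (h r)].
Qed.

Let T'out c : ~ region 0 0 F0 c -> T' c = T c.
Proof. by move=> r; rewrite /T' /paste out. Qed.

Let T'right c : j <= c.2 -> T' c = T c.
Proof. by move=> h; apply: T'out => /F0reg[]; lia. Qed.

Let T'other c x : x != k -> x != k.+1 -> T' c = Some x <-> T c = Some x.
Proof.
move=> n1 n2; have [r|r] := pselect (region 0 0 F0 c); last by rewrite T'out.
have [_ e1] := (F0reg c).1 r; split=> E.
  by case: (T'reg r) => -[_ E']; move: n1 n2; rewrite E' in E; case: E => <-; rewrite eqxx.
by case: e1 => e; rewrite e in E; case: E => E; move: n1 n2; rewrite E eqxx.
Qed.

Let colS j' x : colcount T j' x = (colcount T (j' + 1) x + ncard [set c | T c = Some x /\ c.2 = j'])%N.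
Proof.
rewrite /colcount -ncardU.
- congr ncard; apply/seteqP; split => c /=.
    by move=> [E]; rewrite le_eqVlt => /orP[/eqP e|h]; [right|left; split=> //; lia].
  by move=> [[E h]|[E ->]]; split=> //; lia.
- by apply: sub_finite_set fin => c [/= ->].
- by apply: sub_finite_set fin => c [/= ->].
- by move=> c [[/= _ h] [/= _ e]]; lia.
Qed.

Let col1 j' x : (ncard [set c | T c = Some x /\ c.2 = j'] <= 1)%N.
Proof.
have [->|/eqP/eqP/set0P[c [/= Ec e]]] := eqVneq [set c | T c = Some x /\ c.2 = j'] set0; first by rewrite ncard0.
apply: (@leq_trans (ncard [set c])); last by rewrite ncard1.
apply: ncard_le; first exact: finite_set1.
move=> d /= [Ed e']; apply: cell_ext; last by rewrite e e'.
have [lt|lt|//] := ltngtP d.1 c.1.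
  have ab : above d c by rewrite /above lt e e' eqxx.
  by have [_ /(_ ab)] := le Ed Ec (above_cle ab); rewrite ltnn.
have ab : above c d by rewrite /above lt e e' eqxx.
by have [_ /(_ ab)] := le Ec Ed (above_cle ab); rewrite ltnn.
Qed.

(** There is no failure from column j + 1 on, and a column holds each letter at most once; so the
    excess at j is exactly one and is due to column j. *)
Let failcol : colcount T j k.+1 = (colcount T j k).+1 /\ (forall c, c.2 = j -> T c <> Some k) /\
  (exists c, c.2 = j /\ T c = Some k.+1).
Proof.
have [b m _] := ff; have nb := m (j + 1) k ltac:(lia).
move: b nb; rewrite /bad !(colS j) => b nb.
have h1 := col1 j k.+1; have h0 := col1 j k.
have e1 : ncard [set c | T c = Some k.+1 /\ c.2 = j] = 1%N by lia.
have e0 : ncard [set c | T c = Some k /\ c.2 = j] = 0%N by lia.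
split; first by lia.
have f0 : finite_set [set c | T c = Some k /\ c.2 = j] by apply: sub_finite_set fin => c [/= ->].
split=> [c ec Ec|].
  have := ncard_eq0 f0 e0 => /(congr1 (fun A => A c)) /= H.
  by have : False by rewrite -H.
have [E|/eqP/eqP/set0P[c [/= Ec e]]] := eqVneq [set c | T c = Some k.+1 /\ c.2 = j] set0.
  by rewrite E ncard0 in e1.
by exists c.
Qed.

Let T'le c d a b : T' c = Some a -> T' d = Some b -> cle c d ->
  (a <= b)%N /\ (above c d -> (a < b)%N).
Proof.
move=> Ea Eb l.
have [rc|rc] := pselect (region 0 0 F0 c); have [rd|rd] := pselect (region 0 0 F0 d).
- have [[Fc E1]|[Fc E1]] := T'reg rc; have [[Fd E2]|[Fd E2]] := T'reg rd;
    rewrite E1 in Ea; rewrite E2 in Eb; case: Ea => <-; case: Eb => <-.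
  + by split=> // ab; case: (tog_in2 tF ab Fc Fd).
  + by case: (srt l Fc Fd).
  + by split=> //; lia.
  + by split=> // ab; case: (tog_out2 tF ab Fc Fd).
- rewrite (T'out rd) in Eb; have [jc e] := (F0reg c).1 rc.
  have kb : (k <= b)%N by case: e => e; have [] := le e Eb l; lia.
  have ak : (k <= a <= k.+1)%N.
    by have [[_ E]|[_ E]] := T'reg rc; rewrite E in Ea; case: Ea => <-; lia.
  have [b2|b2] := ltnP k.+1 b; first by split=> [|_]; lia.
  have jd : j <= d.2.
    rewrite leNgt; apply/negP => h; apply: rd; apply/F0reg; split=> //.
    by have [h1|h1] := eqVneq b k; [left|right]; rewrite Eb; congr Some; lia.
  have na : above c d = false by rewrite /above; lia.
  rewrite na; split=> //; have [h1|h1] := eqVneq b k; last by lia.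
  have Ec : T c = Some k.
    case: e => // e; have [] := le e Eb l; rewrite h1; lia.
  (* A k on the left of column j, weakly northwest of a k at d, would force a k into this cell of
     column j, against [failcol]. *)
  pose x : cell := (c.1, j).
  have l1 : cle c x by rewrite /cle /x /= leqnn; lia.
  have l2 : cle x d by move: l; rewrite /cle /x /=; lia.
  have : T x <> None by apply: Tconvex l1 l2; rewrite ?Ec ?Eb.
  case Ex: (T x) => [y|] // _; have [_ [nk _]] := failcol.
  case: (nk x erefl); rewrite Ex; congr Some.
  by have [h2 _] := le Ec Ex l1; have [h3 _] := le Ex Eb l2; lia.
- rewrite (T'out rc) in Ea; have [jd e] := (F0reg d).1 rd.
  have ak : (a <= k.+1)%N by case: e => e; have [] := le Ea e l; lia.
  have kb : (k <= b)%N by have [[_ E]|[_ E]] := T'reg rd; rewrite E in Eb; case: Eb => <-; lia.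
  have lt : (a < k)%N.
    rewrite ltnNge; apply/negP => ka; apply: rc; apply/F0reg; split; first by move: l; rewrite /cle; lia.
    by have [h1|h1] := eqVneq a k; [left|right]; rewrite Ea; congr Some; lia.
  by split=> [|_]; lia.
- by rewrite !T'out // in Ea Eb; apply: le Ea Eb l.
Qed.

Lemma gasharov_SST : SSTn lam kap T'.
Proof.
have [sub dom row col] := ST; split=> //.
- move=> c; rewrite -dom; have [r|r] := pselect (region 0 0 F0 c); last by rewrite T'out.
  have [_ e] := (F0reg c).1 r.
  by have [[_ ->]|[_ ->]] := T'reg r; case: e => ->.
- move=> i j1 j2 a b lt Ea Eb; split=> //; rewrite leEnat.
  by have [] := T'le Ea Eb; rewrite // /cle /= leqnn ltW.
- move=> i i' j1 a b lt Ea Eb; rewrite leEnat ltEnat.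
  have ab : above ((i, j1) : cell) (i', j1) by rewrite /above /= eqxx.
  by have [h1 /(_ ab) h2] := T'le Ea Eb (above_cle ab).
Qed.

Let wt_split x : wt T x = (ncard [set c | T c = Some x /\ (c.2 < j)%R] + colcount T j x)%N.
Proof.
rewrite -ncardU.
- congr (#|` fset_set _|); apply/seteqP; split => c /=.
    by move=> E; have [h|h] := ltP c.2 j; [left|right].
  by move=> [[]|[]].
- by apply: sub_finite_set fin => c [/= ->].
- by apply: sub_finite_set fin => c [/= ->].
- by move=> c [[/= _ h] [/= _ e]]; lia.
Qed.

Let fin' : finite_set [set c | T' c <> None].
Proof. exact: SST_finite gasharov_SST. Qed.

Let wt_split' x (y : nat + nat) : (forall c, T' c = Some x <-> F c = Some y \/ (T c = Some x /\ j <= c.2)) ->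
  (forall c, F c = Some y -> c.2 < j) ->
  wt T' x = (ncard (letters F0 y) + colcount T j x)%N.
Proof.
move=> H Hy; rewrite -(switches_letters y sw) -ncardU.
- congr (#|` fset_set _|); apply/seteqP; split => c /= h; first exact/H.
  by apply/H.
- by apply: sub_finite_set fin' => c /= E; rewrite (_ : T' c = Some x) //; apply/H; left.
- by apply: sub_finite_set fin => c [/= ->].
- by move=> c [/= /Hy h [/= _ e]]; lia.
Qed.

(** To the left of j the numbers of k and k + 1 are exchanged; from j on they are kept, and k + 1
    occurs once more than k. *)
Lemma gasharov_wt : (wt T' k).+1 = wt T k.+1 /\ wt T' k.+1 = (wt T k).+1.
Proof.
have Flt c y : F c = Some y -> c.2 < j.
  move=> E; case: (Fcases c) => -[E' r]; try by case/F0reg: r.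
  by rewrite E' in E.
have e0 : wt T' k = (ncard (letters F0 (inr 0%N)) + colcount T j k)%N.
  apply: wt_split' => c; last exact: Flt.
  split=> [E|[E|[E h]]]; last by rewrite T'right.
    have [r|r] := pselect (region 0 0 F0 c).
      by left; have [[_ E']|[]//] := T'reg r; rewrite E' in E; case: E; lia.
    rewrite T'out // in E; right; split=> //; rewrite leNgt; apply/negP => h.
    by apply: r; apply/F0reg; split=> //; left.
  by rewrite /T' /paste E.
have e1 : wt T' k.+1 = (ncard (letters F0 (inl 0%N)) + colcount T j k.+1)%N.
  apply: wt_split' => c; last exact: Flt.
  split=> [E|[E|[E h]]]; last by rewrite T'right.
    have [r|r] := pselect (region 0 0 F0 c).
      by left; have [[]//|[_ E']] := T'reg r; rewrite E' in E; case: E; lia.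
    rewrite T'out // in E; right; split=> //; rewrite leNgt; apply/negP => h.
    by apply: r; apply/F0reg; split=> //; right.
  by rewrite /T' /paste E.
have l0 : ncard (letters F0 (inl 0%N)) = ncard [set c | T c = Some k /\ c.2 < j].
  by congr ncard; apply/seteqP; split => c; [move=> /F0in[]|move=> [h1 h2]; apply/F0in].
have l1 : ncard (letters F0 (inr 0%N)) = ncard [set c | T c = Some k.+1 /\ c.2 < j].
  by congr ncard; apply/seteqP; split => c; [move=> /F0out[]|move=> [h1 h2]; apply/F0out].
have [ec _] := failcol.
by rewrite e0 e1 !wt_split l0 l1 ec !addnS.
Qed.

Lemma gasharov_wt_other x : x != k -> x != k.+1 -> wt T' x = wt T x.
Proof.
by move=> n1 n2; congr (#|` fset_set _|); apply/seteqP; split => c /= /(T'other _ n1 n2).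
Qed.

Lemma gasharov_firstfail : firstfail T' j k.
Proof.
have E j' x : j <= j' -> colcount T' j' x = colcount T j' x.
  move=> jj; congr ncard; apply/seteqP; split => c [/= E h]; split=> //.
    by rewrite -T'right //; lia.
  by rewrite T'right //; lia.
have [b m l] := ff; split.
- by rewrite /bad !E.
- by move=> j' k' jj; rewrite /bad !E ?ltW //; apply: m.
- by move=> k' kk; rewrite /bad !E //; apply: l.
Qed.

(** The first failure lies in the unchanged columns, so T' is cut at the same place; its cut is the
    flip of F, from which the reversed path leads back. *)
Lemma gasharov_sym : gasharov T' T.
Proof.
exists j, k, (flip F0); split; first exact: gasharov_firstfail.
- have -> : cut j k T' = flip F.
    apply/funext => c; rewrite /cut /flip; case: ifP => h.
      case: (Fcases c) => -[E r]; rewrite E /=.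
      + have [[_ ->]|[E' _]] := T'reg r; last by rewrite E in E'.
        by rewrite eqxx; case: eqP => // e; lia.
      + have [[E' _]|[_ ->]] := T'reg r; first by rewrite E in E'.
        by rewrite eqxx.
      + rewrite T'out //; case e: (T c) => [x|] //.
        case: eqP => [ex|_]; first by case: r; apply/F0reg; rewrite e ex; auto.
        by case: eqP => [ex|_] //; case: r; apply/F0reg; rewrite e ex; auto.
    case: (Fcases c) => -[E r]; rewrite E //; by case/F0reg: r; rewrite h.
  exact: switches_flip.
- move=> S' /switch_ex[c [c' [a [b [br + + _ _]]]]] => /flip_inl/F0out[_ _ e1] /flip_inr/F0in[_ _ e2].
  by have [l _] := below_or_right_cle br; have [] := le e1 e2 l; lia.
- apply/funext => c; rewrite /paste /flip; case E: (F0 c) => [[a|a]|] /=.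
  + by have /F0in[] := E.
  + by have /F0out[] := E.
  + by rewrite T'out // /region E => -[].
Qed.

Lemma gasharov_has : exists c, T c = Some k.+1.
Proof. by have [_ [_ [c [_ E]]]] := failcol; exists c. Qed.

End Step.

Lemma gasharov_fun lam kap T T1 T2 : gpart lam -> gpart kap -> SSTn lam kap T ->
  gasharov T T1 -> gasharov T T2 -> T1 = T2.
Proof.
move=> gl gk ST [j [k [F1 [ff1 sw1 st1 ->]]]] [j2 [k2 [F2 [ff2 sw2 st2 ->]]]].
have [ej ek] := firstfail_uniq ff1 ff2; rewrite -{}ej -{}ek in sw2 *.
congr paste; apply: stuck_uniq sw1 st1 sw2 st2.
have le := SST_cle gl gk ST.
have key c x : cut j k T c = Some x -> (x = inl 0%N /\ T c = Some k) \/ (x = inr 0%N /\ T c = Some k.+1).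
  rewrite /cut; case: ifP => // _; case: (T c) => [a|] //; case: eqP => [->|_].
    by move=> [<-]; left.
  by case: eqP => [->|_] // [<-]; right.
by apply: perfI => c d a b /key[[ea e1]|[ea e1]] /key[[eb e2]|[eb e2]] l; try discriminate;
  case: ea => ->; case: eb => ->; have [_ h] := le _ _ _ _ e1 e2 l; split=> // /h; rewrite ltnn.
Qed.

End Gasharov.

(** * Littlewood-Richardson coefficients *)

Section Coefficients.
Variable n : nat.
Local Notation cell := ('I_n * int)%type.
Implicit Types (c d : cell) (lam kap mu nu : zvec n) (T Q : filling n nat).
Local Notation even := (fun _ : nat => false).
Local Notation SSTn := (SST even).

Lemma gasharov_step lam kap T T' : gpart lam -> gpart kap -> SSTn lam kap T -> gasharov T T' ->
  [/\ SSTn lam kap T', gasharov T' T, ~ clattice T' & exists k,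
   [/\ exists c, T c = Some k.+1, (wt T' k).+1 = wt T k.+1, wt T' k.+1 = (wt T k).+1,
       forall x, x != k -> x != k.+1 -> wt T' x = wt T x
     & forall c x, T' c = Some x -> [\/ x = k, x = k.+1 | T c = Some x] ]].
Proof.
move=> gl gk ST [j [k [F [ff sw st ->]]]]; split.
- exact: (gasharov_SST gl gk ST ff sw st).
- exact: (gasharov_sym gl gk ST ff sw st).
- have [b _ _] := gasharov_firstfail gl gk ST ff sw st.
  by move=> /(_ j k); rewrite leqNgt => /negP; apply.
exists k; have [w1 w2] := gasharov_wt gl gk ST ff sw st; split=> //.
- exact: (gasharov_has gl gk ST ff).
- by move=> x n1 n2; apply: (gasharov_wt_other gl gk ST sw st).
- move=> c x; rewrite /paste; case: (F c) => [[a|a]|].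
  + by move=> [<-]; constructor 2.
  + by move=> [<-]; constructor 1.
  + by constructor 3.
Qed.

Lemma maxcol_ge lam i : - (maxcol lam)%:Z <= lam i.
Proof.
have : (absz (lam i) <= maxcol lam)%N by rewrite /maxcol (bigD1 i) //= leq_maxl.
lia.
Qed.

Definition wtv T : zvec n := [ffun i : 'I_n => (wt T i)%:Z].
Lemma wtvE T i : wtv T i = (wt T i)%:Z. Proof. by rewrite ffunE. Qed.

Lemma clattice_wt lam kap T k : SSTn lam kap T -> clattice T -> (wt T k.+1 <= wt T k)%N.
Proof.
move=> [_ dom _ _] /(_ (- (maxcol kap)%:Z) k).
have E x : ncard [set c | T c = Some x /\ - (maxcol kap)%:Z <= c.2] = wt T x.
  congr (#|` fset_set _|); apply/seteqP; split => -[i j] /= => [[]//|e]; split=> //.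
  have /andP[/= h _] : in_skew lam kap (i, j) by apply/dom; rewrite e.
  exact: le_trans (maxcol_ge kap i) (ltW h).
by rewrite !E.
Qed.

Lemma clattice_strict lam kap T : SSTn lam kap T -> clattice T -> strict (wtv T + rho n).
Proof.
move=> ST cl i j ij; rewrite !zvE !wtvE !rhoE.
suff : (wt T j <= wt T i)%N by lia.
have -> : (j : nat) = (i + (j - i))%N by rewrite subnKC // ltnW.
elim: (j - i)%N => [|m IH]; first by rewrite addn0.
by apply: leq_trans IH; rewrite addnS; apply: clattice_wt ST cl.
Qed.

Lemma alt_neq0 (x y : zvec n) : alt x y != 0 -> exists s, y = act x s.
Proof.
move=> h; apply: contrapT => H; case/negP: h; apply/eqP/big1 => s _.
by case: eqP => [e|_]; [case: H; exists s|rewrite mulr0].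
Qed.

Definition emb M (m : {ffun 'I_n -> 'I_M.+1}) (k : nat) : nat :=
  if insub k is Some i then m i else 0%N.
Lemma embE M (m : {ffun 'I_n -> 'I_M.+1}) (i : 'I_n) : emb m i = m i.
Proof. by rewrite /emb valK. Qed.

Definition lets := rev (iota 0 n).
Lemma mem_lets k : (k \in lets) = (k < n)%N.
Proof. by rewrite mem_rev mem_iota add0n. Qed.
Lemma sorted_lets : sorted (fun x y => (y < x)%O) lets.
Proof. by rewrite rev_sorted iota_ltn_sorted. Qed.

(** Bounds the entries nu_j - j + i of the permutations of nu + rho, diminished by rho; larger
    exponents do not occur in the determinant. *)
Definition wbound nu := (maxcol nu + n)%N.

(* Jacobi-Trudi: multiplication by det (h_{nu_i - i + j}), expanded along the
   permutations that occur in the alternant of nu + rho. *)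
Definition Gop nu (g : zvec n -> int) (x : zvec n) : int :=
  \sum_(m : {ffun 'I_n -> 'I_(wbound nu).+1})
     alt (nu + rho n) (vecn m + rho n) * hops even (emb m) false lets g x.

Lemma Gop_op nu : is_op (Gop nu).
Proof.
apply: (@op_sum _ _ xpredT _ (fun m : {ffun 'I_n -> 'I_(wbound nu).+1} => hops even (emb m) false lets)).
by move=> m; apply: hops_op.
Qed.

Lemma Gop_asym nu : asym_op (Gop nu).
Proof.
apply: (@asym_op_sum _ _ xpredT _ (fun m : {ffun 'I_n -> 'I_(wbound nu).+1} => hops even (emb m) false lets)).
by move=> m; apply: hops_asym.
Qed.

Definition LRs lam nu : set (zvec n * filling n nat) :=
  [set p | [/\ gpart p.1, SSTn lam p.1 p.2, clattice p.2 & forall k, (wt p.2 k)%:Z = coord nu k]].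

Definition tabs lam : set (zvec n * filling n nat) :=
  [set p | [/\ gpart p.1, SSTn lam p.1 p.2 & forall c a, p.2 c = Some a -> (a < n)%N]].

Definition btabs lam nu : set (zvec n * filling n nat) :=
  [set p | tabs lam p /\ forall i : 'I_n, (wt p.2 i <= wbound nu)%N].

Lemma wt_bound nu T : alt (nu + rho n) (wtv T + rho n) != 0 -> forall i : 'I_n, (wt T i <= wbound nu)%N.
Proof.
move=> /alt_neq0[s /ffunP E] i; have := E i.
rewrite actE !zvE !rhoE wtvE /wbound; have := maxcol_le nu (s i); have := ltn_ord (s i); have := ltn_ord i; lia.
Qed.

Lemma wt0 lam kap T k : SSTn lam kap T -> (forall c, T c <> Some k) -> wt T k = 0%N.
Proof.
move=> ST H; rewrite /wt (_ : [set c | _] = set0) ?fset_set0 ?cardfs0 //.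
by apply/seteqP; split => c //= /H.
Qed.

Lemma LRs_btabs lam nu : part nu -> LRs lam nu `<=` btabs lam nu.
Proof.
move=> [gn pn] [kap T] [/= gk ST cl w]; split; first split=> //= c a E.
  rewrite ltnNge; apply/negP => na; have := w a; rewrite coord_ge // => /eqP.
  rewrite eqz_nat => /eqP w0.
  have fin : finite_set [set c | T c = Some a].
    by apply: sub_finite_set (SST_finite ST) => d /= ->.
  by have := ncard_gt0 fin E; rewrite -[ncard _]/(wt T a) w0.
move=> i /=; have := w i; rewrite coord_ord => e.
by rewrite -lez_nat e; apply: le_trans (maxcol_le nu i) _; rewrite lez_nat leq_addr.
Qed.

Lemma btabs_bij lam nu : set_bij
  [set q : {ffun 'I_n -> 'I_(wbound nu).+1} * (zvec n * filling n nat) |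
     xpredT q.1 /\ ST even (emb q.1) lam lets q.2] (btabs lam nu) snd.
Proof.
split.
- move=> [m [kap T]] [_ [/= gk sT let_ w]]; split; first split=> //=.
    by move=> c a /let_; rewrite mem_lets.
  by move=> i /=; rewrite w ?mem_lets // embE -ltnS.
- move=> [m p] [m' p'] /set_mem [_ [/= _ _ _ w]] /set_mem [_ [/= _ _ _ w']] /= E.
  rewrite -E in w' *; congr pair; apply/ffunP => i; apply/ord_inj.
  by rewrite -!embE -w ?mem_lets // w' ?mem_lets.
- move=> [kap T] [[/= gk sT let_] w].
  exists ([ffun i : 'I_n => inord (wt T i)], (kap, T)) => //; split=> //; split=> //=.
    by move=> c a /let_; rewrite mem_lets.
  move=> a; rewrite mem_lets => an.
  by rewrite (embE _ (Ordinal an)) ffunE inordK // ltnS; apply: (w (Ordinal an)).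
Qed.

Lemma btabs_finite lam nu : gpart lam -> finite_set (btabs lam nu).
Proof.
move=> gl; have [_ _ surj] := btabs_bij lam nu; apply: sub_finite_set surj _.
apply: finite_image; apply: (@finite_dep _ _ xpredT (fun m => ST even (emb m) lam lets)) => m _.
by have [] := ST_sum even (emb m) sorted_lets gl.
Qed.

Lemma LRs_finite lam nu : part nu -> gpart lam -> finite_set (LRs lam nu).
Proof. by move=> pn gl; apply: sub_finite_set (LRs_btabs pn) _; apply: btabs_finite. Qed.

Lemma ordinal_ex k : (k < n)%N -> exists i : 'I_n, i = k :> nat.
Proof. by move=> kn; exists (Ordinal kn). Qed.

Lemma Gop_btabs lam nu g : gpart lam -> asym g ->
  Gop nu g (lam + rho n) =
  \sum_(p \in btabs lam nu) alt (nu + rho n) (wtv p.2 + rho n) * g (p.1 + rho n).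
Proof.
move=> gl ag; rewrite (reindex_fsbig _ _ _ _ (btabs_bij lam nu)) /Gop.
transitivity (\sum_(m : {ffun 'I_n -> 'I_(wbound nu).+1} | xpredT m)
   \sum_(p \in ST even (emb m) lam lets) alt (nu + rho n) (vecn m + rho n) * g (p.1 + rho n)).
  apply: eq_bigr => m _; have [_ <- //] := ST_sum even (emb m) sorted_lets gl.
  by rewrite mulr_fsumr.
rewrite (@fsbig_dep _ _ xpredT (fun m => ST even (emb m) lam lets)
  (fun m p => alt (nu + rho n) (vecn m + rho n) * g (p.1 + rho n))); last first.
  by move=> m _; have [] := ST_sum even (emb m) sorted_lets gl.
apply: eq_fsbigr => -[m p] /set_mem [_ [/= _ _ _ w]].
congr (alt _ (_ + _) * _); apply/ffunP => i.
by rewrite vecnE wtvE w ?mem_lets // embE.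
Qed.

(** Once the other tableaux have cancelled, a lattice tableau has a strictly decreasing weight plus
    rho, so its coefficient is 1 for weight nu and 0 otherwise. *)
Lemma Gop_sum lam nu g : part nu -> gpart lam -> asym g ->
  Gop nu g (lam + rho n) = \sum_(p \in LRs lam nu) g (p.1 + rho n).
Proof.
move=> pn gl ag; have [gn _] := pn; rewrite Gop_btabs //.
rewrite (fsbigID [set p | clattice p.2]) /=; last exact: btabs_finite.
rewrite [X in _ + X](_ : _ = 0); last first.
  (* The bound in [btabs] is traded for a nonzero alternant, which implies it by [wt_bound] and
     which the involution preserves up to sign. *)
  pose N := [set p | [/\ tabs lam p, ~ clattice p.2 & alt (nu + rho n) (wtv p.2 + rho n) != 0]].
  rewrite -(@fsbig_widen _ _ _ _ N); last first.
  - move=> p [[[tp _] ncl] nN]; apply/eqP; rewrite mulf_eq0; apply/orP; left.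
    by apply/negPn/negP => h; apply: nN.
  - by move=> p [tp ncl h]; split=> //; split=> //; apply: wt_bound.
  apply: (@fsbig_sign_relation _ _ (fun p p' => p'.1 = p.1 /\ gasharov p.2 p'.2)).
  - move=> [kap T] [[/= gk sT let_] ncl _].
    have [j [k ff]] := firstfail_ex (SST_finite sT) ncl.
    by have [T' hT'] := gasharov_ex gl gk sT ff; exists (kap, T').
  - move=> [kap T] [kap' T'] [[/= gk sT let_] ncl h] [/= -> gT].
    have [sT' gT' ncl' [k [[c Ec] w1 w2 w3 w4]]] := gasharov_step gl gk sT gT.
    have kn := let_ _ _ Ec; have kn' := ltnW kn.
    have [i ik] := ordinal_ex kn'; have [i' ik'] := ordinal_ex kn.
    have E : wtv T' + rho n = act (wtv T + rho n) (tperm i i').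
      apply/ffunP => r; rewrite actE !zvE !wtvE !rhoE.
      case: tpermP => [->|->|/eqP n1 /eqP n2].
      - by rewrite ik ik'; lia.
      - by rewrite ik ik'; lia.
      rewrite w3 //; first by rewrite -ik; apply: contra n1 => /eqP /ord_inj ->.
      by rewrite -ik'; apply: contra n2 => /eqP /ord_inj ->.
    have ne : i != i' by apply/eqP => e; move: ik'; rewrite -e ik; lia.
    have Ealt : alt (nu + rho n) (wtv T' + rho n) = - alt (nu + rho n) (wtv T + rho n).
      by rewrite E alt_asym odd_tperm ne expr1 mulN1r.
    split=> //.
      split=> //=; last by rewrite Ealt oppr_eq0.
      by split=> //= c' x /w4 [->|->|/let_].
    by rewrite /= Ealt mulNr.
  - move=> [kap T] [k1 T1] [k2 T2] [[/= gk sT _] _ _] [/= -> h1] [/= -> h2].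
    by rewrite (gasharov_fun gl gk sT h1 h2).
rewrite addr0 -(@fsbig_widen _ _ _ _ (LRs lam nu)).
- apply: eq_fsbigr => -[kap T] /set_mem [/= gk sT cl w].
  rewrite (_ : wtv T = nu); last by apply/ffunP => i; rewrite wtvE w coord_ord.
  by rewrite alt_strict ?eqxx ?mul1r //; exact: gpart_strict.
- by move=> p h; split; [exact: LRs_btabs|case: h].
- move=> [kap T] [[[[/= gk sT let_] wb] cl] nL]; apply/eqP; rewrite mulf_eq0; apply/orP; left.
  rewrite alt_strict; [|exact: gpart_strict|exact: clattice_strict sT cl].
  have [E|//] := eqVneq (nu + rho n) (wtv T + rho n).
  case: nL; split=> //= k.
  have {}E := addIr _ E; have [kn|kn] := ltnP k n.
    by rewrite (coord_ord _ (Ordinal kn)) E wtvE.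
  rewrite coord_ge // (wt0 sT) // => c /let_; lia.
Qed.

Definition Htab mu : filling n nat := fun c => if in_skew mu 0 c then Some (c.1 : nat) else None.

(** By [straight_entry] each entry is its row index, so the row lengths of lam are the weight mu. *)
Lemma LRs_straight lam mu p : part mu -> gpart lam -> LRs lam mu p -> p.1 = 0 ->
  lam = mu /\ p.2 = Htab lam.
Proof.
case: p => kap T pm gl [/= gk sT cl w] k0; rewrite {kap}k0 in gk sT.
have [sub dom _ _] := sT; have le := SST_cle gl gk sT.
have fin := SST_finite sT.
have pl i : 0 <= lam i by have := sub i; rewrite zv0E.
have rowE := straight_entry fin (fun i k => clattice_rows i k gl gk sT cl).
have {}rowE c b : T c = Some b -> b = c.1.
  apply: rowE => {}c d {}b ab Ed; have : in_skew lam 0 d by apply/dom; rewrite Ed.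
  move=> kd; have : T c <> None.
    by apply/dom; move: kd ab; rewrite /in_skew !zv0E /above; have := gl c.1 d.1; lia.
  case Ec: (T c) => [b'|] // _; exists b' => //.
  by have [_ /(_ ab)] := le _ _ _ _ Ec Ed (above_cle ab).
have TE : T = Htab lam.
  apply/funext => c; rewrite /Htab; case: ifP => h.
    have /dom := h; case E: (T c) => [b|] // _; congr Some.
    exact: rowE E.
  case E: (T c) => [b|] //; have : in_skew lam 0 c by apply/dom; rewrite E.
  by rewrite h.
split=> //; apply/ffunP => i; rewrite -[RHS]coord_ord -w.
have := ncard_row i (pl i); have := pl i.
have -> : [set c : cell | c.1 = i /\ 0 < c.2 <= lam i] = [set c | T c = Some (i : nat)].
  apply/seteqP; split => -[k j] /=; rewrite TE /Htab /in_skew zv0E /=; first by move=> [-> ->].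
  by case: ifP => // h [/ord_inj e]; rewrite e in h *.
by rewrite -[ncard _]/(wt T i) => h ->; rewrite gez0_abs.
Qed.

Lemma LRs_H mu : part mu -> LRs mu mu (0, Htab mu).
Proof.
move=> [gm pm].
have TE c a : Htab mu c = Some a <-> in_skew mu 0 c /\ a = c.1.
  by rewrite /Htab; case: ifP => h; split=> //; [move=> [<-]|move=> [_ ->]|case].
have sT : SSTn mu 0 (Htab mu).
  split.
  - by move=> i; rewrite zv0E.
  - by move=> c; rewrite /Htab; case: ifP.
  - by move=> i j j' a b jj /TE[_ ->] /TE[_ ->].
  - by move=> i i' j a b ii /TE[_ ->] /TE[_ ->]; rewrite leEnat ltEnat /= ltnW.
split=> //=.
- by move=> i j ij; rewrite !zv0E.
- move=> j k; have [kn|kn] := ltnP k n; last first.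
    rewrite (_ : [set c | _] = set0) ?ncard0 //; apply/seteqP; split => c //= -[/TE[_ e] _].
    by have := ltn_ord c.1; lia.
  pose f c : cell := (Ordinal kn, c.2).
  set A := [set c | _]; set B := [set c | _].
  have -> : ncard A = ncard (f @` A).
    apply: (@ncard_bij _ _ _ _ f); split; first by move=> c Ac; exists c.
      move=> c d /set_mem [/TE[_ e1] _] /set_mem [/TE[_ e2] _] [e].
      by apply: cell_ext => //; rewrite -e1 -e2.
    by move=> c.
  apply: ncard_le; first by apply: sub_finite_set (finite_skew mu 0) => c [/TE[]].
  move=> _ [c [/TE[h e] jc] <-]; split=> //; apply/TE; split=> //.
  move: h; rewrite /in_skew !zv0E /f /=; have := gm (Ordinal kn) c.1; rewrite /= -e; lia.
- move=> k; have [kn|kn] := ltnP k n; last first.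
    rewrite coord_ge // (wt0 sT) // => c /TE[_ e]; have := ltn_ord c.1; lia.
  pose i := Ordinal kn; rewrite (coord_ord _ i).
  have := ncard_row i (pm i); have := pm i.
  have -> : [set c : cell | c.1 = i /\ 0 < c.2 <= mu i] = [set c | Htab mu c = Some k].
    apply/seteqP; split => -[k' j] /=; rewrite /Htab /in_skew zv0E /=; first by move=> [-> ->].
    by case: ifP => // h [e]; have e' : k' = i by [apply/ord_inj]; rewrite e' in h *.
  by rewrite -[ncard _]/(wt (Htab mu) k) => h ->; rewrite gez0_abs.
Qed.

Lemma gpart0 : gpart (0 : zvec n). Proof. by move=> i j _; rewrite !zv0E. Qed.
Lemma strict0 : strict (0 + rho n). Proof. exact/gpart_strict/gpart0. Qed.

(** The coefficient at lam counts lattice tableaux of straight shape lam and weight mu: one for lam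
    = mu, none otherwise. Thus [Gop mu] is multiplication by the Schur polynomial of mu. *)
Lemma Gop_alt mu : part mu -> Gop mu (alt (0 + rho n)) =1 alt (mu + rho n).
Proof.
move=> pm; have [gm _] := pm; apply: asym_determined.
- exact/Gop_asym/alt_asym.
- exact: alt_asym.
move=> lam gl; rewrite Gop_sum //; last exact: alt_asym.
rewrite alt_strict; try exact: gpart_strict.
have E p : LRs lam mu p -> alt (0 + rho n) (p.1 + rho n) = (0 == p.1)%:R.
  move=> [gp _ _ _]; rewrite alt_strict ?(inj_eq (addIr _)) //; first exact: strict0.
  exact: gpart_strict.
have [e|ne] := eqVneq (mu + rho n) (lam + rho n).
  have {}e : mu = lam by apply: addIr e.
  rewrite -(@fsbig_widen _ _ _ _ [set (0, Htab lam)]).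
  - by rewrite fsbig_set1 /= alt_strict ?eqxx //; exact: strict0.
  - by move=> p ->; rewrite e; apply: LRs_H; rewrite -e.
  - move=> p [Lp np] /=; rewrite E //; case: eqP => // /esym p0.
    by case: np; have [_] := LRs_straight pm gl Lp p0; case: p p0 {Lp} => k T /= -> ->.
apply: fsbig1 => p Lp; rewrite E //; case: eqP => // /esym p0.
by have [el _] := LRs_straight pm gl Lp p0; rewrite el eqxx in ne.
Qed.

Lemma part_maxcol mu : gpart mu -> part (mu + rect n (maxcol mu)).
Proof.
move=> gm; split; first exact: gpart_rect.
by move=> i; rewrite !zvE; have := maxcol_ge mu i; lia.
Qed.

(* Multiplication by the rational Schur function of the generalized partition mu. *)
Definition Sop mu (g : zvec n -> int) (x : zvec n) : int :=
  Gop (mu + rect n (maxcol mu)) g (x + rect n (maxcol mu)).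

Lemma Sop_op mu : is_op (Sop mu).
Proof.
have H := op_comp (op_shift (- rect n (maxcol mu))) (Gop_op (mu + rect n (maxcol mu))).
case: H => F HF; exists F => g x; rewrite -HF /= opprK //.
Qed.

Lemma alt_rect (x y : zvec n) (q : nat) : alt (x + rect n q) (y + rect n q) = alt x y.
Proof. by apply: alt_shift => s; rewrite act_rect. Qed.

Lemma Sop_alt mu : gpart mu -> Sop mu (alt (0 + rho n)) =1 alt (mu + rho n).
Proof.
move=> gm x; rewrite /Sop Gop_alt; last exact: part_maxcol.
by rewrite addrAC alt_rect.
Qed.

(** Both operators commute with [Sop mu], which produces the alternant of mu from that of 0. *)
Lemma op_determined P P' mu : is_op P -> is_op P' -> gpart mu ->
  P (alt (0 + rho n)) =1 P' (alt (0 + rho n)) -> P (alt (mu + rho n)) =1 P' (alt (mu + rho n)).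
Proof.
move=> oP oP' gm E x.
rewrite -(op_ext x oP (Sop_alt gm)) -(op_ext x oP' (Sop_alt gm)).
rewrite !(op_comm _ _ _ (Sop_op mu)) //; apply: op_ext E; exact: Sop_op.
Qed.

(** The coefficient of s_lam in the product s_mu s_nu of rational Schur functions. *)
Definition lrc lam mu nu : int := Sop nu (alt (mu + rho n)) (lam + rho n).

Lemma lrcC lam mu nu : gpart mu -> gpart nu -> lrc lam mu nu = lrc lam nu mu.
Proof.
move=> gm gn; rewrite /lrc -(op_ext _ (Sop_op nu) (Sop_alt gm)) -(op_ext _ (Sop_op mu) (Sop_alt gn)).
by rewrite op_comm //; apply: Sop_op.
Qed.

Lemma Sop_Gop mu nu x : gpart mu -> part nu -> Sop nu (alt (mu + rho n)) x = Gop nu (alt (mu + rho n)) x.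
Proof.
move=> gm pn; apply: op_determined => //; [exact: Sop_op|exact: Gop_op|].
by move=> y; rewrite Sop_alt ?Gop_alt //; case: pn.
Qed.

(** Adding (p^n) is multiplication by the p-th power of z_1 ... z_n, a shift that commutes with
    everything. *)
Lemma lrc_shift lam mu nu p q : gpart mu -> gpart nu ->
  lrc (lam + rect n (p + q)) (mu + rect n p) (nu + rect n q) = lrc lam mu nu.
Proof.
move=> gm gn; rewrite /lrc.
have rD : rect n (p + q) = rect n p + rect n q by apply/ffunP => i; rewrite !zvE; lia.
have e1 x : alt (mu + rect n p + rho n) x = alt (mu + rho n) (x - rect n p).
  by rewrite -[RHS](alt_rect _ _ p) subrK addrAC.
rewrite (op_ext _ (Sop_op _) e1).
have sh := op_shift (rect n p).
have -> : Sop (nu + rect n q) (fun x => alt (mu + rho n) (x - rect n p)) (lam + rect n (p + q) + rho n) =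
   Sop (nu + rect n q) (alt (mu + rho n)) (lam + rho n + rect n q).
  rewrite (op_comm _ _ (Sop_op _) sh) rD; congr (Sop _ _ _).
  by apply/ffunP => i; rewrite !zvE; lia.
have oS := op_comp (op_shift (rect n q)) (Sop_op nu).
rewrite (op_determined (Sop_op _) oS gm) /=; first by rewrite addrK.
move=> x; rewrite /= !Sop_alt //; last exact: gpart_rect.
by rewrite -[RHS](alt_rect _ _ q) subrK addrAC.
Qed.

Lemma lrc_LRs lam mu nu : gpart lam -> gpart mu -> part nu ->
  lrc lam mu nu = \sum_(p \in LRs lam nu) ((p.1 == mu)%:R : int).
Proof.
move=> gl gm pn; rewrite /lrc Sop_Gop // Gop_sum //; last exact: alt_asym.
apply: eq_fsbigr => p /set_mem [gp _ _ _].
by rewrite alt_strict ?(inj_eq (addIr _)) 1?eq_sym //; apply: gpart_strict.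
Qed.

Lemma SST_size lam kap T : SSTn lam kap T -> (forall c a, T c = Some a -> (a < n)%N) ->
  psize lam = psize kap + (\sum_(i < n) wt T i)%N%:Z.
Proof.
move=> sT let_; have [sub dom _ _] := sT; have fin := SST_finite sT.
have e1 : ncard [set c | T c <> None] = (\sum_i absz (lam i - kap i)%R)%N.
  rewrite -(ncard_rows lam (fun i => absz (lam i - kap i)%R)); congr ncard.
  apply/seteqP; split => -[i j] /=; have := sub i.
    by move=> h /dom; rewrite /in_skew /=; move: (lam i) (kap i) h => a b; lia.
  move=> h h'; apply/dom; move: h h'; rewrite /in_skew /=.
  by move: (lam i) (kap i) => a b; lia.
have e2 : ncard [set c | T c <> None] = (\sum_(i < n) wt T i)%N.
  apply/eqP; rewrite -eqz_nat ncardE -[X in _ == X]natz natr_sum.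
  have bij : set_bij [set q : 'I_n * cell | xpredT q.1 /\ [set c | T c = Some (q.1 : nat)] q.2]
     [set c | T c <> None] snd.
    split; first by move=> [i c] [_ /= ->].
      move=> [i c] [i' c'] /set_mem [_ /= e] /set_mem [_ /= e'] /= E.
      by rewrite -E e in e' *; case: e' => /ord_inj ->.
    move=> c /=; case E: (T c) => [a|] // _.
    by exists (Ordinal (let_ _ _ E), c).
  rewrite (reindex_fsbig _ _ _ _ bij).
  rewrite -(@fsbig_dep _ _ xpredT (fun i : 'I_n => [set c | T c = Some (i : nat)]) (fun _ _ => 1%:Z)).
    by apply/eqP/eq_bigr => i _; rewrite -ncardE natz.
  by move=> i _; apply: sub_finite_set fin => c /= ->.
rewrite -e2 e1 /psize -[X in _ + X]natz natr_sum -big_split; apply: eq_bigr => i _ /=.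
by have := sub i; lia.
Qed.

Lemma LR_LRs lam mu nu T : part lam -> part mu -> part nu -> LR lam mu nu T <-> LRs lam nu (mu, T).
Proof.
move=> pl pm pn; have [gm _] := pm; split=> [[_ _ sT w lat]|[/= _ sT cl w]].
  by split=> //=; apply/(lattice_clattice pl pm sT).
split=> //; last exact/(lattice_clattice pl pm sT).
split; first by case: sT.
have L : LRs lam nu (mu, T) by [].
have [[_ _ let_] _] := LRs_btabs pn L.
rewrite (SST_size sT let_); congr (_ + _); rewrite -natz natr_sum /psize.
by apply: eq_bigr => i _; rewrite natz w coord_ord.
Qed.

Lemma LRnum_lrc lam mu nu : part lam -> part mu -> part nu -> (LRnum lam mu nu)%:Z = lrc lam mu nu.
Proof.
move=> pl pm pn; have [gl _] := pl; have [gm _] := pm.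
rewrite lrc_LRs // -[LRnum _ _ _]/(ncard (LR lam mu nu)) ncardE.
rewrite -(@fsbig_widen _ _ _ _ [set p | LRs lam nu p /\ p.1 = mu]).
- have bij : set_bij (LR lam mu nu) [set p | LRs lam nu p /\ p.1 = mu] (fun T => (mu, T)).
    split.
    + by move=> T /(LR_LRs _ pl pm pn).
    + by move=> T T' _ _ [].
    + by move=> [k T] [/= L e]; exists T; rewrite ?e //; apply/(LR_LRs _ pl pm pn); rewrite -e.
  by rewrite (reindex_fsbig _ _ _ _ bij); apply: eq_fsbigr => T _; rewrite /= eqxx.
- by move=> p [].
- by move=> p [L np] /=; case: eqP => // e; case: np.
Qed.

Lemma LR_finite lam mu nu : finite_set (LR lam mu nu).
Proof.
have [[pl pm pn]|H] := pselect [/\ part lam, part mu & part nu]; last first.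
  by rewrite (_ : LR _ _ _ = set0) //; apply/seteqP; split => T // -[].
have [gl _] := pl; apply: sub_finite_set (finite_image snd (LRs_finite pn gl)) => T.
by move=> /(LR_LRs _ pl pm pn) h; exists (mu, T).
Qed.

(** For shifts of at least M all three vectors are partitions and the count is [lrc]. Any value that
    [xget] may pick agrees with it at still larger shifts. *)
Lemma LRcoef_lrc lam mu nu : gpart lam -> gpart mu -> gpart nu ->
  (LRcoef lam mu nu)%:Z = lrc lam mu nu.
Proof.
move=> gl gm gn; pose M := (maxcol lam + maxcol mu + maxcol nu)%N.
have key p q : (M <= p)%N -> (M <= q)%N ->
   (LRnum (lam + rect n (p + q)) (mu + rect n p) (nu + rect n q))%:Z = lrc lam mu nu.
  move=> Mp Mq; rewrite LRnum_lrc ?lrc_shift //; split; try exact: gpart_rect.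
  - by move=> i; rewrite !zvE; have := maxcol_ge lam i; rewrite /M in Mp Mq; lia.
  - by move=> i; rewrite !zvE; have := maxcol_ge mu i; rewrite /M in Mp Mq; lia.
  - by move=> i; rewrite !zvE; have := maxcol_ge nu i; rewrite /M in Mp Mq; lia.
rewrite /LRcoef; set S := [set m | _].
have S0 : S (LRnum (lam + rect n (M + M)) (mu + rect n M) (nu + rect n M)).
  by exists M => p q Mp Mq; apply/eqP; rewrite -eqz_nat key // key.
have [M1 H] := xgetPex 0%N (ex_intro S _ S0).
by rewrite -(H (M + M1)%N (M + M1)%N (leq_addl _ _) (leq_addl _ _)) key // leq_addr.
Qed.

(** Commuting F past [Sop mu] turns the left side into a sum over finitely many tableaux of weight
    mu + (q^n); grouped by inner shape kap, they give the coefficients through [lrcC]. *)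
Lemma op_expansion F lam mu : is_op F -> asym_op F -> gpart lam -> gpart mu ->
  finite_set [set kap | gpart kap /\ lrc lam mu kap != 0] /\
  F (alt (mu + rho n)) (lam + rho n) =
  \sum_(kap \in @gpart n) lrc lam mu kap * F (alt (0 + rho n)) (kap + rho n).
Proof.
move=> oF aF gl gm; pose q := maxcol mu.
have pq : part (mu + rect n q) by apply: part_maxcol.
have glq := gpart_rect q gl.
pose L := LRs (lam + rect n q) (mu + rect n q).
have fL : finite_set L by apply: LRs_finite.
have fK := finite_image fst fL.
have cE kap : gpart kap -> lrc lam mu kap = \sum_(p \in L) ((p.1 == kap)%:R : int).
  move=> gk; rewrite lrcC // -(lrc_shift lam 0 q gk gm) add0n rect0 addr0.
  by rewrite lrc_LRs.
have sub : [set kap | gpart kap /\ lrc lam mu kap != 0] `<=` fst @` L.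
  move=> kap [gk]; rewrite cE // => h; apply: contrapT => H; case/negP: h; apply/eqP.
  by apply: fsbig1 => p Lp; case: eqP => // e; case: H; exists p.
split; first exact: sub_finite_set sub fK.
rewrite -(op_ext _ oF (Sop_alt gm)) (op_comm _ _ oF (Sop_op mu)) /Sop -/q addrAC.
rewrite Gop_sum //; last exact/aF/alt_asym.
rewrite -(@fsbig_widen _ _ _ _ (fst @` L)).
- transitivity (\sum_(kap \in fst @` L) \sum_(p \in L) ((p.1 == kap)%:R : int) * F (alt (0 + rho n)) (kap + rho n)).
    rewrite exchange_fsbig //; apply: eq_fsbigr => p /set_mem Lp.
    rewrite -(@fsbig_widen _ _ _ _ [set p.1]).
    - by rewrite fsbig_set1 eqxx mul1r.
    - by move=> k ->; exists p.
    - by move=> k [_ /= /eqP ne]; rewrite eq_sym (negbTE ne) mul0r.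
  apply: eq_fsbigr => kap /set_mem [p Lp e].
  by rewrite -mulr_fsuml cE // -e; case: Lp.
- by move=> k [p [gp _ _ _] <-].
- move=> k [gk nk]; rewrite /= (_ : lrc lam mu k = 0) ?mul0r //; apply/eqP/negPn/negP => h.
  by apply: nk; apply: sub.
Qed.

End Coefficients.

(** * Characters and classes of Littlewood-Richardson tableaux *)

Lemma ncardX (T U : choiceType) (A : set T) (B : set U) : finite_set A -> finite_set B ->
  ncard (A `*` B) = (ncard A * ncard B)%N.
Proof.
move=> fA fB; apply/eqP; rewrite -eqz_nat ncardE PoszM [in X in _ == X * _]ncardE mulr_fsuml.
rewrite -(@pair_fsbig _ _ _ _ _ A B (fun _ _ => 1%:Z)) //.
by apply/eqP/eq_fsbigr => x _; rewrite mul1r ncardE.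
Qed.

Lemma bij_of_ncard (T U : choiceType) (u0 : U) (A : set T) (B : set U) :
  finite_set A -> finite_set B -> ncard A = ncard B -> exists f, set_bij A B f.
Proof.
move=> fA fB E; pose sA := enum_fset (fset_set A); pose sB := enum_fset (fset_set B).
have sz : size sA = size sB by exact: E.
have memA x : (x \in sA) = (x \in A) by rewrite /sA in_fset_set.
have memB x : (x \in sB) = (x \in B) by rewrite /sB in_fset_set.
have uA : uniq sA by apply: fset_uniq.
have uB : uniq sB by apply: fset_uniq.
exists (fun x => nth u0 sB (index x sA)); split.
- by move=> x Ax; apply: set_mem; rewrite -memB mem_nth // -sz index_mem memA mem_set.
- move=> x y; rewrite -!memA => xA yA /eqP; rewrite nth_uniq -?sz ?index_mem //.
  by move=> /eqP e; rewrite -(nth_index x xA) e nth_index.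
- move=> y By; have yB : y \in sB by rewrite memB mem_set.
  have lt : (index y sB < size sA)%N by rewrite sz index_mem.
  case: sA lt uA sz memA => // x0 s lt uA sz memA.
  exists (nth x0 (x0 :: s) (index y sB)).
    by apply: set_mem; rewrite -memA mem_nth.
  by rewrite index_uniq // nth_index.
Qed.

Section Sums.
Variable n : nat.
Implicit Types (lam kap mu nu : zvec n).

Lemma op_bigsum P (I : finType) (p : pred I) (g : I -> zvec n -> int) x : is_op P ->
  P (fun y => \sum_(i | p i) g i y) x = \sum_(i | p i) P (g i) x.
Proof.
move=> [F PE]; rewrite PE; under eq_bigr do rewrite mulr_sumr.
by rewrite exchange_big; apply: eq_bigr => i _; rewrite PE.
Qed.

(** Taking adjoints reverses the order of the letters, and commutation restores it. *)
Lemma hops_adj d (X : orderType d) deg (e : X -> nat) s (x y : zvec n) :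
  hops deg e true s (alt x) y = hops deg e false s (alt y) x.
Proof.
elim: s x y => [|a s IH] x y /=; first exact: alt_sym.
rewrite (op_ext (h := fun z => hops deg e false s (alt z) x) _ (hop_op _ _ _ _)); last by move=> z; apply: IH.
rewrite (op_comm _ _ (hop_op _ _ _ _) (hops_op _ _ _ _ _)).
have adj z : hop (deg a) (e a) false (alt y) z = hop (deg a) (e a) true (alt z) y.
  by rewrite hop_adj.
rewrite (op_ext _ (hops_op _ _ _ _ _) adj) /hop /= (op_bigsum _ _ _ (hops_op _ _ _ _ _)); apply: eq_bigr => be _.
by apply: op_ext (hops_op _ _ _ _ _) _ => z; rewrite alt_sym.
Qed.

Lemma SST_inner_uniq d (X : orderType d) deg lam kap kap' (T : filling n X) :
  SST deg lam kap T -> SST deg lam kap' T -> kap = kap'.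
Proof.
have half k1 k2 : SST deg lam k1 T -> SST deg lam k2 T -> forall i, k2 i <= k1 i.
  move=> [s1 d1 _ _] [s2 d2 _ _] i; rewrite leNgt; apply/negP => lt.
  have : in_skew lam k1 (i, k2 i) by rewrite /in_skew /= lt s2.
  by move=> /d1/d2; rewrite /in_skew /= ltxx.
by move=> h1 h2; apply/ffunP => i; apply/eqP; rewrite eq_le (half _ _ h1 h2) (half _ _ h2 h1).
Qed.

End Sums.

Section Supp.
Variables (d : Order.disp_t) (X : orderType d) (deg : X -> bool) (n : nat).
Implicit Types (e : {fsfun X -> nat with 0%N}) (lam kap : zvec n).

Definition support_seq e : seq X := rev (sort <=%O (enum_fset (finsupp e))).

Lemma mem_support_seq e x : (x \in support_seq e) = (e x != 0%N).
Proof. by rewrite mem_rev mem_sort mem_finsupp. Qed.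

Lemma sorted_support_seq e : sorted (fun x y => (y < x)%O) (support_seq e).
Proof.
rewrite rev_sorted lt_sorted_uniq_le sort_uniq fset_uniq /=.
exact: sort_sorted le_total _.
Qed.

Lemma wt_fin_eq0 lam kap (T : filling n X) x : SST deg lam kap T -> wt T x = 0%N ->
  forall c, T c <> Some x.
Proof.
move=> sT w c E; have fin : finite_set [set c | T c = Some x].
  by apply: sub_finite_set (SST_finite sT) => c' /= ->.
by have := ncard_gt0 fin E; rewrite -[ncard _]/(wt T x) w.
Qed.

Lemma wt_none lam kap (T : filling n X) x : (forall c, T c <> Some x) -> wt T x = 0%N.
Proof.
move=> H; rewrite /wt (_ : [set c | _] = set0) ?fset_set0 ?cardfs0 //.
by apply/seteqP; split => c //= /H.
Qed.

Lemma ST_supportP lam e kap (T : filling n X) :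
  ST deg e lam (support_seq e) (kap, T) <->
  [/\ gpart kap, SST deg lam kap T & forall x, wt T x = e x].
Proof.
split=> [[/= gk sT let_ w]|[gk sT w]]; split=> //=.
- move=> x; have [xs|] := boolP (x \in support_seq e); first exact: w.
  move=> xs; have e0 : e x = 0%N by apply/eqP; move: xs; rewrite mem_support_seq negbK.
  rewrite e0; apply: (wt_none lam kap) => c Ec; case/negP: xs; exact: let_ Ec.
- move=> c x E; rewrite mem_support_seq -w; apply/eqP => w0.
  exact: (wt_fin_eq0 sT w0 E).
Qed.

Lemma fsfun_of_wt lam kap (T : filling n X) : SST deg lam kap T ->
  exists e : {fsfun X -> nat with 0%N}, forall x, wt T x = e x.
Proof.
move=> sT; pose L := [set x | exists c, T c = Some x].
have fL : finite_set L.
  case: (pselect (exists x, L x)) => [[x0 _]|H]; last first.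
    by rewrite (_ : L = set0) //; apply/seteqP; split => x // Lx; apply: H; exists x.
  apply: (@sub_finite_set _ _ ((fun c => odflt x0 (T c)) @` [set c | T c <> None])).
    by move=> x [c E]; exists c => /=; rewrite E.
  exact: finite_image (SST_finite sT).
exists [fsfun x in fset_set L => wt T x | 0%N] => x; rewrite fsfunE.
case: ifP => // /negbT; rewrite in_fset_set // => xL.
apply: (wt_none lam kap) => c E; case/negP: xL; apply: mem_set.
by exists c.
Qed.

End Supp.

(** * Pairs of tableaux of a given weight *)

Section Character.
Variables (dA : Order.disp_t) (A : orderType dA) (degA : A -> bool).
Variables (dB : Order.disp_t) (B : orderType dB) (degB : B -> bool).
Variable n : nat.
Implicit Types (lam kap mu nu : zvec n) (T : filling n A * filling n B) (m : monom A B).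

(** Only nu - (d^n) matters; conversely, a large d turns all three vectors into partitions. *)
Lemma SSTpairP lam mu T : gpart lam -> gpart mu ->
  SSTpair degA degB lam mu T <->
  exists kap, [/\ gpart kap, SST degA lam kap T.1 & SST degB mu kap T.2].
Proof.
move=> gl gm; split=> [[d [nu [[gn pn] _ _ sA sB]]]|[kap [gk sA sB]]].
  exists (nu - rect n d); split.
  - by move=> i j ij; rewrite !zvE; have := gn i j ij; lia.
  - by apply/(SST_translate _ _ _ d); rewrite subrK.
  - by apply/(SST_translate _ _ _ d); rewrite subrK.
pose d := (maxcol kap + maxcol lam + maxcol mu)%N.
have big x : (maxcol x <= d)%N -> gpart x -> part (x + rect n d).
  move=> xd gx; split; first exact: gpart_rect.
  by move=> i; rewrite !zvE; have := maxcol_ge x i; lia.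
exists d, (kap + rect n d); split.
- by apply: big => //; rewrite /d; lia.
- by split; apply: big => //; rewrite /d; lia.
- by split=> i; rewrite !zvE lerD2r; [case: sA|case: sB].
- exact/SST_translate.
- exact/SST_translate.
Qed.

Definition fiber m lam mu : set (filling n A * filling n B) :=
  [set T | SSTpair degA degB lam mu T /\ has_monom T m].

Definition mop m (g : zvec n -> int) : zvec n -> int :=
  hops degA m.1 false (support_seq m.1) (hops degB m.2 true (support_seq m.2) g).

Lemma mop_op m : is_op (mop m).
Proof. exact: op_comp (hops_op _ _ _ _ _) (hops_op _ _ _ _ _). Qed.

Lemma mop_asym m : asym_op (mop m).
Proof. by move=> g ag; apply/hops_asym/hops_asym. Qed.

(** Summing over T^+ evaluates a function at its inner shape. By adjunction this value is a sum over
    the T^- of outer shape mu, in which the alternants test whether the two inner shapes agree. *)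
Lemma fiber_mop m lam mu : gpart lam -> gpart mu ->
  finite_set (fiber m lam mu) /\ (ncard (fiber m lam mu))%:Z = mop m (alt (mu + rho n)) (lam + rho n).
Proof.
move=> gl gm.
pose SA := ST degA m.1 lam (support_seq m.1); pose SB := ST degB m.2 mu (support_seq m.2).
have [fA hA] := ST_sum degA m.1 (sorted_support_seq m.1) gl.
have [fB hB] := ST_sum degB m.2 (sorted_support_seq m.2) gm.
pose P := [set q : (zvec n * filling n A) * (zvec n * filling n B) | (SA `*` SB) q /\ q.1.1 = q.2.1].
have fP : finite_set P by apply: sub_finite_set (finite_setX fA fB) => q [].
have bij : set_bij P (fiber m lam mu) (fun q => (q.1.2, q.2.2)).
  split.
  - move=> [[k1 T1] [k2 T2]] [/= [/ST_supportP[gk sA wA] /ST_supportP[_ sB wB]] ek].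
    rewrite -ek in sB; split; last by split.
    by apply/SSTpairP => //; exists k1.
  - move=> [[k1 T1] [k2 T2]] [[k1' T1'] [k2' T2']] /set_mem [/= [/ST_supportP[_ sA _] _] /= e].
    move=> /set_mem [/= [/ST_supportP[_ sA' _] _] /= e'] [E1 E2].
    rewrite -{}E1 -{}E2 in sA' *; have ek := SST_inner_uniq sA sA'.
    by rewrite -e -e' ek.
  - move=> [T1 T2] [sT [wA wB]].
    have [k [gk sA sB]] := (SSTpairP (T1, T2) gl gm).1 sT.
    exists ((k, T1), (k, T2)) => //; split=> //; split.
      by apply/ST_supportP.
    by apply/ST_supportP.
split; first by have [_ _ surj] := bij; apply: sub_finite_set surj _; exact: finite_image.
rewrite -(ncard_bij bij) ncardE /mop -hA; last exact/hops_asym/alt_asym.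
transitivity (\sum_(p \in SA) \sum_(q \in SB) ((p.1 == q.1)%:R : int)); last first.
  apply: eq_fsbigr => p /set_mem pA; rewrite hops_adj -hB; last exact: alt_asym.
  apply: eq_fsbigr => q /set_mem qB; case: pA qB => gp _ _ _ [gq _ _ _].
  by rewrite alt_strict ?(inj_eq (addIr _)) //; apply: gpart_strict.
rewrite (@pair_fsbig _ _ _ _ _ SA SB (fun p q => ((p.1 == q.1)%:R : int))) //.
rewrite -(@fsbig_widen _ _ _ _ P (SA `*` SB)).
- by apply: eq_fsbigr => q /set_mem [_ ->]; rewrite eqxx.
- by move=> q [].
- by move=> q [Sq nP] /=; case: eqP => // e; case: nP.
Qed.

Lemma schar_mop m lam mu : gpart lam -> gpart mu ->
  schar degA degB lam mu m = mop m (alt (mu + rho n)) (lam + rho n).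
Proof.
move=> gl gm; have [_ <-] := fiber_mop m gl gm; rewrite /schar ncardE.
rewrite -(@fsbig_widen _ _ _ _ (fiber m lam mu)).
- by apply: eq_fsbigr => T /set_mem [_ h]; rewrite asboolT.
- by move=> T [].
- by move=> T [sT nf] /=; case: asboolP => // h; case: nf.
Qed.

Lemma schar_expansion m lam mu : gpart lam -> gpart mu ->
  schar degA degB lam mu m =
  \sum_(nu \in PAB degA degB n) (LRcoef lam mu nu)%:Z * schar0 degA degB nu m.
Proof.
move=> gl gm; have [_ E] := op_expansion (mop_op m) (@mop_asym m) gl gm.
rewrite schar_mop // E; apply/esym.
transitivity (\sum_(nu \in PAB degA degB n) lrc lam mu nu * mop m (alt (0 + rho n)) (nu + rho n)).
  apply: eq_fsbigr => nu /set_mem [gn _].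
  by rewrite LRcoef_lrc // /schar0 schar_mop //; exact: gpart0.
apply: fsbig_widen => [nu []//|nu [gn np]] /=.
rewrite -schar_mop //; last exact: gpart0.
rewrite /schar fsbig1 ?mulr0 // => T sT; case: np; split=> //.
by exists T.
Qed.

End Character.

(** * Counting the classes of Littlewood-Richardson tableaux *)

Section ClassCount.
Variable n : nat.
Hypothesis n0 : (0 < n)%N.
Implicit Types lam mu nu : zvec n.

Lemma min_shift mu : gpart mu -> exists p, forall q, part (mu + rect n q) <-> (p <= q)%N.
Proof.
move=> gm; have [p [pp pmin]] := nat_min (P := fun p => part (mu + rect n p)) (part_maxcol gm).
exists p => q; split=> [pq|pq]; first by rewrite leqNgt; apply/negP => /pmin.
have -> : mu + rect n q = mu + rect n p + rect n (q - p).
  by apply/ffunP => i; rewrite !zvE; lia.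
exact: part_rect.
Qed.

Lemma smallest_ex lam mu nu : gpart lam -> gpart mu -> gpart nu -> exists p q, smallest lam mu nu p q.
Proof.
move=> gl gm gn.
have [a aP] := min_shift gl; have [b bP] := min_shift gm; have [c cP] := min_shift gn.
have adm p q : admissible lam mu nu p q <-> [/\ (b <= p)%N, (c <= q)%N & (a <= p + q)%N].
  split=> [[/bP h1 /cP h2 /aP h3]//|[h1 h2 h3]]; split; [exact/bP|exact/cP|exact/aP].
(* First q as small as nu allows, then p as small as mu and lam allow for this q. *)
exists (maxn b (a - c)), c; split; first by apply/adm; split; lia.
by move=> p' q' /adm[h1 h2 h3] l1 l2; lia.
Qed.

(** The inclusion of nu comes from the symmetry of the coefficients: a tableau with mu and nu
    exchanged exists as well. *)
Lemma LR_sub lam mu nu Q : LR lam mu nu Q -> subdiag mu lam /\ subdiag nu lam.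
Proof.
move=> L; have [[pl pm pn] [sub _] _ _ _] := L; split=> //.
have [gl _] := pl; have [gm _] := pm; have [gn _] := pn.
have pos : (0 < LRnum lam nu mu)%N.
  have : (LRnum lam nu mu)%:Z = LRnum lam mu nu by rewrite !LRnum_lrc // lrcC.
  by move=> [->]; apply: (ncard_gt0 (LR_finite lam mu nu) L).
have [E|/eqP/eqP/set0P[Q' [_ [s _] _ _ _]]] := eqVneq (LR lam nu mu) set0 => //.
by move: pos; rewrite -[LRnum _ _ _]/(ncard (LR lam nu mu)) E ncard0.
Qed.

(* When several pairs (p, q) are smallest, lam + ((p+q)^n) has a zero entry where
   mu + (p^n) or nu + (q^n) has none, and there is no tableau. *)
Lemma bLR_count lam mu nu : gpart lam -> gpart mu -> gpart nu ->
  finite_set (bLR lam mu nu) /\ (ncard (bLR lam mu nu))%:Z = lrc lam mu nu.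
Proof.
move=> gl gm gn; have [p [q sm]] := smallest_ex gl gm gn.
have [[pm pn pl] _] := sm.
have gnum : (LRnum (lam + rect n (p + q)) (mu + rect n p) (nu + rect n q))%:Z = lrc lam mu nu.
  by rewrite LRnum_lrc // lrc_shift.
pose L := LR (lam + rect n (p + q)) (mu + rect n p) (nu + rect n q).
have uniq p' q' Q : smallest lam mu nu p' q' ->
    LR (lam + rect n (p' + q')) (mu + rect n p') (nu + rect n q') Q -> p' = p /\ q' = q.
  move=> [[pm' pn' pl'] mn'] LQ; have [s1 s2] := LR_sub LQ.
  have [a aP] := min_shift gl; have [b bP] := min_shift gm; have [c cP] := min_shift gn.
  have adm x y : admissible lam mu nu x y <-> [/\ (b <= x)%N, (c <= y)%N & (a <= x + y)%N].
    split=> [[/bP h1 /cP h2 /aP h3]//|[h1 h2 h3]]; split; [exact/bP|exact/cP|exact/aP].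
  (* If lam allowed a smaller sum, each of x and y could be lowered unless it is already minimal for
     mu or nu. *)
  have shrink x y : smallest lam mu nu x y -> (x = b /\ y = c) \/ (a = x + y)%N.
    move=> [/adm[h1 h2 h3] mn]; have [e|lt] : (a = x + y)%N \/ (a < x + y)%N by lia.
      by right.
    left; split; apply/eqP/negPn/negP => ne.
      by have [|||e _] := mn x.-1 y; [apply/adm; split; lia|lia|lia|lia].
    by have [|||_ e] := mn x y.-1; [apply/adm; split; lia|lia|lia|lia].
  have tight x y : ((x = b /\ y = c) \/ (a = x + y)%N) ->
    (b <= x)%N -> (c <= y)%N -> subdiag (mu + rect n x) (lam + rect n (x + y)) ->
    subdiag (nu + rect n y) (lam + rect n (x + y)) -> x = b /\ y = c.
    move=> [//|axy] bx cy sb1 sb2.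
    have [z z0] : exists i, lam i + (x + y)%N%:Z <= 0 \/ (x + y)%N = 0%N.
      have [a0|apos] := posnP (x + y)%N; first by exists (Ordinal n0); right.
      apply: contrapT => H; have /aP : part (lam + rect n (x + y).-1).
        split; first exact: gpart_rect.
        move=> i; rewrite !zvE; have : ~ (lam i + (x + y)%N%:Z <= 0) by move=> h; apply: H; exists i; left.
        lia.
      lia.
    case: z0 => [z0|z0]; last by lia.
    split; apply/eqP/negPn/negP => ne.
      have /bP : (b <= x.-1)%N by lia.
      move=> [_ /(_ z)]; have := sb1 z; rewrite !zvE; lia.
    have /cP : (c <= y.-1)%N by lia.
    move=> [_ /(_ z)]; have := sb2 z; rewrite !zvE; lia.
  have [h1 h2 h3] := (adm p' q').1 (And3 pm' pn' pl').
  have [ep eq] : p' = b /\ q' = c by apply: tight => //; apply: shrink.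
  have [h4 h5 h6] := (adm p q).1 (And3 pm pn pl).
  by case: sm => _ mn; have [-> ->] := mn p' q' (And3 pm' pn' pl') ltac:(lia) ltac:(lia).
have [E|/eqP/eqP/set0P[Q0 LQ0]] := eqVneq L set0.
  have -> : bLR lam mu nu = set0.
    apply/seteqP; split => C // -[p' [q' [sm' [Q LQ _]]]].
    have [ep eq] := uniq _ _ _ sm' LQ; rewrite ep eq in LQ.
    by have : L Q by []; rewrite E.
  rewrite -gnum -[LRnum _ _ _]/(ncard L) E !ncard0; split=> //; exact: finite_set0.
have -> : bLR lam mu nu = LRclass (mu + rect n p) (nu + rect n q) @` L.
  apply/seteqP; split => C.
    move=> [p' [q' [sm' [Q LQ ->]]]]; have [ep eq] := uniq _ _ _ sm' LQ.
    by rewrite ep eq in LQ *; exists Q.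
  by move=> [Q LQ <-]; exists p, q; split=> //; exists Q.
have fL : finite_set L by apply: LR_finite.
split; first exact: finite_image.
rewrite -gnum -[LRnum _ _ _]/(ncard L); congr Posz; apply/esym.
apply: (@ncard_bij _ _ _ _ (LRclass (mu + rect n p) (nu + rect n q))); split.
- by move=> Q LQ; exists Q.
- by move=> Q Q' /set_mem LQ /set_mem LQ'; apply: LRclass_inj LQ LQ'.
- by move=> C.
Qed.

End ClassCount.

(** * The bijection *)

Section Bijection.
Variables (dA : Order.disp_t) (A : orderType dA) (degA : A -> bool).
Variables (dB : Order.disp_t) (B : orderType dB) (degB : B -> bool).
Variable n : nat.
Hypothesis n0 : (0 < n)%N.
Variables lam mu : zvec n.
Hypotheses (gl : gpart lam) (gm : gpart mu).
Local Notation tableaux := (filling n A * filling n B)%type.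
Local Notation target := (zvec n * (tableaux * set (filling n nat)))%type.
Implicit Types (T : tableaux) (m : monom A B) (x : target).

Definition ufiber m : set target := [set x | LRunion degA degB lam mu x /\ has_monom x.2.1 m].

(** Restricting to nonzero coefficients makes the set of shapes finite, by [op_expansion];
    membership in [PAB] is witnessed by the tableau pair itself. *)
Lemma ufiberE m : ufiber m = [set x : target |
  (gpart x.1 /\ lrc lam mu x.1 != 0) /\ (fiber degA degB m x.1 0 `*` bLR lam mu x.1) x.2].
Proof.
apply/seteqP; split => -[nu [T C]] /=.
  move=> [[[gn _] sT bC] h]; split=> //; split=> //.
  have [fb <-] := bLR_count n0 gl gm gn.
  by rewrite eqz_nat -lt0n; apply: ncard_gt0 fb bC.
move=> [[gn _] [[sT h] bC]]; split=> //; split=> //.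
by split=> //; exists T.
Qed.

Lemma ufiber_count m : finite_set (ufiber m) /\ ncard (ufiber m) = ncard (fiber degA degB m lam mu).
Proof.
have gz := @gpart0 n; rewrite ufiberE.
have [fK E] := op_expansion (@mop_op _ _ degA _ _ degB n m) (@mop_asym _ _ degA _ _ degB n m) gl gm.
set K := [set kap | _] in fK.
have fin nu : K nu -> finite_set (fiber degA degB m nu 0 `*` bLR lam mu nu).
  move=> [gn _]; apply: finite_setX; first by have [] := fiber_mop degA degB m gn gz.
  by have [] := bLR_count n0 gl gm gn.
split; first exact: (finite_sigma fK fin).
apply/eqP; rewrite -eqz_nat ncardE.
rewrite -(@fsbig_sigma _ _ K (fun nu => fiber degA degB m nu 0 `*` bLR lam mu nu) (fun _ _ => 1%:Z)) //.
have [_ ->] := fiber_mop degA degB m gl gm; rewrite E; apply/eqP.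
transitivity (\sum_(kap \in K) lrc lam mu kap * mop degA degB m (alt (0 + rho n)) (kap + rho n)).
  apply: eq_fsbigr => kap /set_mem [gk _].
  have [f1 <-] := fiber_mop degA degB m gk gz; have [f2 <-] := bLR_count n0 gl gm gk.
  by rewrite -ncardE ncardX // mulnC PoszM.
apply: fsbig_widen => [kap []//|kap [gk nk]] /=.
suff -> : lrc lam mu kap = 0 by rewrite mul0r.
by apply/eqP/negPn/negP => h; apply: nk.
Qed.

Lemma monom_ex T : SSTpair degA degB lam mu T -> exists m, has_monom T m.
Proof.
move=> /(SSTpairP _ _ _ gl gm)[kap [_ sA sB]].
have [e1 h1] := fsfun_of_wt sA; have [e2 h2] := fsfun_of_wt sB.
by exists (e1, e2).
Qed.

Lemma monom_uniq T m m' : has_monom T m -> has_monom T m' -> m = m'.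
Proof.
case: m m' => [e f] [e' f'] [/= h1 h2] [/= h3 h4].
by congr pair; apply/fsfunP => a; rewrite -?h1 -?h3 -?h2 -?h4.
Qed.

(** One bijection is chosen for each monomial and applied to T at the monomial of T. Injectivity
    holds across monomials because the image still determines its monomial. *)
Lemma bijection_ex : exists J : tableaux -> target,
  set_bij (SSTpair degA degB lam mu) (LRunion degA degB lam mu) J /\
  forall T, SSTpair degA degB lam mu T ->
    wt (J T).2.1.1 =1 wt T.1 /\ wt (J T).2.1.2 =1 wt T.2.
Proof.
have /(_ _)/cid-/all_sig[f fP] : forall m, exists f, set_bij (fiber degA degB m lam mu) (ufiber m) f.
  move=> m; have [fu E] := ufiber_count m; have [ff _] := fiber_mop degA degB m gl gm.
  exact: (bij_of_ncard (0, ((fun=> None, fun=> None), set0))).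
pose mon T : monom A B :=
  if pselect (exists m, has_monom T m) is left h then sval (cid h) else ([fsfun], [fsfun]).
have monP T : SSTpair degA degB lam mu T -> has_monom T (mon T).
  move=> /monom_ex h; rewrite /mon; case: pselect => // h'.
  by case: (cid h').
have inF T : SSTpair degA degB lam mu T -> fiber degA degB (mon T) lam mu T.
  by move=> sT; split=> //; exact: monP.
have Jm T : SSTpair degA degB lam mu T -> ufiber (mon T) (f (mon T) T).
  by move=> /inF h; have [fu _ _] := fP (mon T); apply: fu.
exists (fun T => f (mon T) T); split; first split.
- by move=> T /Jm[].
- move=> T T' /set_mem sT /set_mem sT' E.
  have em : mon T = mon T'.
    by apply: (monom_uniq (T := (f (mon T) T).2.1)); [case: (Jm _ sT)|rewrite E; case: (Jm _ sT')].
  have [_ inj _] := fP (mon T); apply: inj; [exact/mem_set/inF| |by rewrite E em].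
  by rewrite em; apply/mem_set/inF.
- move=> x Lx; have [m hm] : exists m, has_monom x.2.1 m.
    case: (Lx) => -[gx _] + _ => /(SSTpairP _ _ _ gx (@gpart0 n))[kap [_ sA sB]].
    have [e1 h1] := fsfun_of_wt sA; have [e2 h2] := fsfun_of_wt sB.
    by exists (e1, e2).
  have [_ _ /(_ x (conj Lx hm))[T [sT hT] <-]] := fP m.
  by exists T => //; rewrite (monom_uniq (monP _ sT) hT).
- move=> T sT; have [_ [h1 h2]] := Jm _ sT; have [h3 h4] := monP _ sT.
  by split=> a; rewrite ?h1 ?h2 ?h3 ?h4.
Qed.

End Bijection.

Theorem theorem4p11
  (dA : Order.disp_t) (A : orderType dA) (degA : A -> bool)
  (dB : Order.disp_t) (B : orderType dB) (degB : B -> bool)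
  (countA : countable [set: A]) (countB : countable [set: B])
  (n : nat) (n_ge1 : (1 <= n)%N)
  (lam mu : {ffun 'I_n -> int}) (lamP : gpart lam) (muP : gpart mu) :
  (exists J : filling n A * filling n B ->
              {ffun 'I_n -> int} *
                ((filling n A * filling n B) * set (filling n nat)),
     set_bij (SSTpair degA degB lam mu) (LRunion degA degB lam mu) J /\
     (forall T, SSTpair degA degB lam mu T ->
        wt (J T).2.1.1 =1 wt T.1 /\ wt (J T).2.1.2 =1 wt T.2))
  /\
  (forall m : monom A B,
     schar degA degB lam mu m =
     \sum_(nu \in PAB degA degB n)
        (LRcoef lam mu nu)%:Z * schar0 degA degB nu m).
Proof.
split; first exact: bijection_ex.
by move=> m; apply: schar_expansion.
Qed.
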